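(* Let the setting be as described in the context: $X=\{X_s\}_{s\in S}$ and $Y=\{Y_t\}_{t\in T}$ are time-homogeneous Markov (or sub-Markov) processes satisfying Assumption (A1) of the context, with associated $\mu,\nu,\mathcal F,\phi,\psi$. Assume in addition that the measure $\mu$ is excessive for $X$ and the measure $\nu$ is excessive for $Y$. Let $\mathfrak s\in S$, $\mathfrak t\in T$, and let $s:[0,1]\to[0,\mathfrak s]$ and $t:[0,1]\to[0,\mathfrak t]$ be two increasing and right-continuous functions with $s(0)=t(0)=0$, $s(1)=\mathfrak s$ and $t(1)=\mathfrak t$. Assume that $f:\mathcal X\to\mathbb C$ and $g:\mathcal Y\to\mathbb C$ are functions such that $f\in L^2(\mathcal X,\mu)$ and $g=\mathcal Ff$. Denote $$\mathsf F(x):=\mathbb E\Big[e^{-\int_{(0,1]}\psi(X_{s(w-)})\,\mathrm dt(w)}f(X_{\mathfrak s})\,\Big|\,X_0=x\Big],\quad x\in\mathcal X,$$ $$\mathsf G(y):=\mathbb E\Big[e^{-\int_{(0,1]}\phi(Y_{t(w)})\,\mathrm ds(w)}g(Y_{\mathfrak t})\,\Big|\,Y_0=y\Big],\quad y\in\mathcal Y.$$ Then $\mathsf F\in L^2(\mathcal X,\mu)$ and $\mathsf G=\mathcal F\,\mathsf F$.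
   Context: Setting. $S$ and $T$ are real intervals of the form $[0,b]$ ($b>0$) or $[0,\infty)$. $X=\{X_s\}_{s\in S}$ and $Y=\{Y_t\}_{t\in T}$ are Markov (or sub-Markov) processes with càdlàg paths, with values in $\mathcal X\subseteq\mathbb R$ and $\mathcal Y\subseteq\mathbb R$ respectively; each of $\mathcal X,\mathcal Y$ is an interval (possibly infinite or semi-infinite) or a countable set. Their semigroups are $\mathcal P_{s_1,s_2}f(x)=\mathbb E[f(X_{s_2})\mid X_{s_1}=x]$ and $\mathcal Q_{t_1,t_2}g(y)=\mathbb E[g(Y_{t_2})\mid Y_{t_1}=y]$ for bounded Borel measurable $f,g$. (For sub-Markov processes, functionals are taken to be zero if the process has been killed.) Assumption (A1). There exist: (i) two Hilbert spaces $L^2(\mathcal X,\mu)$, $L^2(\mathcal Y,\nu)$ of complex-valued functions and a unitary operator $\mathcal F:L^2(\mathcal X,\mu)\to L^2(\mathcal Y,\nu)$; (ii) continuous functions $\phi:\mathcal Y\to\mathbb C^+$ and $\psi:\mathcal X\to\mathbb C^+$, where $\mathbb C^+=\{z\in\mathbb C:\mathrm{Re}(z)\ge0\}$; such that for all $s_1<s_2$ in $S$, $t_1<t_2$ in $T$, $$\mathcal P_{s_1,s_2}f=\mathcal F^{-1}e^{(s_1-s_2)\phi}\mathcal Ff,\qquad \mathcal Q_{t_1,t_2}g=\mathcal Fe^{(t_1-t_2)\psi}\mathcal F^{-1}g$$ for all bounded Borel measurable $f\in L^2(\mathcal X,\mu)$ and $g\in L^2(\mathcal Y,\nu)$, where $e^{(s_1-s_2)\phi}$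 and $e^{(t_1-t_2)\psi}$ are multiplication operators. In particular the processes are time-homogeneous, with semigroups $\mathcal P_s$ and $\mathcal Q_t$. A $\sigma$-finite measure $\mu$ is excessive for $X$ if $\mu\mathcal P_s\le\mu$ for all $s>0$ (and similarly for $\nu$, $Y$, $\mathcal Q_t$). $s(w-)$ denotes the left limit of $s$ at $w$; the integrals in the exponents are Lebesgue–Stieltjes integrals. Convention on expectations. If $\xi$ is a bounded functional of the path of $X$ on $[0,\mathfrak s]$ and $f\in L^2(\mathcal X,\mu)$, the function $x\mapsto\mathbb E[\xi f(X_{\mathfrak s})\mid X_0=x]$ is understood as the value at $f$ of the unique continuous extension to $L^2(\mathcal X,\mu)$ of the operator $f\mapsto\mathbb E[\xi f(X_{\mathfrak s})\mid X_0=\cdot]$, originally defined for bounded $f\in L^2(\mathcal X,\mu)$. The same convention applies to $Y$ and $L^2(\mathcal Y,\nu)$. Equalities are between elements of $L^2$ spaces. *)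

(* Defs.v *)
From HB Require Import structures.
From mathcomp Require Import all_boot all_order all_algebra.
From mathcomp Require Import complex.
From mathcomp Require Import all_classical all_reals all_analysis.
From mathcomp Require Import measurable_realfun.

Set Implicit Arguments.
Unset Strict Implicit.
Unset Printing Implicit Defensive.
Import Order.TTheory GRing.Theory Num.Theory.
Import numFieldNormedType.Exports.

Local Open Scope classical_set_scope.
Local Open Scope complex_scope.
Local Open Scope ring_scope.

Section complex_functions.
Context {R : realType}.
Implicit Types (z : R[i]).

Definition expC z : R[i] :=
  (expR (complex.Re z) * cos (complex.Im z)) +i*
  (expR (complex.Re z) * sin (complex.Im z)).

Context {d : measure_display} {T : measurableType d}.
Implicit Types (mu : {measure set T -> \bar R}) (D : set T) (f g : T -> R[i]).

Definition measurable_funC D f :=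
  measurable_fun D (fun x => complex.Re (f x)) /\
  measurable_fun D (fun x => complex.Im (f x)).

Definition boundedC D f :=
  exists M : R, forall x, D x -> Normc.normc (f x) <= M.

Definition integralC mu D f : R[i] :=
  (\int[mu]_(x in D) complex.Re (f x)) +i* (\int[mu]_(x in D) complex.Im (f x)).

(* Elements of the complex Hilbert space L^2(D, mu) are handled through their
   representatives f : T -> R[i]: only the values on D matter, and equality in
   L^2(D, mu) is the library's [f = g %[ae mu in D]]. *)
Definition L2norm mu D f : \bar R :=
  'N[mu]_2%:E[(fun x => (Normc.normc (f x))%:E) \_ D].

Definition inL2 mu D f := measurable_funC D f /\ (L2norm mu D f < +oo)%E.

Definition L2dot mu D f g : R[i] := integralC mu D (fun x => f x * (g x)^*).

Definition bounded_inL2 mu D f := inL2 mu D f /\ boundedC D f.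

End complex_functions.

Record unitaryL2 {R : realType} {d d' : measure_display}
    {T : measurableType d} {T' : measurableType d'}
    (mu : {measure set T -> \bar R}) (D : set T)
    (nu : {measure set T' -> \bar R}) (D' : set T')
    (U : (T -> R[i]) -> (T' -> R[i])) (V : (T' -> R[i]) -> (T -> R[i])) :
    Prop := UnitaryL2 {
  unitary_dom : forall f, inL2 mu D f -> inL2 nu D' (U f) ;
  unitary_cod : forall g, inL2 nu D' g -> inL2 mu D (V g) ;
  unitary_linear : forall (a : R[i]) f g, inL2 mu D f -> inL2 mu D g ->
    U (fun x => a * f x + g x) = (fun y => a * U f y + U g y) %[ae nu in D'] ;
  unitary_dot : forall f g, inL2 mu D f -> inL2 mu D g ->
    L2dot nu D' (U f) (U g) = L2dot mu D f g ;
  unitaryK : forall f, inL2 mu D f -> V (U f) = f %[ae mu in D] ;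
  unitaryVK : forall g, inL2 nu D' g -> U (V g) = g %[ae nu in D'] }.

(* B is a continuous map of L^2(D, mu) into itself that coincides with A on the
   bounded elements of L^2(D, mu). Bounded elements being dense, such a B is
   unique (as a map on a.e.-classes). *)
Record continuous_extensionL2 {R : realType} {d : measure_display}
    {T : measurableType d} (mu : {measure set T -> \bar R}) (D : set T)
    (A B : (T -> R[i]) -> (T -> R[i])) : Prop := ContinuousExtensionL2 {
  extension_dom : forall f, inL2 mu D f -> inL2 mu D (B f) ;
  extension_continuous : forall f, inL2 mu D f ->
    forall e : R, 0 < e -> exists2 r : R, 0 < r &
    forall h, inL2 mu D h ->
      (L2norm mu D (fun x => h x - f x)%R < r%:E)%E ->
      (L2norm mu D (fun x => B h x - B f x)%R < e%:E)%E ;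
  extensionE : forall f, bounded_inL2 mu D f -> B f = A f %[ae mu in D] }.

Definition time_interval {R : realType} (S : set R) :=
  (exists2 b : R, 0 < b & S = `[0, b]%classic) \/ S = `[0, +oo[%classic.

Definition state_space {R : realType} (D : set R) :=
  is_interval D \/ countable D.

(* Raw data of a time-homogeneous, possibly killed, process: [position u w] is
   the position at time u, meaningful for u < lifetime w (the killing time, +oo
   if there is no killing), and [start_law x] is the probability given X_0 = x.
*)
Record process (R : realType) {d : measure_display} (O : measurableType d) :=
  Process {
  position : R -> O -> R ;
  lifetime : O -> \bar R ;
  start_law : R -> probability O R }.

Section markov.
Context {R : realType} {d : measure_display} {O : measurableType d}.
Implicit Types (X : process R O) (S D B : set R).

Definition alive_in X (u : R) B : set O :=
  [set w | (u%:E < lifetime X w)%E /\ B (position X u w)].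

Definition history X S (u : R) : set (set O) :=
  <<s [set alive_in X v B | v in S `&` [set v | v <= u] & B in measurable] >>.

(* Cadlag in D on the lifetime: left limits are required to lie in D. The trace
   [within S] matters only at the right end of S. *)
Definition cadlag_path X S D (w : O) :=
  forall u, S u -> (u%:E < lifetime X w)%E ->
    [/\ D (position X u w),
        position X v w @[v --> within S u^'+] --> position X u w
      & 0 < u -> exists2 l, D l & position X v w @[v --> u^'-] --> l].

Record markov_process X S D : Prop := MarkovProcess {
  markov_measurable : forall u B, S u -> measurable B ->
    measurable (alive_in X u B) ;
  markov_cadlag : forall w, cadlag_path X S D w ;
  markov_kernel : forall u B, S u -> measurable B ->
    measurable_fun D (fun x => start_law X x (alive_in X u B)) ;
  markov_start : forall x, D x -> start_law X x (alive_in X 0 [set x]) = 1%E ;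
  markov_property : forall x u v A B, D x -> S u -> S v -> u <= v ->
    history X S u A -> measurable B ->
    start_law X x (A `&` alive_in X v B) =
    (\int[start_law X x]_(w in A `&` alive_in X u setT)
       start_law X (position X u w) (alive_in X (v - u) B))%E }.

(* E[xi | X_0 = x] for a functional xi of the path on [0, u], taken to be zero
   if the process has been killed by time u. *)
Definition expectation_alive X (u : R) (xi : O -> R[i]) (x : R) : R[i] :=
  integralC (start_law X x) (alive_in X u setT) xi.

Definition semigroup X (u : R) (f : R -> R[i]) (x : R) : R[i] :=
  expectation_alive X u (fun w => f (position X u w)) x.

Record excessive X S D (mu : {measure set R -> \bar R}) : Prop := Excessive {
  excessive_sigma_finite : sigma_finite D mu ;
  excessive_le : forall u B, S u -> 0 < u -> measurable B -> B `<=` D ->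
    (\int[mu]_(x in D) start_law X x (alive_in X u B) <= mu B)%E }.

End markov.

Record continuous_Cplus {R : realType} (D : set R) (h : R -> R[i]) : Prop :=
  ContinuousCplus {
  Cplus_continuous : {within D, continuous (h : R -> R[i]^o)} ;
  Cplus_ge0 : forall x, D x -> 0 <= complex.Re (h x) }.

Record dual_semigroups {R : realType} {d d' : measure_display}
    {O : measurableType d} {O' : measurableType d'}
    (X : process R O) (S D : set R) (Y : process R O') (S' D' : set R)
    (mu nu : {measure set R -> \bar R})
    (F Finv : (R -> R[i]) -> (R -> R[i])) (phi psi : R -> R[i]) : Prop :=
  DualSemigroups {
  dual_unitary : unitaryL2 mu D nu D' F Finv ;
  dual_phi : continuous_Cplus D' phi ;
  dual_psi : continuous_Cplus D psi ;
  dual_semigroup1 : forall s1 s2, S s1 -> S s2 -> s1 < s2 ->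
    forall f, bounded_inL2 mu D f ->
    semigroup X (s2 - s1) f =
    Finv (fun y => expC ((s1 - s2)%:C * phi y) * F f y) %[ae mu in D] ;
  dual_semigroup2 : forall t1 t2, S' t1 -> S' t2 -> t1 < t2 ->
    forall g, bounded_inL2 nu D' g ->
    semigroup Y (t2 - t1) g =
    F (fun x => expC ((t1 - t2)%:C * psi x) * Finv g x) %[ae nu in D'] }.

(* Lebesgue-Stieltjes integral over (0, 1]; it depends only on the restriction
   of c to [0, 1]. *)
Definition stieltjes01 {R : realType} (c : cumulative R R) (h : R -> R[i]) :
    R[i] :=
  integralC (lebesgue_stieltjes_measure c) `]0, 1] h.

Definition left_limit {R : realType} (c : R -> R) (r : R) : R := lim (c @ r^'-).

(* Main.v *)
Require Import Defs.
From HB Require Import structures.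
From mathcomp Require Import all_boot all_order all_algebra.
From mathcomp Require Import complex.
From mathcomp Require Import all_classical all_reals all_analysis.
From mathcomp Require Import measurable_realfun.
From mathcomp Require Import ring lra.

Set Implicit Arguments.
Unset Strict Implicit.
Unset Printing Implicit Defensive.
Import Order.TTheory GRing.Theory Num.Theory.
Import numFieldNormedType.Exports.

Local Open Scope classical_set_scope.
Local Open Scope complex_scope.
Local Open Scope ring_scope.

(* Discretize the curve r |-> (s r, t r), completed at its jumps by first a
   vertical and then a horizontal segment, into a staircase.  For a staircase
   both functionals are compositions, in matching order, of the operators
   exp(-a psi) (multiplication) and P_b on one side, and of Q_a and
   exp(-b phi) on the other; since the unitary F intertwines exp(-a psi) with
   Q_a and P_b with exp(-b phi), the duality is then immediate.

   For the limit, the corners of the staircases are the points of the curve,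
   and their left limits, at the points of partitions of [0, 1] that exhaust a
   countable dense set containing the discontinuities of t.  Then the step
   functions approximating Y_(t r) converge everywhere by right continuity, and
   those approximating X_(s(r-)) converge outside the points r at which s
   approaches a jump time of X strictly from the left; there are countably many
   of these, and those outside the dense set carry no mass of dt.  Hence the
   functionals converge pathwise, and by dominated convergence in L^2 for
   bounded f: by Jensen's inequality and excessiveness, |E[xi f(X)]|^2 is
   dominated by the integrable function P(|f|^2).  The same bound shows that the
   expectation itself, restricted to the points where P(|f|^2) is finite, is the
   continuous extension to unbounded f. *)

(** * Induction on measurable functions *)

Section function_induction.
Import HBNNSimple.

(** The obstacle is boundedness. (A1) and the convergence of the staircase functionals are available
    for bounded functions only, and [F] need not send a bounded function to a bounded one, so an
    approximation of [f] cannot simply be transported to [g]. Instead [f] and [g] get bounded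
    approximations [h] and [k] that are chosen independently. Rewritten through [F], the staircase
    operators act on all of L^2 and are contractions; exact duality is then invoked for [f] and [g]
    themselves, and the mismatch between [k] and [F h] costs a fixed multiple of the approximation
    error, uniformly in the staircase. The order chosen at jumps dictates the asymmetry of the
    theorem: the coordinate t moves before s, so X is read before its own time s jumps, at s(r-),
    while Y is read after its time t has jumped, at t(r). Apart from this order the two sides are
    symmetric, so results about one process are proved for a generic one and used twice. *)

Lemma nnsfun_seq {d} {T : measurableType d} {R : realType}
    (f : {nnsfun T >-> R}) :
  exists s : seq (R * set T),
    (forall p, p \in s -> 0 <= p.1 /\ measurable p.2) /\
    forall x, f x = \sum_(p <- s) p.1 * \1_(p.2) x.
Proof.
exists [seq (y, f @^-1` [set y]) | y <- finmap.enum_fset (fset_set (range f))]; split.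
  move=> p /mapP[y]; rewrite in_fset_set// inE => -[x _ <-] -> /=; split => //.
move=> x; rewrite big_map (fimfunE f x) fsbig_finite//=.
Qed.

(** Closure under uniformly bounded pointwise limits is what dominated convergence under a finite
    measure provides. Simple functions are reached by induction on their list of levels, the others
    by simple approximation. *)
Lemma bounded_measurable_ind {d} {T : measurableType d} {R : realType}
    (P : (T -> R) -> Prop) :
  (forall A, measurable A -> P \1_A) ->
  (forall (a : R) (f g : T -> R), measurable_fun setT f -> measurable_fun setT g ->
     bounded_fun f -> bounded_fun g -> P f -> P g ->
     P (fun x => a * f x + g x)) ->
  (forall (f_ : nat -> T -> R) (f : T -> R) (M : R), (forall n, measurable_fun setT (f_ n)) ->
     (forall n x, `|f_ n x| <= M) -> (forall x, f_ n x @[n --> \oo] --> f x) ->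
     (forall n, P (f_ n)) -> P f) ->
  forall (f : T -> R) (M : R), measurable_fun setT f -> (forall x, `|f x| <= M) -> P f.
Proof.
move=> P1 PD Pl.
have bddI (A : set T) : bounded_fun (\1_A : T -> R).
  exists 1; split; first exact: num_real.
  move=> M M1 x _; rewrite /= ger0_norm ?ler0n//.
  by rewrite (le_trans _ (ltW M1))// indicE; case: (_ \in _); rewrite ?lexx.
have Pn (g : {nnsfun T >-> R}) : P g.
  have [s [sP gE]] := nnsfun_seq g.
  rewrite (_ : (g : T -> R) = fun x => \sum_(p <- s) p.1 * \1_(p.2) x); last first.
    exact/funext.
  suff : measurable_fun setT (fun x => \sum_(p <- s) p.1 * \1_(p.2) x) /\
         P (fun x => \sum_(p <- s) p.1 * \1_(p.2) x) by case.
  elim: s sP {gE} => [_|p s IH sP].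
    rewrite (_ : (fun _ => _) = \1_(set0 : set T)).
      by split; [exact: measurable_indic|exact: P1].
    by apply/funext => x; rewrite big_nil indic0.
  have sP' q : q \in s -> 0 <= q.1 /\ measurable q.2.
    by move=> qs; apply: sP; rewrite inE qs orbT.
  have {IH} [ms IH] := IH sP'.
  have [p0 mp2] := sP p (mem_head _ _).
  rewrite (_ : (fun _ => _) = fun x => p.1 * \1_(p.2) x + \sum_(q <- s) q.1 * \1_(q.2) x);
    last first.
    by apply/funext => x; rewrite big_cons.
  split.
    by apply: measurable_funD => //; apply: measurable_funM => //; exact: measurable_indic.
  apply: PD => //; [|exact: P1].
  exists (\sum_(q <- s) `|q.1|); split; first exact: num_real.
  move=> M M1 x _.
  apply: le_trans (ltW M1); apply: (le_trans (ler_norm_sum _ _ _)).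
  apply: ler_sum => q _; rewrite normrM ler_piMr// ger0_norm//.
move=> f M mf fM.
pose g x := f x + M.
have g0 x : (0 <= (g x)%:E)%E.
  by rewrite lee_fin -lerBlDr sub0r lerNl; have := fM x; rewrite ler_norml lerNl => /andP[].
have mg : measurable_fun setT (EFin \o g).
  by apply/measurable_EFinP/measurable_funD.
pose h := nnsfun_approx measurableT mg.
have hg x : h n x @[n --> \oo] --> g x.
  have /fine_cvgP[_] := @cvg_nnsfun_approx _ _ _ _ measurableT _ mg (fun x _ => g0 x) x I.
  exact.
have gM x : g x <= 2 * M.
  by rewrite /g mulr2n mulrDl mul1r lerD2r; have := fM x; rewrite ler_norml => /andP[].
have hM n x : `|h n x| <= 2 * M.
  rewrite ger0_norm//; apply: le_trans (gM x); rewrite -lee_fin.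
  rewrite /h nnsfun_approxE.
  by apply: (@le_approx _ _ _ setT (EFin \o g)) => // y _; exact: g0.
have Pg : P g.
  exact: (Pl h g (2 * M)).
have -> : f = fun x => (- M) * \1_setT x + g x.
  by apply/funext => x; rewrite indicT mulr1 /g addrC addrK.
apply: PD => //; [exact: measurable_funD| |exact: P1].
exists (2 * M); split; first exact: num_real.
move=> K K1 x _; apply: le_trans (ltW K1).
by rewrite ger0_norm ?gM// -lee_fin.
Qed.

(** Variant for integrals that may be infinite, where nothing can be subtracted: coefficients are
    nonnegative and limits increasing, so that monotone convergence suffices. *)
Lemma ge0_measurable_ind {d} {T : measurableType d} {R : realType}
    (P : (T -> \bar R) -> Prop) :
  (forall A, measurable A -> P (EFin \o \1_A)) ->
  (forall (a : R) (f g : T -> \bar R), measurable_fun setT f -> measurable_fun setT g ->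
     (forall x, 0 <= f x)%E -> (forall x, 0 <= g x)%E -> 0 <= a -> P f -> P g ->
     P (fun x => a%:E * f x + g x)%E) ->
  (forall (f_ : nat -> T -> \bar R) (f : T -> \bar R), (forall n, measurable_fun setT (f_ n)) ->
     (forall n x, 0 <= f_ n x)%E ->
     (forall x, nondecreasing_seq (f_ ^~ x)) ->
     (forall x, f_ n x @[n --> \oo] --> f x) ->
     (forall n, P (f_ n)) -> P f) ->
  forall f : T -> \bar R, measurable_fun setT f -> (forall x, 0 <= f x)%E -> P f.
Proof.
move=> P1 PD Pl.
have Pn (g : {nnsfun T >-> R}) : P (EFin \o g).
  have [s [sP gE]] := nnsfun_seq g.
  rewrite (_ : EFin \o g = fun x => (\sum_(p <- s) p.1 * \1_(p.2) x)%:E); last first.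
    by apply/funext => x /=; rewrite gE.
  suff : measurable_fun setT (fun x => (\sum_(p <- s) p.1 * \1_(p.2) x)%:E) /\
         P (fun x => (\sum_(p <- s) p.1 * \1_(p.2) x)%:E) by case.
  elim: s sP {gE} => [_|p s IH sP].
    rewrite (_ : (fun _ => _) = EFin \o \1_(set0 : set T)).
      by split; [exact/measurable_EFinP/measurable_indic|exact: P1].
    by apply/funext => x; rewrite big_nil /= indic0.
  have sP' q : q \in s -> 0 <= q.1 /\ measurable q.2.
    by move=> qs; apply: sP; rewrite inE qs orbT.
  have {IH} [ms IH] := IH sP'.
  have [p0 mp2] := sP p (mem_head _ _).
  rewrite (_ : (fun _ => _) = fun x =>
    p.1%:E * (EFin \o \1_(p.2)) x + (\sum_(q <- s) q.1 * \1_(q.2) x)%:E)%E; last first.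
    by apply/funext => x; rewrite big_cons EFinD EFinM.
  split.
    apply: emeasurable_funD => //; apply: measurable_funeM.
    exact/measurable_EFinP/measurable_indic.
  apply: PD => //.
  - exact/measurable_EFinP/measurable_indic.
  - by move=> x; rewrite /= lee_fin indicE ler0n.
  - move=> x; rewrite lee_fin big_seq; apply: sumr_ge0 => q qs.
    by rewrite mulr_ge0//; case: (sP' q qs).
  - exact: P1.
move=> f mf f0.
pose h := nnsfun_approx measurableT mf.
apply: (Pl (fun n => EFin \o h n)) => //.
- by move=> n; exact/measurable_EFinP.
- by move=> n x; rewrite /= lee_fin.
- move=> x m n mn; rewrite /= lee_fin.
  exact/lefP/(nd_nnsfun_approx measurableT mf mn).
- move=> x; exact: (@cvg_nnsfun_approx _ _ _ _ measurableT _ mf (fun x _ => f0 x) x I).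
Qed.

End function_induction.

(** * Complex numbers and bounded integrals *)

Section complex_facts.
Context {R : realType}.
Implicit Types z w : R[i].
Notation Re := (@complex.Re R).
Notation Im := (@complex.Im R).

(** The squared modulus as a polynomial in the real and imaginary parts: identities follow by
    [ring], and no square root enters the L^2 estimates. *)
Definition nsq z : R := Re z ^+ 2 + Im z ^+ 2.

Lemma nsq_ge0 z : 0 <= nsq z.
Proof. by rewrite addr_ge0 ?sqr_ge0. Qed.

Lemma normc_sqr z : Normc.normc z ^+ 2 = nsq z.
Proof. by case: z => a b; rewrite /= sqr_sqrtr// addr_ge0 ?sqr_ge0. Qed.

Lemma cReD z w : Re (z + w) = Re z + Re w. Proof. by case: z; case: w. Qed.
Lemma cImD z w : Im (z + w) = Im z + Im w. Proof. by case: z; case: w. Qed.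
Lemma cReN z : Re (- z) = - Re z. Proof. by case: z. Qed.
Lemma cImN z : Im (- z) = - Im z. Proof. by case: z. Qed.
Lemma cReM z w : Re (z * w) = Re z * Re w - Im z * Im w.
Proof. by case: z; case: w. Qed.
Lemma cImM z w : Im (z * w) = Re z * Im w + Im z * Re w.
Proof. by case: z; case: w. Qed.

Definition complexE := (cReD, cImD, cReN, cImN, cReM, cImM).

Lemma complex_eq z w : Re z = Re w -> Im z = Im w -> z = w.
Proof. by case: z => a b; case: w => c e /= -> ->. Qed.

Lemma nsqM z w : nsq (z * w) = nsq z * nsq w.
Proof. by rewrite /nsq !complexE; ring. Qed.

Lemma nsqN z : nsq (- z) = nsq z.
Proof. by rewrite /nsq !complexE; ring. Qed.

(** Parallelogram law: the gap is [nsq (z - w)]. This is the origin of the factors 2 in the later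
    triangle inequalities. *)
Lemma nsqD_le z w : nsq (z + w) <= 2 * nsq z + 2 * nsq w.
Proof.
rewrite -subr_ge0 /nsq !complexE.
rewrite (_ : _ - _ = (Re z - Re w) ^+ 2 + (Im z - Im w) ^+ 2); last by ring.
by rewrite addr_ge0 ?sqr_ge0.
Qed.

Lemma nsq_eq0 z : nsq z = 0 -> z = 0.
Proof.
move/eqP; rewrite paddr_eq0 ?sqr_ge0// !sqrf_eq0 => /andP[/eqP a /eqP b].
exact: complex_eq.
Qed.

Lemma nsq0 : nsq 0 = 0. Proof. by rewrite /nsq /= expr0n addr0. Qed.

Lemma expCD z w : expC (z + w) = expC z * expC w.
Proof.
apply: complex_eq; rewrite !complexE /expC /= !complexE expRD ?cosD ?sinD; ring.
Qed.

Lemma expC0 : expC (0 : R[i]) = 1.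
Proof. by rewrite /expC /= expR0 cos0 sin0 mulr1 mulr0. Qed.

Lemma nsq_expC z : nsq (expC z) = expR (Re z) ^+ 2.
Proof.
rewrite /nsq /expC /= -[RHS]mulr1 -(cos2Dsin2 (Im z)); ring.
Qed.

Lemma nsq_expC_le1 z : Re z <= 0 -> nsq (expC z) <= 1.
Proof.
by move=> z0; rewrite nsq_expC expr_le1 ?expR_ge0// -expR0 ler_expR.
Qed.

Lemma abs_Re_le z M : Normc.normc z <= M -> `|Re z| <= M.
Proof.
move=> zM; rewrite -ler_sqr ?nnegrE ?(le_trans _ zM)//; last by case: (z) => ? ?; exact: sqrtr_ge0.
rewrite real_normK ?num_real// (@le_trans _ _ (nsq z))// ?lerDl ?sqr_ge0//.
by rewrite -normc_sqr lerXn2r// ?nnegrE ?(le_trans _ zM)//; case: (z) => ? ?; exact: sqrtr_ge0.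
Qed.

Lemma abs_Im_le z M : Normc.normc z <= M -> `|Im z| <= M.
Proof.
move=> zM; rewrite -ler_sqr ?nnegrE ?(le_trans _ zM)//; last by case: (z) => ? ?; exact: sqrtr_ge0.
rewrite real_normK ?num_real// (@le_trans _ _ (nsq z))// ?lerDr ?sqr_ge0//.
by rewrite -normc_sqr lerXn2r// ?nnegrE ?(le_trans _ zM)//; case: (z) => ? ?; exact: sqrtr_ge0.
Qed.

Lemma normc_le_absD z : Normc.normc z <= `|Re z| + `|Im z|.
Proof.
rewrite -ler_sqr ?nnegrE ?addr_ge0//; last by case: (z) => ? ?; exact: sqrtr_ge0.
rewrite normc_sqr sqrrD !real_normK ?num_real// /nsq lerD2r lerDl.
by rewrite mulrn_wge0// mulr_ge0.
Qed.

Lemma nsq_le1P z : nsq z <= 1 -> `|Re z| <= 1 /\ `|Im z| <= 1.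
Proof.
move=> z1; split; rewrite -(expr_le1 (n := 2))// real_normK ?num_real//;
  apply: le_trans z1; by rewrite ?lerDl ?lerDr ?sqr_ge0.
Qed.

Lemma cvg_expC (u : nat -> R[i]) z :
  Re (u n) @[n --> \oo] --> Re z -> Im (u n) @[n --> \oo] --> Im z ->
  Re (expC (u n)) @[n --> \oo] --> Re (expC z) /\
  Im (expC (u n)) @[n --> \oo] --> Im (expC z).
Proof.
move=> cr ci; split; rewrite /expC /=; apply: cvgM.
- by apply: (continuous_cvg _ (@continuous_expR R _) cr).
- by apply: (continuous_cvg _ (@continuous_cos R _) ci).
- by apply: (continuous_cvg _ (@continuous_expR R _) cr).
- by apply: (continuous_cvg _ (@continuous_sin R _) ci).
Qed.

Lemma cvg_nsq (u : nat -> R[i]) z :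
  Re (u n) @[n --> \oo] --> Re z -> Im (u n) @[n --> \oo] --> Im z ->
  nsq (u n) @[n --> \oo] --> nsq z.
Proof.
move=> cr ci; rewrite /nsq.
by apply: cvgD; rewrite expr2; (under eq_fun do rewrite expr2); apply: cvgM.
Qed.

End complex_facts.

Section bounded_integrals.
Context {d} {T : measurableType d} {R : realType}.
Context (m : {measure set T -> \bar R}) (D : set T).
Hypotheses (mD : measurable D) (fD : (m D < +oo)%E).

Lemma bounded_integrable (f : T -> R) M : measurable_fun D f ->
  (forall x, D x -> `|f x| <= M) -> m.-integrable D (EFin \o f).
Proof.
move=> mf fM; apply: measurable_bounded_integrable => //.
exists M; split; first exact: num_real.
by move=> K MK x Dx; apply: le_trans (ltW MK); exact: fM.
Qed.

Lemma measurable_fun_cvgR (f_ : nat -> T -> R) (f : T -> R) :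
  (forall n, measurable_fun D (f_ n)) ->
  (forall x, D x -> f_ n x @[n --> \oo] --> f x) -> measurable_fun D f.
Proof.
move=> mf cf; apply/measurable_EFinP.
apply: (emeasurable_fun_cvg (fun n => EFin \o f_ n)).
  by move=> n; apply/measurable_EFinP.
by move=> x Dx; apply: cvg_EFin; [exact: nearW|exact: cf].
Qed.

Lemma bounded_cvg_Rintegral (f_ : nat -> T -> R) (f : T -> R) M :
  (forall n, measurable_fun D (f_ n)) ->
  (forall n x, D x -> `|f_ n x| <= M) ->
  (forall x, D x -> f_ n x @[n --> \oo] --> f x) ->
  \int[m]_(x in D) f_ n x @[n --> \oo] --> \int[m]_(x in D) f x.
Proof.
move=> mf fM cf.
have M0 x : D x -> `|f x| <= M.
  move=> Dx; have c := cf _ Dx.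
  rewrite -(cvg_lim _ (cvg_norm c))//; apply: limr_le; first exact: cvgP (cvg_norm c).
  by apply: nearW => n; exact: fM.
have intf : m.-integrable D (EFin \o f).
  exact: bounded_integrable (measurable_fun_cvgR mf cf) M0.
have := @dominated_cvg _ _ _ m D mD (fun n => EFin \o f_ n) (EFin \o f) (cst M%:E).
move=> H; apply: fine_cvg; rewrite fineK; last exact: integrable_fin_num.
apply: H => //.
- by move=> n; apply/measurable_EFinP.
- by move=> x Dx; apply: cvg_EFin; [exact: nearW|exact: cf].
- by apply: (bounded_integrable (M := `|M|)).
Qed.

End bounded_integrals.

(** * Square-integrable complex functions *)

Section measurable_complex.
Context {R : realType} {d : measure_display} {T : measurableType d}.
Implicit Types (f g : T -> R[i]) (D : set T).

Lemma measurable_funC_cst D (c : R[i]) : measurable_funC D (fun=> c).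
Proof. by split; exact: measurable_cst. Qed.

Lemma measurable_funCD D f g : measurable_funC D f -> measurable_funC D g ->
  measurable_funC D (fun x => f x + g x).
Proof.
move=> [? ?] [? ?]; split; [under eq_fun do rewrite cReD|under eq_fun do rewrite cImD];
  exact: measurable_funD.
Qed.

Lemma measurable_funCN D f : measurable_funC D f ->
  measurable_funC D (fun x => - f x).
Proof.
move=> [? ?]; split; [under eq_fun do rewrite cReN|under eq_fun do rewrite cImN];
  exact: measurableT_comp.
Qed.

Lemma measurable_funCB D f g : measurable_funC D f -> measurable_funC D g ->
  measurable_funC D (fun x => f x - g x).
Proof. by move=> mf mg; apply: measurable_funCD => //; exact: measurable_funCN. Qed.

Lemma measurable_funCM D f g : measurable_funC D f -> measurable_funC D g ->
  measurable_funC D (fun x => f x * g x).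
Proof.
move=> [? ?] [? ?]; split; [under eq_fun do rewrite cReM|under eq_fun do rewrite cImM].
- by apply: measurable_funB; exact: measurable_funM.
- by apply: measurable_funD; exact: measurable_funM.
Qed.

Lemma measurable_funCX D f : measurable_funC D f ->
  measurable_funC D (fun x => expC (f x)).
Proof.
move=> [mr mi]; split => /=; apply: measurable_funM.
- exact: measurableT_comp.
- by apply: measurableT_comp mi; apply: continuous_measurable_fun; exact: continuous_cos.
- exact: measurableT_comp.
- by apply: measurableT_comp mi; apply: continuous_measurable_fun; exact: continuous_sin.
Qed.

Lemma measurable_nsq D f : measurable_funC D f ->
  measurable_fun D (fun x => nsq (f x)).
Proof. by move=> [mr mi]; apply: measurable_funD; exact: measurable_funX. Qed.

Lemma measurable_nsqE D f : measurable_funC D f ->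
  measurable_fun D (fun x => (nsq (f x))%:E).
Proof. by move=> mf; apply/measurable_EFinP; exact: measurable_nsq. Qed.

Lemma measurable_funC_if D (A : set T) f g : measurable A -> measurable D ->
  measurable_funC D f -> measurable_funC D g ->
  measurable_funC D (fun x => if x \in A then f x else g x).
Proof.
move=> mA mD [fr fi] [gr gi].
have mb : measurable_fun D (fun x => x \in A).
  apply: (measurable_fun_bool true); rewrite (_ : _ @^-1` _ = A).
    exact: measurableI.
  by apply/seteqP; split => x /=; [move/set_mem|move/mem_set].
have k (u v : T -> R) : measurable_fun D u -> measurable_fun D v ->
    measurable_fun D (fun x => if x \in A then u x else v x).
  move=> mu mv; apply: measurable_fun_if => //.
    by apply: measurable_funS mu.
  by apply: measurable_funS mv.
split; [rewrite (_ : (fun x => _) = fun x => if x \in A then complex.Re (f x) else complex.Re (g x))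
  |rewrite (_ : (fun x => _) = fun x =>
    if x \in A then complex.Im (f x) else complex.Im (g x))]; try exact: k;
  by apply/funext => x; case: ifP.
Qed.

End measurable_complex.

Lemma cvge0_near_lt {R : realType} (u : nat -> \bar R) (e : R) :
  u n @[n --> \oo] --> 0%E -> 0 < e -> \forall n \near \oo, (u n < e%:E)%E.
Proof.
move=> /fine_cvgP[fu cu] e0; near=> n; rewrite -[u n]fineK; last by near: n.
by rewrite lte_fin; near: n; exact: (cvgr_lt _ cu).
Unshelve. all: by end_near. Qed.

Section L2_facts.
Context {R : realType} {d : measure_display} {T : measurableType d}.
Context (mu : {measure set T -> \bar R}) (D : set T).
Hypothesis mD : measurable D.
Implicit Types (f g h : T -> R[i]).

(** The squared L^2 norm. Being a plain integral, it is accessible to the convergence theorems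
    directly; the price is a triangle inequality with factors 2. *)
Definition Nsq f : \bar R := (\int[mu]_(x in D) (nsq (f x))%:E)%E.

Lemma Nsq_ge0 f : (0 <= Nsq f)%E.
Proof. by apply: integral_ge0 => x _; rewrite lee_fin nsq_ge0. Qed.

Lemma L2norm_sqr f : (L2norm mu D f `^ 2)%E = Nsq f.
Proof.
rewrite /L2norm powR_Lnorm ?pnatr_eq0// /Nsq [RHS]integral_mkcond.
apply: eq_integral => x _; rewrite /patch; case: ifPn => _; last first.
  by rewrite abse0 poweR0r ?pnatr_eq0.
by rewrite /= powR_mulrn ?normr_ge0// real_normK ?num_real// normc_sqr.
Qed.

Lemma L2norm_lt f (r : R) : 0 < r ->
  (L2norm mu D f < r%:E)%E = (Nsq f < (r ^+ 2)%:E)%E.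
Proof.
move=> r0; rewrite -L2norm_sqr.
have : (0 <= L2norm mu D f)%E by exact: Lnorm_ge0.
case: (L2norm mu D f) => [x| |]//=.
- rewrite lee_fin => x0; rewrite powR_mulrn// !lte_fin ltr_sqr ?nnegrE//.
  exact: ltW.
- by rewrite pnatr_eq0 /= !ltNge !leey.
Qed.

Lemma L2norm_lty f : (L2norm mu D f < +oo)%E = (Nsq f < +oo)%E.
Proof.
rewrite -L2norm_sqr.
have : (0 <= L2norm mu D f)%E by exact: Lnorm_ge0.
by case: (L2norm mu D f) => [x| |]//= _; rewrite ?ltry// pnatr_eq0.
Qed.

Lemma inL2P f : inL2 mu D f <-> measurable_funC D f /\ (Nsq f < +oo)%E.
Proof. by rewrite /inL2 L2norm_lty. Qed.

Lemma le_Nsq f g : measurable_funC D f -> measurable_funC D g ->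
  (forall x, D x -> nsq (f x) <= nsq (g x)) -> (Nsq f <= Nsq g)%E.
Proof.
move=> mf mg fg; apply: ge0_le_integral => //.
- by move=> x _; rewrite lee_fin nsq_ge0.
- exact: measurable_nsqE.
- exact: measurable_nsqE.
Qed.

Lemma NsqZ (c : R[i]) f : measurable_funC D f ->
  Nsq (fun x => c * f x) = ((nsq c)%:E * Nsq f)%E.
Proof.
move=> mf; rewrite /Nsq -ge0_integralZl_EFin ?nsq_ge0//.
- by apply: eq_integral => x _; rewrite nsqM EFinM.
- by move=> x _; rewrite lee_fin nsq_ge0.
- exact: measurable_nsqE.
Qed.

Lemma NsqD_le f g : measurable_funC D f -> measurable_funC D g ->
  (Nsq (fun x => f x + g x)%R <= 2%:E * Nsq f + 2%:E * Nsq g)%E.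
Proof.
move=> mf mg; rewrite /Nsq -!ge0_integralZl_EFin//; try exact: measurable_nsqE;
  try by move=> x _; rewrite lee_fin nsq_ge0.
have m2 h : measurable_funC D h -> measurable_fun D (fun x => 2%:E * (nsq (h x))%:E)%E.
  by move=> mh; apply/measurable_EFinP; apply: measurable_funM => //; exact: measurable_nsq.
have p2 h x : (0 <= 2%:E * (nsq (h x))%:E)%E.
  by rewrite -EFinM lee_fin mulr_ge0// nsq_ge0.
rewrite -ge0_integralD//; try exact: m2.
apply: ge0_le_integral => //.
- by move=> x _; rewrite lee_fin nsq_ge0.
- by apply: measurable_nsqE; exact: measurable_funCD.
- by apply: emeasurable_funD; exact: m2.
- by move=> x _; rewrite -!EFinM -EFinD lee_fin nsqD_le.
Qed.

Lemma NsqB_le f g h : measurable_funC D f -> measurable_funC D g ->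
  measurable_funC D h ->
  (Nsq (fun x => f x - h x)%R <=
   2%:E * Nsq (fun x => f x - g x)%R + 2%:E * Nsq (fun x => g x - h x)%R)%E.
Proof.
move=> mf mg mh; rewrite [leLHS](_ : _ = Nsq (fun x => (f x - g x) + (g x - h x))).
  by apply: NsqD_le; exact: measurable_funCB.
by congr Nsq; apply/funext => x; rewrite addrA subrK.
Qed.

Lemma NsqN f : Nsq (fun x => - f x) = Nsq f.
Proof. by rewrite /Nsq; under eq_integral do rewrite nsqN. Qed.

Lemma Nsq_subC f g : Nsq (fun x => f x - g x) = Nsq (fun x => g x - f x).
Proof. by rewrite -NsqN; congr Nsq; apply/funext => x; rewrite opprB. Qed.

Lemma inL2D f g : inL2 mu D f -> inL2 mu D g -> inL2 mu D (fun x => f x + g x).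
Proof.
move=> /inL2P[mf fi] /inL2P[mg gi]; apply/inL2P; split.
  exact: measurable_funCD.
apply: le_lt_trans (NsqD_le mf mg) _.
by rewrite lte_add_pinfty// lte_mul_pinfty.
Qed.

Lemma inL2Z (c : R[i]) f : inL2 mu D f -> inL2 mu D (fun x => c * f x).
Proof.
move=> /inL2P[mf fi]; apply/inL2P; split.
  by apply: measurable_funCM => //; exact: measurable_funC_cst.
by rewrite NsqZ// lte_mul_pinfty// lee_fin nsq_ge0.
Qed.

Lemma inL2B f g : inL2 mu D f -> inL2 mu D g -> inL2 mu D (fun x => f x - g x).
Proof.
move=> Lf Lg; rewrite (_ : (fun x => _) = (fun x => f x + (-1) * g x)).
  by apply: inL2D => //; exact: inL2Z.
by apply/funext => x; rewrite mulN1r.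
Qed.

Lemma inL2_mul f g : inL2 mu D f -> measurable_funC D g ->
  (forall x, D x -> nsq (g x) <= 1) -> inL2 mu D (fun x => g x * f x).
Proof.
move=> /inL2P[mf fi] mg g1; apply/inL2P; split; first exact: measurable_funCM.
apply: le_lt_trans fi; apply: le_Nsq => //; first exact: measurable_funCM.
by move=> x Dx; rewrite nsqM ler_piMl ?nsq_ge0 ?g1.
Qed.

Lemma ae_eq_Nsq f g : measurable_funC D f -> measurable_funC D g ->
  f = g %[ae mu in D] -> Nsq f = Nsq g.
Proof.
move=> mf mg fg; apply: ge0_ae_eq_integral => //.
- exact: measurable_nsqE.
- exact: measurable_nsqE.
- by move=> x _; rewrite lee_fin nsq_ge0.
- by move=> x _; rewrite lee_fin nsq_ge0.
- by apply: filterS fg => x fg Dx; rewrite fg.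
Qed.

Lemma ae_eq_Nsq0 f g : measurable_funC D f -> measurable_funC D g ->
  f = g %[ae mu in D] -> Nsq (fun x => f x - g x) = 0%E.
Proof.
move=> mf mg fg; rewrite (@ae_eq_Nsq _ (fun=> 0)).
- by rewrite /Nsq integral0_eq// => x _; rewrite nsq0.
- exact: measurable_funCB.
- exact: measurable_funC_cst.
- by apply: filterS fg => x fg Dx; rewrite fg// subrr.
Qed.

Lemma Nsq0_ae_eq f g : measurable_funC D f -> measurable_funC D g ->
  Nsq (fun x => f x - g x) = 0%E -> f = g %[ae mu in D].
Proof.
move=> mf mg N0.
have mfg := measurable_nsqE (measurable_funCB mf mg).
have /(@ae_eq_integral_abs _ _ _ mu D mD _ mfg) : (\int[mu]_(x in D) `|(nsq (f x - g x))%:E| = 0)%E.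
  by rewrite -[RHS]N0; apply: eq_integral => x _; rewrite gee0_abs// lee_fin nsq_ge0.
apply: filterS => x fg0 Dx; have [] := fg0 Dx.
by move/nsq_eq0/eqP; rewrite subr_eq0 => /eqP.
Qed.

Lemma Nsq_small_ae_eq f g : measurable_funC D f -> measurable_funC D g ->
  (forall e : R, 0 < e -> (Nsq (fun x => f x - g x)%R < e%:E)%E) ->
  f = g %[ae mu in D].
Proof.
move=> mf mg small; apply: Nsq0_ae_eq => //.
apply/eqP; rewrite eq_le Nsq_ge0 andbT; apply/lee_addgt0Pr => e e0.
by rewrite add0e; apply/ltW/small.
Qed.

End L2_facts.

(** * Unitary maps and discrete duality *)

Section unitary.
Context {R : realType} {d d' : measure_display}.
Context {T : measurableType d} {T' : measurableType d'}.
Context (mu : {measure set T -> \bar R}) (D : set T).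
Context (nu : {measure set T' -> \bar R}) (D' : set T').
Context (U : (T -> R[i]) -> (T' -> R[i])) (V : (T' -> R[i]) -> (T -> R[i])).
Hypotheses (mD : measurable D) (mD' : measurable D').
Hypothesis UV : unitaryL2 mu D nu D' U V.

Lemma L2dot_nsq {d0} {T0 : measurableType d0} (m : {measure set T0 -> \bar R})
    (A : set T0) f : complex.Re (L2dot m A f f) = fine (Nsq m A f).
Proof.
rewrite /L2dot /integralC /= /Rintegral /Nsq; congr fine.
by apply: eq_integral => x _; congr EFin; case: (f x) => a b /=; rewrite /nsq /=; ring.
Qed.

Lemma unitary_Nsq f : inL2 mu D f -> Nsq nu D' (U f) = Nsq mu D f.
Proof.
move=> Lf; have /inL2P[mf fi] := Lf.
have /inL2P[mUf Ufi] := unitary_dom UV Lf.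
(* Inner products are made of [fine] parts of integrals, so their equality yields equality of the
   norms only because both integrals are finite. *)
have := congr1 (@complex.Re R) (unitary_dot UV Lf Lf); rewrite !L2dot_nsq => e.
by rewrite -[LHS]fineK ?ge0_fin_numE ?Nsq_ge0// e fineK// ge0_fin_numE ?Nsq_ge0.
Qed.

Lemma unitary_sub f g : inL2 mu D f -> inL2 mu D g ->
  U (fun x => f x - g x) = (fun y => U f y - U g y) %[ae nu in D'].
Proof.
move=> Lf Lg; have := unitary_linear UV (-1) Lg Lf.
rewrite (_ : (fun x => -1 * g x + f x) = (fun x => f x - g x)); last first.
  by apply/funext => x; rewrite mulN1r addrC.
by apply: filterS => y e Dy; rewrite e// mulN1r addrC.
Qed.

Lemma unitary_dist f g : inL2 mu D f -> inL2 mu D g ->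
  Nsq nu D' (fun y => U f y - U g y) = Nsq mu D (fun x => f x - g x).
Proof.
move=> Lf Lg; rewrite -unitary_Nsq; last exact: inL2B.
apply/esym/(ae_eq_Nsq mD') => //; last exact: unitary_sub.
- by have /inL2P[] := unitary_dom UV (inL2B mD Lf Lg).
- apply: measurable_funCB; [have /inL2P[]// := unitary_dom UV Lf|].
  by have /inL2P[] := unitary_dom UV Lg.
Qed.

(** [U] acts on representatives. That it respects almost everywhere equality is a consequence of the
    isometry, which sends distance zero to distance zero. *)
Lemma unitary_ae_eq f g : inL2 mu D f -> inL2 mu D g ->
  f = g %[ae mu in D] -> U f = U g %[ae nu in D'].
Proof.
move=> Lf Lg fg.
have /inL2P[mf _] := Lf; have /inL2P[mg _] := Lg.
have /inL2P[mUf _] := unitary_dom UV Lf.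
have /inL2P[mUg _] := unitary_dom UV Lg.
by apply: (Nsq0_ae_eq mD') => //; rewrite unitary_dist// (ae_eq_Nsq0 mD).
Qed.

Lemma unitary_inj f g : inL2 mu D f -> inL2 mu D g ->
  U f = U g %[ae nu in D'] -> f = g %[ae mu in D].
Proof.
move=> Lf Lg fg.
have /inL2P[mf _] := Lf; have /inL2P[mg _] := Lg.
have /inL2P[mUf _] := unitary_dom UV Lf.
have /inL2P[mUg _] := unitary_dom UV Lg.
by apply: (Nsq0_ae_eq mD) => //; rewrite -unitary_dist// (ae_eq_Nsq0 mD').
Qed.

Lemma L2dot_ae_eq {d0} {T0 : measurableType d0} (m : {measure set T0 -> \bar R})
    (A : set T0) f f' g g' : measurable A ->
  measurable_funC A f -> measurable_funC A f' ->
  measurable_funC A g -> measurable_funC A g' ->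
  f = f' %[ae m in A] -> g = g' %[ae m in A] ->
  L2dot m A f g = L2dot m A f' g'.
Proof.
move=> mA mf mf' mg mg' ff' gg'.
have mJ (h : T0 -> R[i]) : measurable_funC A h -> measurable_funC A (fun x => (h x)^*).
  move=> [hr hi]; split.
  - by apply: eq_measurable_fun hr => x _; case: (h x).
  - have mN := measurableT_comp (@oppr_measurable _ _) hi.
    by apply: eq_measurable_fun mN => x _ /=; case: (h x).
have [ma mb] := measurable_funCM mf (mJ _ mg).
have [ma' mb'] := measurable_funCM mf' (mJ _ mg').
have e : (fun x => f x * (g x)^*) = (fun x => f' x * (g' x)^*) %[ae m in A].
  by apply: filterS2 ff' gg' => x a b Ax; rewrite a// b.
rewrite /L2dot /integralC /Rintegral; congr (fine _ +i* fine _);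
  apply: ae_eq_integral => //; try exact/measurable_EFinP;
  by apply: filterS e => x e Ax; rewrite /= e.
Qed.

(** [unitaryL2] states linearity and preservation of inner products for [U]; for [V] they are
    obtained by mapping back with [U], linearity through [unitary_inj]. This symmetry lets every
    result about one process be applied to the other. *)
Lemma unitary_sym : unitaryL2 nu D' mu D V U.
Proof.
split; [exact: (unitary_cod UV)|exact: (unitary_dom UV)| | |
  exact: (unitaryVK UV)|exact: (unitaryK UV)].
- move=> a f g Lf Lg.
  have LVf := unitary_cod UV Lf; have LVg := unitary_cod UV Lg.
  have La : inL2 nu D' (fun x => a * f x + g x) by apply: inL2D => //; exact: inL2Z.
  apply: unitary_inj; [exact: (unitary_cod UV)| by apply: inL2D => //; exact: inL2Z|].
  have e3 : (fun y => a * U (V f) y + U (V g) y) = (fun y => a * f y + g y) %[ae nu in D'].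
    by apply: filterS2 (unitaryVK UV Lf) (unitaryVK UV Lg) => y e1 e2 Dy; rewrite e1// e2.
  apply: filterS3 (unitaryVK UV La) (unitary_linear UV a LVf LVg) e3 => y e1 e2 e3' Dy.
  by rewrite e1// e2// e3'.
- move=> f g Lf Lg.
  have LVf := unitary_cod UV Lf; have LVg := unitary_cod UV Lg.
  rewrite -(unitary_dot UV LVf LVg).
  have mm h : inL2 nu D' h -> measurable_funC D' h by move=> /inL2P[].
  apply: L2dot_ae_eq; rewrite //; try by apply: mm => //; exact: (unitary_dom UV).
  + exact: (unitaryVK UV).
  + exact: (unitaryVK UV).
Qed.

End unitary.

(** * Staircase operators on L^2 and their duality *)

Section discrete_operators.
Context {R : realType}.

Definition expmul {T : Type} (q : T -> R[i]) (a : R) (f : T -> R[i]) : T -> R[i] :=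
  fun x => expC ((- a)%:C * q x) * f x.

(** Under (A1) the semigroup at time b is [V (expmul q' b (U _))], so this is the staircase operator
    with every semigroup replaced by its unitary expression. In this form it makes sense on all of
    L^2, not only on bounded functions. *)
Fixpoint dual_ops {T T' : Type} (U : (T -> R[i]) -> (T' -> R[i]))
    (V : (T' -> R[i]) -> (T -> R[i])) (q : T -> R[i]) (q' : T' -> R[i])
    (l : seq (R * R)) (f : T -> R[i]) : T -> R[i] :=
  if l is (a, b) :: l' then
    expmul q a (V (expmul q' b (U (dual_ops U V q q' l' f))))
  else f.

(* A step (a, b) multiplies by exp(-a q) and then runs the semigroup for time b.
   For the dual process the roles of a and b are exchanged and the operators of
   the same staircase pair up differently; a is the pending multiplier. *)
Fixpoint shift_steps (a : R) (l : seq (R * R)) : seq (R * R) :=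
  if l is (b, c) :: l' then (a, b) :: shift_steps c l' else [:: (a, 0)].

Definition nneg_steps (l : seq (R * R)) :=
  forall p, p \in l -> 0 <= p.1 /\ 0 <= p.2.

Lemma nneg_steps_cons p l : nneg_steps (p :: l) ->
  [/\ 0 <= p.1, 0 <= p.2 & nneg_steps l].
Proof.
move=> H; have [? ?] := H p (mem_head _ _).
by split=> // q ql; apply: H; rewrite inE ql orbT.
Qed.

Lemma expmul0 {T : Type} (q : T -> R[i]) f : expmul q 0 f = f.
Proof.
apply/funext => x; rewrite /expmul oppr0.
by rewrite (_ : 0%:C = 0)// mul0r expC0 mul1r.
Qed.

Definition Cplus_fun {d} {T : measurableType d} (D : set T) (q : T -> R[i]) :=
  measurable_funC D q /\ forall x, D x -> 0 <= complex.Re (q x).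

Section expmul.
Context {d} {T : measurableType d} (mu : {measure set T -> \bar R}) (D : set T).
Hypothesis mD : measurable D.
Context (q : T -> R[i]) (qP : Cplus_fun D q).

Lemma measurable_expmul1 a : measurable_funC D (fun x => expC ((- a)%:C * q x)).
Proof.
apply: measurable_funCX; apply: measurable_funCM; last exact: qP.1.
exact: measurable_funC_cst.
Qed.

Lemma nsq_expmul1 a x : 0 <= a -> D x -> nsq (expC ((- a)%:C * q x)) <= 1.
Proof.
move=> a0 Dx; apply: nsq_expC_le1; rewrite cReM /= mul0r subr0.
by rewrite mulNr oppr_le0 mulr_ge0// qP.2.
Qed.

Lemma inL2_expmul a f : 0 <= a -> inL2 mu D f -> inL2 mu D (expmul q a f).
Proof.
move=> a0 Lf; apply: inL2_mul => //; first exact: measurable_expmul1.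
by move=> x; exact: nsq_expmul1.
Qed.

Lemma Nsq_expmul a f g : 0 <= a -> inL2 mu D f -> inL2 mu D g ->
  (Nsq mu D (fun x => expmul q a f x - expmul q a g x)%R <=
   Nsq mu D (fun x => f x - g x)%R)%E.
Proof.
move=> a0 Lf Lg; apply: le_Nsq => //.
- by have /inL2P[] := inL2B mD (inL2_expmul a0 Lf) (inL2_expmul a0 Lg).
- by have /inL2P[] := inL2B mD Lf Lg.
- move=> x Dx; rewrite /expmul -mulrBr nsqM ler_piMl ?nsq_ge0//.
  exact: nsq_expmul1.
Qed.

Lemma expmul_ae_eq a f g : f = g %[ae mu in D] ->
  expmul q a f = expmul q a g %[ae mu in D].
Proof. by apply: filterS => x e Dx; rewrite /expmul e. Qed.

End expmul.

Context {d d' : measure_display}.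
Context {T : measurableType d} {T' : measurableType d'}.
Context (mu : {measure set T -> \bar R}) (D : set T).
Context (nu : {measure set T' -> \bar R}) (D' : set T').
Context (U : (T -> R[i]) -> (T' -> R[i])) (V : (T' -> R[i]) -> (T -> R[i])).
Hypotheses (mD : measurable D) (mD' : measurable D').
Hypothesis UV : unitaryL2 mu D nu D' U V.
Context (q : T -> R[i]) (q' : T' -> R[i]).
Hypotheses (qP : Cplus_fun D q) (qP' : Cplus_fun D' q').

Lemma inL2_dual_ops l f : nneg_steps l -> inL2 mu D f ->
  inL2 mu D (dual_ops U V q q' l f).
Proof.
elim: l => [//|[a b] l IH] /nneg_steps_cons[/= a0 b0 l0] Lf /=.
apply: inL2_expmul => //; apply: (unitary_cod UV).
apply: inL2_expmul => //; apply: (unitary_dom UV); exact: IH.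
Qed.

(** Each factor is an isometry or a multiplication by a function of modulus at most 1, so the
    operator is a contraction whatever the number of steps. This uniformity permits independent
    approximations of [f] and [g]. *)
Lemma Nsq_dual_ops l f g : nneg_steps l -> inL2 mu D f -> inL2 mu D g ->
  (Nsq mu D (fun x => dual_ops U V q q' l f x - dual_ops U V q q' l g x)%R <=
   Nsq mu D (fun x => f x - g x)%R)%E.
Proof.
elim: l => [//|[a b] l IH] /nneg_steps_cons[/= a0 b0 l0] Lf Lg /=.
apply: le_trans (IH l0 Lf Lg).
have Lf' := inL2_dual_ops l0 Lf; have Lg' := inL2_dual_ops l0 Lg.
have Uf := unitary_dom UV Lf'; have Ug := unitary_dom UV Lg'.
have Ef := inL2_expmul mD' qP' b0 Uf; have Eg := inL2_expmul mD' qP' b0 Ug.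
have Vf := unitary_cod UV Ef; have Vg := unitary_cod UV Eg.
apply: le_trans (Nsq_expmul mD qP a0 Vf Vg) _.
rewrite (unitary_dist mD' mD (unitary_sym mD mD' UV) Ef Eg).
by apply: le_trans (Nsq_expmul mD' qP' b0 Uf Ug) _; rewrite (unitary_dist mD mD' UV).
Qed.

End discrete_operators.

Section discrete_duality.
Context {R : realType} {d d' : measure_display}.
Context {T : measurableType d} {T' : measurableType d'}.
Context (mu : {measure set T -> \bar R}) (D : set T).
Context (nu : {measure set T' -> \bar R}) (D' : set T').
Context (U : (T -> R[i]) -> (T' -> R[i])) (V : (T' -> R[i]) -> (T -> R[i])).
Hypotheses (mD : measurable D) (mD' : measurable D').
Hypothesis UV : unitaryL2 mu D nu D' U V.
Context (q : T -> R[i]) (q' : T' -> R[i]).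
Hypotheses (qP : Cplus_fun D q) (qP' : Cplus_fun D' q').

Lemma nneg_shift_steps (a : R) l : 0 <= a -> nneg_steps l -> nneg_steps (shift_steps a l).
Proof.
elim: l a => [|[b c] l IH] a a0 l0 /= p.
  by rewrite inE => /eqP ->.
have [/= b0 c0 l1] := nneg_steps_cons l0.
by rewrite inE => /orP[/eqP ->//|]; exact: IH.
Qed.

(** With a pending multiplier [a] in front, the induction hypothesis at [c] produces exactly the
    block [expmul q' c (U _)] that [dual_ops] wraps into [expmul q b (V _)]: both sides are the same
    product of operators, bracketed differently. *)
Lemma dual_ops_duality (l : seq (R * R)) (a : R) f : nneg_steps l -> 0 <= a -> inL2 mu D f ->
  dual_ops V U q' q (shift_steps a l) (U f) =
  expmul q' a (U (dual_ops U V q q' l f)) %[ae nu in D'].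
Proof.
move=> l0 a0 Lf; have LUf := unitary_dom UV Lf.
elim: l a l0 a0 => [|[b c] l IH] a l0 a0 /=; last first.
  have [/= b0 c0 l1] := nneg_steps_cons l0.
  apply: expmul_ae_eq; have e := IH c l1 c0.
  have Lo := inL2_dual_ops mD mD' UV qP qP' l1 Lf; have LUo := unitary_dom UV Lo.
  have LEo := inL2_expmul mD' qP' c0 LUo.
  have VU := unitary_sym mD mD' UV.
  have Ls := inL2_dual_ops mD' mD VU qP' qP (nneg_shift_steps c0 l1) LUf.
  apply: (unitary_ae_eq mD mD' UV).
  - by apply: inL2_expmul => //; exact: (unitary_cod UV).
  - by apply: inL2_expmul => //; exact: (unitary_cod UV).
  - by apply: expmul_ae_eq; exact: (unitary_ae_eq mD' mD VU).
(* The last shifted step has time 0, so its multiplier disappears and only [U (V (U f))] remains. *)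
apply: expmul_ae_eq; rewrite expmul0.
exact: (unitaryVK UV).
Qed.

End discrete_duality.

(** * Processes started at a point *)

Section bounded_mfun.
Context {d} {T : measurableType d} {R : realType}.
Implicit Types (A : set T) (f g : T -> R).

Definition bounded_mfun A f :=
  measurable_fun A f /\ exists M, forall x, A x -> `|f x| <= M.

Lemma bounded_mfun_cst A (c : R) : bounded_mfun A (fun=> c).
Proof. by split; [exact: measurable_cst|exists `|c|]. Qed.

Lemma bounded_mfunD A f g : bounded_mfun A f -> bounded_mfun A g ->
  bounded_mfun A (fun x => f x + g x).
Proof.
move=> [mf [M fM]] [mg [N gN]]; split; first exact: measurable_funD.
by exists (M + N) => x Ax; rewrite (le_trans (ler_normD _ _))// lerD// ?fM ?gN.
Qed.

Lemma bounded_mfunM A f g : bounded_mfun A f -> bounded_mfun A g ->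
  bounded_mfun A (fun x => f x * g x).
Proof.
move=> [mf [M fM]] [mg [N gN]]; split; first exact: measurable_funM.
by exists (M * N) => x Ax; rewrite normrM ler_pM// ?fM ?gN.
Qed.

Lemma bounded_mfunN A f : bounded_mfun A f -> bounded_mfun A (fun x => - f x).
Proof.
move=> [mf [M fM]]; split; first exact: measurableT_comp.
by exists M => x Ax; rewrite normrN fM.
Qed.

Lemma bounded_mfunS A B f : measurable A -> B `<=` A -> bounded_mfun A f -> bounded_mfun B f.
Proof.
move=> mA BA [mf [M fM]]; split; first exact: measurable_funS mf.
by exists M => x /BA; exact: fM.
Qed.

Lemma bounded_mfun_restrict A f : measurable A -> bounded_mfun A f ->
  bounded_mfun setT (f \_ A).
Proof.
move=> mA [mf [M fM]]; split; first exact/(measurable_restrictT _ mA).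
exists `|M| => x _; rewrite /patch; case: ifPn => [/set_mem Ax|_]; last by rewrite normr0.
by rewrite (le_trans (fM _ Ax))// ler_norm.
Qed.

Lemma bounded_mfun_eq A f g : (forall x, A x -> f x = g x) ->
  bounded_mfun A f -> bounded_mfun A g.
Proof.
move=> fg [mf [M fM]]; split; last by exists M => x Ax; rewrite -fg// fM.
by apply: eq_measurable_fun mf => x /set_mem; exact: fg.
Qed.

Context (m : {measure set T -> \bar R}) (A : set T).
Hypotheses (mA : measurable A) (fA : (m A < +oo)%E).

Lemma bounded_mfun_integrable f : bounded_mfun A f -> m.-integrable A (EFin \o f).
Proof. by move=> [mf [M fM]]; exact: bounded_integrable fM. Qed.

Lemma Rintegral_lin (a : R) f g : bounded_mfun A f -> bounded_mfun A g ->
  \int[m]_(x in A) (a * f x + g x) =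
  a * \int[m]_(x in A) f x + \int[m]_(x in A) g x.
Proof.
move=> bf bg; rewrite RintegralD ?RintegralZl//; try exact: bounded_mfun_integrable.
by apply: bounded_mfun_integrable; apply: bounded_mfunM => //; exact: bounded_mfun_cst.
Qed.

Lemma RintegralB_bounded f g : bounded_mfun A f -> bounded_mfun A g ->
  \int[m]_(x in A) (f x - g x) = \int[m]_(x in A) f x - \int[m]_(x in A) g x.
Proof. by move=> bf bg; rewrite RintegralB//; exact: bounded_mfun_integrable. Qed.

Lemma RintegralD_bounded f g : bounded_mfun A f -> bounded_mfun A g ->
  \int[m]_(x in A) (f x + g x) = \int[m]_(x in A) f x + \int[m]_(x in A) g x.
Proof. by move=> bf bg; rewrite RintegralD//; exact: bounded_mfun_integrable. Qed.

Lemma Rintegral_abs_le f M : bounded_mfun A f -> (m A <= 1)%E ->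
  (forall x, A x -> `|f x| <= M) -> `|\int[m]_(x in A) f x| <= `|M|.
Proof.
move=> bf m1 fM; apply: (le_trans (le_normr_Rintegral mA (bounded_mfun_integrable bf))).
have bn : bounded_mfun A (fun x => `|f x|).
  case: bf => mf [N fN]; split; first exact: measurableT_comp.
  by exists N => x Ax; rewrite normr_id fN.
apply: (@le_trans _ _ (\int[m]_(x in A) `|M|)).
  apply: le_Rintegral => //.
  - exact: (bounded_mfun_integrable bn).
  - exact: (bounded_mfun_integrable (bounded_mfun_cst _ _)).
  - by move=> x Ax; rewrite (le_trans (fM _ Ax))// ler_norm.
rewrite Rintegral_cst// ler_piMr// -lee_fin fineK//.
by rewrite ge0_fin_numE.
Qed.

End bounded_mfun.

Lemma state_space_measurable {R : realType} (D : set R) :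
  state_space D -> measurable D.
Proof.
case=> [|cD]; first exact: is_interval_measurable.
by apply: countable_measurable => // t; exact: measurable_set1.
Qed.

Section time_interval.
Context {R : realType} (S : set R).
Hypothesis hS : time_interval S.

Lemma time_interval0 : S 0.
Proof. by case: hS => [[b b0 ->]|->] /=; rewrite in_itv/= ?lexx ?ltW. Qed.

Lemma time_interval_ge0 u : S u -> 0 <= u.
Proof. by case: hS => [[b b0 ->]|->] /=; rewrite in_itv/= => /andP[]. Qed.

Lemma time_interval_le (u v : R) : S v -> 0 <= u -> u <= v -> S u.
Proof.
case: hS => [[b b0 ->]|->] /=; rewrite !in_itv/=; last by rewrite !andbT.
by move=> /andP[v0 vb] u0 uv; rewrite u0 (le_trans uv).
Qed.

End time_interval.

Section process_facts.
Context {R : realType} {d : measure_display} {O : measurableType d}.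
Context (X : process R O) (S D : set R).
Hypotheses (hS : time_interval S) (mD : measurable D).
Hypothesis hX : markov_process X S D.
Implicit Types (u v x : R) (k : R -> R) (h : R -> R[i]).

Definition alive u := alive_in X u setT.

Lemma alive_inE u B : alive_in X u B = alive u `&` position X u @^-1` B.
Proof. by apply/seteqP; split => w [] //= [? _]. Qed.

Lemma alive_mono u v : u <= v -> alive v `<=` alive u.
Proof. by move=> uv w [vl _]; split => //; apply: le_lt_trans vl; rewrite lee_fin. Qed.

Lemma alive_state u w : S u -> alive u w -> D (position X u w).
Proof. by move=> Su [ul _]; have [] := markov_cadlag hX Su ul. Qed.

Lemma measurable_alive u : S u -> measurable (alive u).
Proof. by move=> Su; exact: (markov_measurable hX Su measurableT). Qed.

Lemma start_law_finite x (A : set O) : measurable A -> (start_law X x A < +oo)%E.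
Proof. by move=> mA; rewrite (le_lt_trans (probability_le1 _ mA))// ltry. Qed.

(** [k] is measurable on [D] only. Paths stay in [D] while alive, so the preimage of [B] is the
    event of being alive with a position in the measurable set of points of [D] that [k] sends to
    [B]. *)
Lemma measurable_position_comp u {d'} {T' : measurableType d'} (k : R -> T') :
  S u -> measurable_fun D k ->
  measurable_fun (alive u) (fun w => k (position X u w)).
Proof.
move=> Su mk _ B mB; have mDB := mk mD _ mB.
have := markov_measurable hX Su mDB; congr measurable.
apply/seteqP; split => w /=.
  by case=> wu [_ kB]; split; [split|].
by case=> wu kB; have Dw := alive_state Su wu; case: wu => wu _.
Qed.

Lemma bounded_position_comp u k : S u -> bounded_mfun D k ->
  bounded_mfun (alive u) (fun w => k (position X u w)).
Proof.
move=> Su [mk [M kM]]; split; first exact: measurable_position_comp.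
by exists M => w wu; apply: kM; exact: alive_state.
Qed.

(** The semigroup on real functions. The real and imaginary parts of [semigroup] are convertible to
    it, which carries its properties over to complex functions. *)
Definition rexp u k x : R := \int[start_law X x]_(w in alive u) k (position X u w).

Lemma rexp_abs_le u k M x : S u -> bounded_mfun D k ->
  (forall y, D y -> `|k y| <= M) -> `|rexp u k x| <= `|M|.
Proof.
move=> Su bk kM; apply: Rintegral_abs_le => //.
- exact: measurable_alive.
- by apply: start_law_finite; exact: measurable_alive.
- exact: bounded_position_comp.
- by apply: probability_le1; exact: measurable_alive.
- by move=> w wu; apply: kM; exact: alive_state.
Qed.

Lemma rexp_lin u a k k' x : S u -> bounded_mfun D k -> bounded_mfun D k' ->
  rexp u (fun y => a * k y + k' y) x = a * rexp u k x + rexp u k' x.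
Proof.
move=> Su bk bk'; rewrite /rexp Rintegral_lin//.
- exact: measurable_alive.
- by apply: start_law_finite; exact: measurable_alive.
- exact: bounded_position_comp.
- exact: bounded_position_comp.
Qed.

Lemma eq_rexp u k k' x : S u -> (forall y, D y -> k y = k' y) ->
  rexp u k x = rexp u k' x.
Proof.
move=> Su kk'; apply: eq_Rintegral => w /set_mem wu; apply: kk'; exact: alive_state.
Qed.

Lemma rexp_indic u x B : S u -> measurable B ->
  rexp u \1_B x = fine (start_law X x (alive_in X u B)).
Proof.
move=> Su mB; rewrite /rexp /Rintegral; congr fine.
have mA := markov_measurable hX Su mB.
rewrite (eq_integral (fun w => (\1_(alive_in X u B) w)%:E)) => [|w /set_mem wu].
  rewrite integral_indic//; last exact: measurable_alive.
  by congr (start_law X x _); rewrite alive_inE setIAC setIid.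
by rewrite alive_inE !indicE in_setI (mem_set wu) andTb.
Qed.

Lemma cvg_rexp u (k_ : nat -> R -> R) k M x : S u ->
  (forall n, measurable_fun D (k_ n)) ->
  (forall n y, D y -> `|k_ n y| <= M) ->
  (forall y, D y -> k_ n y @[n --> \oo] --> k y) ->
  rexp u (k_ n) x @[n --> \oo] --> rexp u k x.
Proof.
move=> Su mk kM ck; apply: bounded_cvg_Rintegral.
- exact: measurable_alive.
- by apply: start_law_finite; exact: measurable_alive.
- by move=> n; exact: measurable_position_comp.
- by move=> n w wu; exact: kM (alive_state Su wu).
- by move=> w wu; apply: ck; exact: alive_state.
Qed.

Lemma bounded_fun_mfun k : measurable_fun setT k -> bounded_fun k ->
  bounded_mfun D k.
Proof.
move=> mk [M [_ HM]]; split; first exact: measurable_funTS.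
by exists (M + 1) => y _; apply: (HM (M + 1)); rewrite ?ltrDl.
Qed.

(** [markov_kernel] is the case of indicators, and the class of admissible [k] is closed under
    linear combinations and bounded limits. [k] is first extended by zero outside [D], to be
    measurable on the whole line. *)
Lemma bounded_mfun_rexp u k : S u -> bounded_mfun D k ->
  bounded_mfun D (rexp u k).
Proof.
move=> Su bk; split; last first.
  by case: (bk) => _ [M kM]; exists `|M| => x _; exact: rexp_abs_le.
have kE x : rexp u k x = rexp u (k \_ D) x.
  by apply: eq_rexp => // y Dy; rewrite patchT// inE.
rewrite (funext kE).
have [mkD [M kM]] := bounded_mfun_restrict mD bk.
move: mkD (fun x => kM x I); move: (k \_ D) M {kM kE bk} => {}k M.
move: k M; apply: bounded_measurable_ind.
- move=> B mB; rewrite (funext (fun x => rexp_indic x Su mB)).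
  have mk := markov_kernel hX Su mB.
  by have := measurableT_comp (@fine_measurable R setT measurableT) mk.
- move=> a f g mf mg bf bg Hf Hg.
  rewrite (funext (fun x => rexp_lin a x Su (bounded_fun_mfun mf bf) (bounded_fun_mfun mg bg))).
  by apply: measurable_funD => //; exact: measurable_funM.
- move=> f_ f M mf fM cf IH; apply: (measurable_fun_cvgR IH) => x Dx.
  by apply: cvg_rexp => // n; exact: measurable_funTS.
Qed.

End process_facts.

(** * The Markov property for functions of the past *)

Section markov.
Context {R : realType} {d : measure_display} {O : measurableType d}.
Context (X : process R O) (S D : set R).
Hypotheses (hS : time_interval S) (mD : measurable D).
Hypothesis hX : markov_process X S D.

(** The sigma-algebra [history X S u] as a measurable type, so that dependence on the past is an
    ordinary [measurable_fun] and the induction principle for bounded functions applies to it. *)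
Definition past (u : R) : measurableType _ :=
  g_sigma_algebraType [set alive_in X v B | v in S `&` [set v | v <= u] & B in measurable].

Lemma past_mono (u v : R) : u <= v -> @measurable _ (past u) `<=` @measurable _ (past v).
Proof.
move=> uv; apply: sub_sigma_algebra2 => A [r [Sr ru] [B mB <-]].
exists r; first by split => //; exact: le_trans uv.
by exists B.
Qed.

Lemma past_measurable (u : R) : @measurable _ (past u) `<=` @measurable _ O.
Proof.
apply: smallest_sub; first exact: sigma_algebra_measurable.
by move=> A [v [Sv _] [B mB <-]]; exact: (markov_measurable hX Sv mB).
Qed.

Lemma past_alive (u v : R) : S v -> v <= u -> @measurable _ (past u) (alive X v).
Proof.
move=> Sv vu; apply: sub_sigma_algebra; exists v; first by split.
by exists setT.
Qed.

Lemma past_measurable_fun (u : R) (A : set O) (xi : O -> R) :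
  @measurable _ O A ->
  @measurable_fun _ _ (past u) R setT xi -> @measurable_fun _ _ O R A xi.
Proof.
move=> mA mxi _ B mB; apply: measurableI => //; apply: (past_measurable (u := u)).
by rewrite -[X in measurable X]setTI; exact: mxi.
Qed.

Lemma past_position (u v : R) (k : R -> R) : S v -> v <= u ->
  measurable_fun D k ->
  @measurable_fun _ _ (past u) R (alive X v) (fun w => k (position X v w)).
Proof.
move=> Sv vu mk _ B mB; have mDB := mk mD _ mB.
apply: sub_sigma_algebra; exists v; first by split.
exists (D `&` k @^-1` B) => //.
apply/seteqP; split => w /=.
  by case=> wu [_ kB]; split; [split|].
by case=> wu kB; have Dw := alive_state hX Sv wu; case: wu => wu _.
Qed.

(** [markov_property] is the case of two indicators. Bounded functions are reached by nested
    inductions: the outer one over functionals [xi] of the past and, when [xi] is an indicator, an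
    inner one over functions [k] of the later position. *)
Lemma markov_real (x u v : R) (xi : O -> R) (k : R -> R) :
  D x -> S u -> S v -> u <= v ->
  @bounded_mfun _ (past u) R setT xi -> bounded_mfun D k ->
  \int[start_law X x]_(w in alive X v) (xi w * k (position X v w)) =
  \int[start_law X x]_(w in alive X u) (xi w * rexp X (v - u) k (position X u w)).
Proof.
move=> Dx Su Sv uv bxi bk.
have Svu : S (v - u).
  apply: (time_interval_le hS Sv); first by rewrite subr_ge0.
  by rewrite gerBl (time_interval_ge0 hS).
have mav := measurable_alive hX Sv; have mau := measurable_alive hX Su.
have fv := start_law_finite X x mav; have fu := start_law_finite X x mau.
pose k' : R -> R := k \_ D.
have kk' y : D y -> k y = k' y by move=> Dy; rewrite /k' patchT// inE.
rewrite (@eq_Rintegral _ _ _ _ _ (fun w => xi w * k' (position X v w))); last first.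
  by move=> w /set_mem /(alive_state hX Sv) Dw; rewrite kk'.
rewrite [RHS](@eq_Rintegral _ _ _ _ _ (fun w =>
  xi w * rexp X (v - u) k' (position X u w))); last first.
  by move=> w _; congr (_ * _); exact: (eq_rexp hX _ Svu kk').
have [mk' [M k'M]] := bounded_mfun_restrict mD bk.
have {}k'M y : `|k' y| <= M by exact: k'M.
case: bxi => mxi [N xiN]; have {}xiN w : `|xi w| <= N by exact: xiN.
have bx (A : set O) (f : past u -> R) : measurable A -> measurable_fun setT f ->
    bounded_fun f -> bounded_mfun A (f : O -> R).
  move=> mA mf [K [_ HK]]; split; first exact: past_measurable_fun mf.
  by exists (K + 1) => y _; apply: (HK (K + 1)); rewrite ?ltrDl.
have bxc (A : set O) (f : past u -> R) (K : R) : measurable A -> measurable_fun setT f ->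
    (forall w, `|f w| <= K) -> bounded_mfun A (f : O -> R).
  by move=> mA mf fK; split; [exact: past_measurable_fun mf|exists K].
have bkv (f : R -> R) : bounded_mfun D f -> bounded_mfun (alive X v) (fun w => f (position X v w)).
  by move=> bf; apply: (bounded_position_comp mD hX Sv).
have bku (f : R -> R) : bounded_mfun D f ->
    bounded_mfun (alive X u) (fun w => rexp X (v - u) f (position X u w)).
  by move=> bf; apply: (bounded_position_comp mD hX Su); exact: (bounded_mfun_rexp mD hX Svu bf).
have bfm (f : R -> R) (K : R) : measurable_fun setT f -> (forall y, `|f y| <= K) ->
  bounded_mfun D f.
  by move=> mf fK; split; [exact: measurable_funTS|exists K].
apply: (@bounded_measurable_ind _ (past u) R (fun xi : O -> R =>
  \int[start_law X x]_(w in alive X v) (xi w * k' (position X v w)) =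
  \int[start_law X x]_(w in alive X u) (xi w * rexp X (v - u) k' (position X u w)))
  _ _ _ xi N mxi xiN) => {xi N mxi xiN}.
- move=> A mA; have mAO := past_measurable mA.
  have bA B : bounded_mfun B (\1_A : O -> R).
    split; first exact: measurable_indic.
    by exists 1 => w _; rewrite indicE; case: (_ \in _); rewrite ?normr1 ?normr0.
  apply: (@bounded_measurable_ind _ R R (fun k : R -> R =>
    \int[start_law X x]_(w in alive X v) (\1_A w * k (position X v w)) =
    \int[start_law X x]_(w in alive X u) (\1_A w * rexp X (v - u) k (position X u w)))
    _ _ _ k' M mk' k'M) => {bk k k' M mk' k'M kk'}.
  + move=> B mB.
    rewrite (@eq_Rintegral _ O _ _ _ (\1_((A : set O) `&` alive_in X v B) : O -> R)); last first.
      move=> w /set_mem wv /=; rewrite !indicE.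
      have -> : (w \in (A : set O) `&` alive_in X v B) = (w \in (A :
        set O)) && (position X v w \in B).
        apply/idP/andP => [/set_mem[/mem_set ? [_ /mem_set ?]]//|[/set_mem ? /set_mem ?]].
        by apply/mem_set; split=> //; split=> //; case: wv.
      by case: (w \in (A : set O)); rewrite ?mul1r ?mul0r.
    rewrite /Rintegral integral_indic//; last first.
      by apply: measurableI => //; exact: (markov_measurable hX Sv mB).
    rewrite (_ : _ `&` alive X v = A `&` alive_in X v B); last first.
      by apply: setIidl => w [_ [wv _]]; split.
    apply: (etrans (congr1 fine (markov_property hX Dx Su Sv uv mA mB))); congr fine.
    rewrite setIC integral_mkcondr; apply: eq_integral => w /set_mem wu.
    rewrite (rexp_indic hX _ Svu mB) /patch indicE; case: ifPn => _; rewrite ?mul0r// mul1r.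
    rewrite fineK// ge0_fin_numE//; apply: start_law_finite.
    exact: (markov_measurable hX Svu mB).
  + move=> a f g mf mg bf bg IHf IHg.
    have bf' := bounded_fun_mfun D mf bf; have bg' := bounded_fun_mfun D mg bg.
    transitivity (\int[start_law X x]_(w in alive X v)
      (a * (\1_A w * f (position X v w)) + \1_A w * g (position X v w))).
      by apply: eq_Rintegral => w _; ring.
    rewrite Rintegral_lin//; try by apply: bounded_mfunM => //; exact: bkv.
    rewrite IHf IHg -Rintegral_lin//; try by apply: bounded_mfunM => //; exact: bku.
    apply: eq_Rintegral => w _; by rewrite (rexp_lin mD hX a _ Svu bf' bg'); ring.
  + move=> f_ f K mf fK cf IH.
    have c1 : \int[start_law X x]_(w in alive X v) (\1_A w * f_ n (position X v w))
       @[n --> \oo] --> \int[start_law X x]_(w in alive X v) (\1_A w * f (position X v w)).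
      apply: (bounded_cvg_Rintegral mav fv (M := K)).
      * by move=> n; apply: (proj1 (bounded_mfunM (bA _) (bkv _ (bfm _ _ (mf n) (fK n))))).
      * move=> n w _; rewrite normrM -[leRHS]mul1r ler_pM//.
        by rewrite indicE; case: (_ \in _); rewrite ?normr1 ?normr0.
      * by move=> w _; apply: cvgM; [exact: cvg_cst|exact: cf].
    have c2 : \int[start_law X x]_(w in alive X u) (\1_A w * rexp X (v - u) (f_ n) (position X u w))
       @[n --> \oo] --> \int[start_law X x]_(w in alive X u) (\1_A w * rexp X (v - u) f
         (position X u w)).
      apply: (bounded_cvg_Rintegral mau fu (M := `|K|)).
      * by move=> n; apply: (proj1 (bounded_mfunM (bA _) (bku _ (bfm _ _ (mf n) (fK n))))).
      * move=> n w _; rewrite normrM -[leRHS]mul1r ler_pM//.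
          by rewrite indicE; case: (_ \in _); rewrite ?normr1 ?normr0.
        by apply: (rexp_abs_le mD hX) => //; exact: bfm (fK n).
      * move=> w _; apply: cvgM; first exact: cvg_cst.
        by apply: (cvg_rexp mD hX) => // n; exact: measurable_funTS.
    by rewrite (funext IH) in c1; exact: (cvg_unique _ c1 c2).
- have bk' : bounded_mfun D k' by exact: bfm k'M.
  move=> a f g mf mg bf bg IHf IHg.
  transitivity (\int[start_law X x]_(w in alive X v)
      (a * (f w * k' (position X v w)) + g w * k' (position X v w))).
    by apply: eq_Rintegral => w _; ring.
  rewrite Rintegral_lin//; try by apply: bounded_mfunM; [exact: bx|exact: bkv].
  rewrite IHf IHg -Rintegral_lin//; try by apply: bounded_mfunM; [exact: bx|exact: bku].
  by apply: eq_Rintegral => w _; ring.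
- have bk' : bounded_mfun D k' by exact: bfm k'M.
  move=> f_ f K mf fK cf IH.
  have c1 : \int[start_law X x]_(w in alive X v) (f_ n w * k' (position X v w))
     @[n --> \oo] --> \int[start_law X x]_(w in alive X v) (f w * k' (position X v w)).
    apply: (bounded_cvg_Rintegral mav fv (M := K * M)).
    * by move=> n; apply: (proj1 (bounded_mfunM (bxc _ _ _ mav (mf n) (fK n)) (bkv _ bk'))).
    * by move=> n w _; rewrite normrM ler_pM.
    * by move=> w _; apply: cvgM; [exact: cf|exact: cvg_cst].
  have c2 : \int[start_law X x]_(w in alive X u) (f_ n w * rexp X (v - u) k' (position X u w))
     @[n --> \oo] --> \int[start_law X x]_(w in alive X u) (f w * rexp X (v - u) k'
       (position X u w)).
    apply: (bounded_cvg_Rintegral mau fu (M := K * `|M|)).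
    * by move=> n; apply: (proj1 (bounded_mfunM (bxc _ _ _ mau (mf n) (fK n)) (bku _ bk'))).
    * by move=> n w _; rewrite normrM ler_pM//; apply: (rexp_abs_le mD hX).
    * by move=> w _; apply: cvgM; [exact: cf|exact: cvg_cst].
  by rewrite (funext IH) in c1; exact: (cvg_unique _ c1 c2).
Qed.

End markov.

(** * Multi-step expectations *)

Section bounded_mfunC.
Context {d} {T : measurableType d} {R : realType}.
Implicit Types (A : set T) (f g : T -> R[i]).

Definition bounded_mfunC A f := bounded_mfun A (fun x => complex.Re (f x)) /\
  bounded_mfun A (fun x => complex.Im (f x)).

Lemma bounded_mfunCP A f :
  bounded_mfunC A f <-> measurable_funC A f /\ boundedC A f.
Proof.
split=> [[[mr [M rM]] [mi [N iN]]]|[[mr mi] [M fM]]].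
  split=> //; exists (M + N) => x Ax.
  by rewrite (le_trans (normc_le_absD _))// lerD ?rM ?iN.
split; split=> //; exists M => x Ax.
- by apply: abs_Re_le; exact: fM.
- by apply: abs_Im_le; exact: fM.
Qed.

Lemma bounded_mfunCM A f g : bounded_mfunC A f -> bounded_mfunC A g ->
  bounded_mfunC A (fun x => f x * g x).
Proof.
move=> [fr fi] [gr gi]; split.
  apply: (bounded_mfun_eq (f := fun x =>
    complex.Re (f x) * complex.Re (g x) + - (complex.Im (f x) * complex.Im (g x)))).
    by move=> x _; rewrite cReM.
  by apply: bounded_mfunD; [|apply: bounded_mfunN]; exact: bounded_mfunM.
apply: (bounded_mfun_eq (f := fun x =>
  complex.Re (f x) * complex.Im (g x) + complex.Im (f x) * complex.Re (g x))).
  by move=> x _; rewrite cImM.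
by apply: bounded_mfunD; exact: bounded_mfunM.
Qed.

Lemma bounded_mfunC_nsq A f : measurable_funC A f ->
  (forall x, A x -> nsq (f x) <= 1) -> bounded_mfunC A f.
Proof.
move=> [mr mi] f1; split; split=> //; exists 1 => x Ax;
  by have [] := nsq_le1P (f1 _ Ax).
Qed.

Lemma eq_integralC (m : {measure set T -> \bar R}) A f g :
  (forall x, A x -> f x = g x) -> integralC m A f = integralC m A g.
Proof.
move=> fg; congr (_ +i* _); apply: eq_Rintegral => x /set_mem Ax; by rewrite fg.
Qed.

End bounded_mfunC.

Section steps.
Context {R : realType}.

Definition steps_time (l : seq (R * R)) : R := \sum_(p <- l) p.2.

(** The exponent collected along a staircase. [p] is read before the time advances, in agreement
    with the order of multiplication and semigroup in [steps_op]. *)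
Fixpoint steps_sum (p : R -> R[i]) (u : R) (l : seq (R * R)) : R[i] :=
  if l is (a, b) :: l' then a%:C * p u + steps_sum p (u + b) l' else 0.

Fixpoint steps_op {d} {O : measurableType d} (X : process R O) (q : R -> R[i])
    (l : seq (R * R)) (h : R -> R[i]) : R -> R[i] :=
  if l is (a, b) :: l' then expmul q a (semigroup X b (steps_op X q l' h)) else h.

Lemma steps_time_cons a b l : steps_time ((a, b) :: l) = b + steps_time l.
Proof. by rewrite /steps_time big_cons. Qed.

Lemma steps_time_ge0 l : nneg_steps l -> 0 <= steps_time l.
Proof.
elim: l => [|[a b] l IH] l0; first by rewrite /steps_time big_nil.
have [_ b0 l1] := nneg_steps_cons l0.
by rewrite steps_time_cons addr_ge0// IH.
Qed.

End steps.

Section steps_markov.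
Context {R : realType} {d : measure_display} {O : measurableType d}.
Context (X : process R O) (S D : set R).
Hypotheses (hS : time_interval S) (mD : measurable D).
Hypothesis hX : markov_process X S D.

Lemma bounded_mfunC_position (u : R) (h : R -> R[i]) : S u -> bounded_mfunC D h ->
  bounded_mfunC (alive X u) (fun w => h (position X u w)).
Proof.
by move=> Su [hr hi]; split; [move: hr|move: hi];
  exact: (bounded_position_comp mD hX Su).
Qed.

Lemma bounded_mfunC_semigroup (u : R) h : S u -> bounded_mfunC D h ->
  bounded_mfunC D (semigroup X u h).
Proof.
by move=> Su [hr hi]; split; [move: hr|move: hi]; exact: (bounded_mfun_rexp mD hX Su).
Qed.

(** Time 0 acts as the identity because [markov_start] puts all the mass on paths alive at 0 and
    located at [x]. Staircases do contain steps of time 0, whereas (A1) concerns positive times. *)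
Lemma semigroup0 h x : D x -> bounded_mfunC D h -> semigroup X 0 h x = h x.
Proof.
move=> Dx [hr hi].
have S0 := time_interval0 hS.
have mA := measurable_alive hX S0.
have mx := markov_measurable hX S0 (measurable_set1 x).
have e (k : R -> R) : bounded_mfun D k -> rexp X 0 k x = k x.
  move=> bk.
  have iP : start_law X x (~` alive_in X 0 [set x]) = 0%E.
    by rewrite probability_setC// (markov_start hX Dx) subee.
  rewrite /rexp /Rintegral.
  rewrite (@ae_eq_integral _ _ _ _ _ (fun=> (k x)%:E))//.
  - rewrite integral_cst// [X in (_ * X)%E](_ : _ = 1%E) ?mule1//.
    apply/eqP; rewrite eq_le probability_le1//= -(markov_start hX Dx).
    by apply: le_measure; rewrite ?inE// => w [w0 _]; split.
  - by apply/measurable_EFinP; case: (bounded_position_comp mD hX S0 bk).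
  - exists (~` alive_in X 0 [set x]); split => //; first exact: measurableC.
    move=> w /= H [w0 wx]; apply: H => _.
    by rewrite wx.
rewrite -[RHS](_ : rexp X 0 (fun y => complex.Re (h y)) x +i* rexp X 0 (fun y =>
  complex.Im (h y)) x = _)//.
by rewrite !e//; case: (h x).
Qed.

Lemma markov_complex (x u v : R) (xi : O -> R[i]) (h : R -> R[i]) :
  D x -> S u -> S v -> u <= v ->
  @bounded_mfunC _ (past X S u) R (alive X u) xi -> bounded_mfunC D h ->
  integralC (start_law X x) (alive X v) (fun w => xi w * h (position X v w)) =
  integralC (start_law X x) (alive X u)
    (fun w => xi w * semigroup X (v - u) h (position X u w)).
Proof.
move=> Dx Su Sv uv [xr xm] [hr hm].
have Svu : S (v - u).
  apply: (time_interval_le hS Sv); first by rewrite subr_ge0.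
  by rewrite gerBl (time_interval_ge0 hS).
have mau := measurable_alive hX Su; have mav := measurable_alive hX Sv.
have fv := start_law_finite X x mav; have fu := start_law_finite X x mau.
have mpu : @measurable _ (past X S u) (alive X u) by exact: past_alive.
have bO f : @bounded_mfun _ (past X S u) R (alive X u) f -> @bounded_mfun _ O R (alive X u) f.
  move=> bf; have [mf [M fM]] := bounded_mfun_restrict mpu bf.
  apply: (bounded_mfun_eq (f := f \_ (alive X u))).
    by move=> w wu; rewrite patchT// inE.
  split; last by exists M => w _; exact: fM.
  exact: (past_measurable_fun hX mau mf).
have real f k : @bounded_mfun _ (past X S u) R (alive X u) f -> bounded_mfun D k ->
  \int[start_law X x]_(w in alive X v) (f w * k (position X v w)) =
  \int[start_law X x]_(w in alive X u) (f w * rexp X (v - u) k (position X u w)).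
  move=> bf bk; have bf' := bounded_mfun_restrict mpu bf.
  have := markov_real hS mD hX Dx Su Sv uv bf' bk.
  rewrite (@eq_Rintegral _ O _ _ _ (fun w : O => f w * k (position X v w))); last first.
    by move=> w /set_mem /(alive_mono uv) wu; rewrite patchT// inE.
  move=> ->; apply: eq_Rintegral => w wu; by rewrite patchT.
have bv f k : @bounded_mfun _ (past X S u) R (alive X u) f -> bounded_mfun D k ->
    bounded_mfun (alive X v) (fun w => f w * k (position X v w)).
  move=> bf bk; apply: bounded_mfunM; last exact: (bounded_position_comp mD hX Sv bk).
  by apply: bounded_mfunS (bO _ bf) => //; exact: alive_mono.
have bu f k : @bounded_mfun _ (past X S u) R (alive X u) f -> bounded_mfun D k ->
    bounded_mfun (alive X u) (fun w => f w * rexp X (v - u) k (position X u w)).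
  move=> bf bk; apply: bounded_mfunM; first exact: bO.
  by apply: (bounded_position_comp mD hX Su); exact: (bounded_mfun_rexp mD hX Svu).
congr (_ +i* _).
- transitivity (\int[start_law X x]_(w in alive X v)
    (complex.Re (xi w) * complex.Re (h (position X v w)) -
     complex.Im (xi w) * complex.Im (h (position X v w)))).
    by apply: eq_Rintegral => w _; rewrite cReM.
  rewrite RintegralB_bounded//; [|exact: bv xr hr|exact: bv xm hm].
  rewrite (real _ _ xr hr) (real _ _ xm hm) -RintegralB_bounded//;
    [|exact: bu xr hr|exact: bu xm hm].
  by apply: eq_Rintegral => w _; rewrite cReM.
- transitivity (\int[start_law X x]_(w in alive X v)
    (complex.Re (xi w) * complex.Im (h (position X v w)) +
     complex.Im (xi w) * complex.Re (h (position X v w)))).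
    by apply: eq_Rintegral => w _; rewrite cImM.
  rewrite RintegralD_bounded//; [|exact: bv xr hm|exact: bv xm hr].
  rewrite (real _ _ xr hm) (real _ _ xm hr) -RintegralD_bounded//;
    [|exact: bu xr hm|exact: bu xm hr].
  by apply: eq_Rintegral => w _; rewrite cImM.
Qed.

Context (q : R -> R[i]) (qP : Cplus_fun D q).

Lemma bounded_mfunC_expmul (a : R) h : 0 <= a -> bounded_mfunC D h ->
  bounded_mfunC D (expmul q a h).
Proof.
move=> a0 bh; apply: bounded_mfunCM => //; apply: bounded_mfunC_nsq.
  exact: measurable_expmul1.
by move=> x; exact: nsq_expmul1.
Qed.

Lemma bounded_mfunC_steps_op l h : nneg_steps l -> S (steps_time l) ->
  bounded_mfunC D h -> bounded_mfunC D (steps_op X q l h).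
Proof.
move=> + + bh; elim: l => [//|[a b] l IH] l0; rewrite steps_time_cons => Sl.
have [/= a0 b0 l1] := nneg_steps_cons l0; have t0 := steps_time_ge0 l1.
apply: bounded_mfunC_expmul => //; apply: bounded_mfunC_semigroup.
  by apply: (time_interval_le hS Sl) => //; rewrite lerDl.
by apply: IH => //; apply: (time_interval_le hS Sl) => //; rewrite lerDr.
Qed.

(** The factor of the first step depends on the position at [u] only. It is absorbed into the
    functional [xi] of the past; then the Markov property between [u] and [u + b] applies, and the
    induction hypothesis is used with the enlarged functional. *)
Lemma steps_markov x u l (xi : O -> R[i]) h : D x -> 0 <= u ->
  nneg_steps l -> S (u + steps_time l) ->
  @bounded_mfunC _ (past X S u) R (alive X u) xi -> bounded_mfunC D h ->
  integralC (start_law X x) (alive X (u + steps_time l))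
    (fun w => xi w * (expC (- steps_sum (fun v => q (position X v w)) u l) *
       h (position X (u + steps_time l) w))) =
  integralC (start_law X x) (alive X u)
    (fun w => xi w * steps_op X q l h (position X u w)).
Proof.
move=> Dx + + + + bh; elim: l u xi => [|[a b] l IH] u xi u0 l0 Sl bxi.
  rewrite /steps_time big_nil addr0; apply: eq_integralC => w _ /=.
  by rewrite oppr0 expC0 mul1r.
have [/= a0 b0 l1] := nneg_steps_cons l0.
have t0 := steps_time_ge0 l1.
move: Sl; rewrite steps_time_cons addrA => Sl.
have Sub : S (u + b) by apply: (time_interval_le hS Sl); rewrite ?addr_ge0// lerDl.
have Su : S u by apply: (time_interval_le hS Sub) => //; rewrite lerDl.
have Stl : S (steps_time l).
  by apply: (time_interval_le hS Sl) => //; rewrite lerDr addr_ge0.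
have uub : u <= u + b by rewrite lerDl.
pose xi' w := xi w * expC ((- a)%:C * q (position X u w)).
have bq : @bounded_mfunC _ (past X S u) R (alive X u) (fun w =>
  expC ((- a)%:C * q (position X u w))).
  have [mr mi] := measurable_expmul1 qP a.
  apply: bounded_mfunC_nsq.
    by split; [move: mr|move: mi] => m; apply: (past_position mD hX Su (lexx u) m).
  by move=> w wu; apply: (nsq_expmul1 qP a0); exact: (alive_state hX Su).
have bxi' : @bounded_mfunC _ (past X S u) R (alive X u) xi' by exact: bounded_mfunCM.
(* The enlarged functional has to be measurable for the past of the later time [u + b], on the
   smaller event of survival until then. *)
have bxi'' : @bounded_mfunC _ (past X S (u + b)) R (alive X (u + b)) xi'.
  have mono f : @bounded_mfun _ (past X S u) R (alive X u) f ->
      @bounded_mfun _ (past X S (u + b)) R (alive X (u + b)) f.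
    move=> [mf [M fM]]; split; last by exists M => w /(alive_mono uub); exact: fM.
    move=> _ B mB.
    have pu : @measurable _ (past X S u) (alive X u) by exact: past_alive.
    have pub : @measurable _ (past X S (u + b)) (alive X (u + b)) by exact: past_alive.
    have := measurableI _ _ pub (past_mono uub (mf pu _ mB)).
    congr measurable; apply/seteqP; split => w /=; first by case=> ? [].
    by case=> wub Bw; split => //; split => //; exact: alive_mono wub.
  by case: bxi' => br bi; split; exact: mono.
transitivity (integralC (start_law X x) (alive X u)
   (fun w => xi' w * semigroup X (u + b - u) (steps_op X q l h) (position X u w))); last first.
  by apply: eq_integralC => w _; rewrite /xi' /expmul [u + b]addrC addrK mulrA.
rewrite -(markov_complex Dx Su Sub uub bxi'); last exact: bounded_mfunC_steps_op.
rewrite -(IH (u + b) xi')//; last by rewrite addr_ge0.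
apply: eq_integralC => w _.
rewrite /xi' -!mulrA; congr (_ * _); rewrite mulrA; congr (_ * _).
by rewrite -expCD opprD; congr expC; rewrite rmorphN mulNr.
Qed.

(** Case of starting time 0 and [xi] equal to 1: what remains is the semigroup at time 0 applied to
    [steps_op], which [semigroup0] removes. *)
Lemma steps_expectation x l h : D x -> nneg_steps l -> S (steps_time l) ->
  bounded_mfunC D h ->
  expectation_alive X (steps_time l) (fun w =>
    expC (- steps_sum (fun v => q (position X v w)) 0 l) *
    h (position X (steps_time l) w)) x = steps_op X q l h x.
Proof.
move=> Dx l0 Sl bh.
have b1 : @bounded_mfunC _ (past X S 0) R (alive X 0) (fun=> 1).
  by split; exact: bounded_mfun_cst.
have := steps_markov (xi := fun=> 1) Dx (lexx 0) l0; rewrite add0r => /(_ h Sl b1 bh).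
rewrite /expectation_alive => H.
rewrite -(semigroup0 Dx (bounded_mfunC_steps_op l0 Sl bh)).
rewrite /semigroup /expectation_alive; apply: etrans (etrans H _);
  by apply: eq_integralC => w _; rewrite mul1r.
Qed.

End steps_markov.

(** * Jensen's inequality and excessive measures *)

Section jensen.
Context {d} {T : measurableType d} {R : realType}.
Context (m : {measure set T -> \bar R}) (A : set T).
Hypotheses (mA : measurable A) (m1 : (m A <= 1)%E).

Lemma le_measure1_lty : (m A < +oo)%E.
Proof. by rewrite (le_lt_trans m1)// ltry. Qed.

(** On a set of mass at most 1 constants are integrable, and [|g|] is at most [g ^+ 2 + 1]. *)
Lemma sqr_integrable (g : T -> R) : measurable_fun A g ->
  (\int[m]_(x in A) (g x ^+ 2)%:E < +oo)%E -> m.-integrable A (EFin \o g).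
Proof.
move=> mg fin; have m1y := le_measure1_lty.
have ig2 : m.-integrable A (fun x => (g x ^+ 2)%:E).
  apply/integrableP; split; first exact/measurable_EFinP/measurable_funX.
  by under eq_integral do rewrite gee0_abs ?lee_fin ?sqr_ge0//.
have ic : m.-integrable A (fun x => (g x ^+ 2)%:E + 1%:E)%E.
  by apply: integrableD => //; exact: (bounded_mfun_integrable mA m1y (bounded_mfun_cst A 1)).
apply: le_integrable ic => //; first exact/measurable_EFinP.
move=> x Ax /=; rewrite lee_fin [leRHS]ger0_norm ?addr_ge0 ?sqr_ge0//.
rewrite -(real_normK (num_real (g x))).
have := sqr_ge0 (`|g x| - 1); nra.
Qed.

(** Jensen's inequality for sub-probabilities, as killing requires. With [c] and [s] the integrals
    of [g] and [g ^+ 2] and m the mass, integrating [(g x - c) ^+ 2] gives 0 <= s - 2 c^2 + m c^2,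
    and m <= 1. *)
Lemma Rintegral_sqr_le (g : T -> R) : measurable_fun A g ->
  (((\int[m]_(x in A) g x) ^+ 2)%:E <= \int[m]_(x in A) (g x ^+ 2)%:E)%E.
Proof.
move=> mg.
have [->|fin] := eqVneq (\int[m]_(x in A) (g x ^+ 2)%:E)%E +oo%E; first exact: leey.
have {}fin : (\int[m]_(x in A) (g x ^+ 2)%:E < +oo)%E by rewrite ltey.
have ig := sqr_integrable mg fin; have m1y := le_measure1_lty.
have ig2 : m.-integrable A (fun x => (g x ^+ 2)%:E).
  apply/integrableP; split; first exact/measurable_EFinP/measurable_funX.
  by under eq_integral do rewrite gee0_abs ?lee_fin ?sqr_ge0//.
have fg2 := integrable_fin_num mA ig2.
rewrite -(fineK fg2) lee_fin -/(Rintegral m A (fun x => g x ^+ 2)).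
set c := \int[m]_(x in A) g x; set s := \int[m]_(x in A) (g x ^+ 2).
have icst (k : R) : m.-integrable A (EFin \o (fun=> k)) by exact:
  (bounded_mfun_integrable mA m1y (bounded_mfun_cst A k)).
have i2 : m.-integrable A (EFin \o (fun x => - (2 * c) * g x)).
  by have := integrableZl mA (- (2 * c)) ig.
have pos : 0 <= \int[m]_(x in A) ((g x ^+ 2 + (- (2 * c) * g x)) + c ^+ 2).
  apply: Rintegral_ge0 => x _.
  rewrite (_ : _ + _ = (g x - c) ^+ 2) ?sqr_ge0//; ring.
move: pos; rewrite RintegralD//; last by have := integrableD mA ig2 i2.
rewrite RintegralD// RintegralZl// Rintegral_cst// -/c -/s.
have : 0 <= fine (m A) <= 1.
  by rewrite fine_ge0//= -lee_fin fineK// ge0_fin_numE.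
have := sqr_ge0 c; move: (fine (m A)) => k; nra.
Qed.

Lemma nsq_integralC_le (z : T -> R[i]) : measurable_funC A z ->
  ((nsq (integralC m A z))%:E <= \int[m]_(x in A) (nsq (z x))%:E)%E.
Proof.
move=> [mr mi]; rewrite /nsq EFinD.
under eq_integral do rewrite EFinD.
rewrite ge0_integralD//; last 4 first.
- by move=> x _; rewrite lee_fin sqr_ge0.
- exact/measurable_EFinP/measurable_funX.
- by move=> x _; rewrite lee_fin sqr_ge0.
- exact/measurable_EFinP/measurable_funX.
by apply: leeD; exact: Rintegral_sqr_le.
Qed.

Lemma nsq_integrable (z : T -> R[i]) : measurable_funC A z ->
  (\int[m]_(x in A) (nsq (z x))%:E < +oo)%E ->
  m.-integrable A (fun x => (complex.Re (z x))%:E) /\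
  m.-integrable A (fun x => (complex.Im (z x))%:E).
Proof.
move=> mz fin; have [mr mi] := mz.
have mn := measurable_nsqE mz.
split; apply: sqr_integrable => //; apply: le_lt_trans fin; apply: ge0_le_integral => //.
- by move=> x _; rewrite lee_fin sqr_ge0.
- exact/measurable_EFinP/measurable_funX.
- by move=> x _; rewrite lee_fin lerDl sqr_ge0.
- by move=> x _; rewrite lee_fin sqr_ge0.
- exact/measurable_EFinP/measurable_funX.
- by move=> x _; rewrite lee_fin lerDr sqr_ge0.
Qed.

Lemma integralCB (z z' : T -> R[i]) : measurable_funC A z -> measurable_funC A z' ->
  (\int[m]_(x in A) (nsq (z x))%:E < +oo)%E ->
  (\int[m]_(x in A) (nsq (z' x))%:E < +oo)%E ->
  integralC m A (fun x => z x - z' x) = integralC m A z - integralC m A z'.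
Proof.
move=> mz mz' f f'; have [ir ii] := nsq_integrable mz f.
have [ir' ii'] := nsq_integrable mz' f'.
apply: complex_eq; rewrite ?cReD ?cReN ?cImD ?cImN /integralC /= -RintegralB//;
  by apply: eq_Rintegral => x _; rewrite ?cReD ?cReN ?cImD ?cImN.
Qed.

End jensen.

Lemma cvg_nsq0 {R : realType} (u : nat -> R[i]) (z : R[i]) :
  (nsq (u n - z))%:E @[n --> \oo] --> 0%E ->
  complex.Re (u n) @[n --> \oo] --> complex.Re z /\
  complex.Im (u n) @[n --> \oo] --> complex.Im z.
Proof.
move=> c0.
have small (p : R[i] -> R) : (forall z w, p (z - w) = p z - p w) ->
    (forall z, p z ^+ 2 <= nsq z) -> p (u n) @[n --> \oo] --> p z.
  move=> pB pn; apply/cvgrPdist_lt => e e0.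
  have [N _ HN] := cvge0_near_lt c0 (exprn_gt0 2 e0).
  exists N => // n /= Nn; have := HN n Nn; rewrite lte_fin => lt.
  rewrite distrC -pB -(ltr_pXn2r (n := 2))// ?nnegrE ?ltW//.
  by rewrite real_normK ?num_real// (le_lt_trans (pn _)).
split; apply: small => *; rewrite ?cReD ?cReN ?cImD ?cImN// /nsq ?lerDl ?lerDr ?sqr_ge0//.
Qed.

(** Setting [f] to zero where [nsq f] exceeds [n] gives pointwise stationary convergence with an
    error dominated by [f] itself. It serves twice: under [mu], for the density of bounded
    functions, and under the start laws, for the measurability of the extension. *)
Lemma truncation {R : realType} {d} {T : measurableType d} (D : set T) (f : T -> R[i]) :
  measurable D -> measurable_funC D f ->
  exists f_ : nat -> T -> R[i],
    [/\ forall n, bounded_mfunC D (f_ n),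
        forall n x, nsq (f x - f_ n x) <= nsq (f x) &
        forall x, D x -> \forall n \near \oo, f_ n x = f x].
Proof.
move=> mD mf.
exists (fun n x => if x \in [set x | nsq (f x) <= n%:R] `&` D then f x else 0).
have mA n : measurable ([set x | nsq (f x) <= n%:R] `&` D).
  rewrite setIC.
  have := measurable_nsq mf mD (measurable_itv `]-oo, n%:R]).
  by congr (measurable (_ `&` _)); apply/seteqP; split => x /=; rewrite in_itv/=.
split.
- move=> n; apply/bounded_mfunCP; split.
    by apply: measurable_funC_if => //; exact: measurable_funC_cst.
  exists (Num.sqrt n%:R) => x Dx; case: ifPn => [|_]; last first.
    by rewrite Normc.normc0 sqrtr_ge0.
  by rewrite inE => -[/= fn _]; case: (f x) fn => a b; rewrite /nsq/= => ?; exact: ler_wsqrtr.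
- by move=> n x; case: ifP; rewrite ?subrr ?subr0// nsq0 nsq_ge0.
- move=> x Dx; exists (Num.truncn (nsq (f x))).+1 => // n /= nx.
  rewrite ifT// inE; split => //=.
  by rewrite ltW// (lt_le_trans (truncnS_gt _))// ler_nat.
Qed.

Lemma bounded_inL2_dense {R : realType} {d} {T : measurableType d}
    (mu : {measure set T -> \bar R}) (D : set T) (f : T -> R[i]) (e : R) :
  measurable D -> inL2 mu D f -> 0 < e ->
  exists2 h, bounded_inL2 mu D h & (Nsq mu D (fun x => f x - h x)%R < e%:E)%E.
Proof.
move=> mD Lf e0; have /inL2P[mf fi] := Lf.
have [f_ [bf_ lef_ ef_]] := truncation mD mf.
have mf_ n := ((bounded_mfunCP _ _).1 (bf_ n)).1.
have c0 : (Nsq mu D (fun x => f x - f_ n x)) @[n --> \oo] --> 0%E.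
  rewrite (_ : 0%E = \int[mu]_(x in D) cst 0%E x)%E; last by rewrite integral0.
  apply: (@dominated_cvg _ _ _ mu D mD (fun n x => (nsq (f x - f_ n x))%:E) _
    (fun x => (nsq (f x))%:E)) => //.
  - by move=> n; apply: measurable_nsqE; exact: measurable_funCB.
  - move=> x Dx; apply: cvg_near_cst; apply: filterS (ef_ x Dx) => n ->.
    by rewrite subrr nsq0.
  - apply/integrableP; split; first exact: measurable_nsqE.
    by under eq_integral do rewrite gee0_abs ?lee_fin ?nsq_ge0//.
  - by move=> n x Dx; rewrite gee0_abs ?lee_fin ?nsq_ge0.
have [N _ /(_ N (leqnn N)) hN] := cvge0_near_lt c0 e0.
exists (f_ N) => //.
have [_ bN] := (bounded_mfunCP _ _).1 (bf_ N); split => //.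
rewrite (_ : f_ N = (fun x => f x - (f x - f_ N x))).
  apply: inL2B => //; apply/inL2P; split; first exact: measurable_funCB.
  by apply: lt_trans hN _; rewrite ltry.
by apply/funext => x; rewrite subKr.
Qed.

(** * Excessiveness, from sets to functions *)

Section excessive_bound.
Context {R : realType} {d : measure_display} {O : measurableType d}.
Context (X : process R O) (S D : set R).
Hypotheses (hS : time_interval S) (mD : measurable D).
Hypothesis hX : markov_process X S D.
Context (mu : {measure set R -> \bar R}).
Hypothesis hmu : excessive X S D mu.

Definition eexp (u : R) (k : R -> \bar R) (x : R) : \bar R :=
  (\int[start_law X x]_(w in alive X u) k (position X u w))%E.

Lemma eexp_ge0 u k x : (forall y, 0 <= k y)%E -> (0 <= eexp u k x)%E.
Proof. by move=> k0; apply: integral_ge0. Qed.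

Lemma eexp_restrict u k x : S u -> eexp u (k \_ D) x = eexp u k x.
Proof.
move=> Su; apply: eq_integral => w /set_mem wu; rewrite patchT// inE.
exact: (alive_state hX Su).
Qed.

Lemma eexp_indic u x B : S u -> measurable B ->
  eexp u (EFin \o \1_B) x = start_law X x (alive_in X u (B `&` D)).
Proof.
move=> Su mB; rewrite -(fineK (_ : start_law X x (alive_in X u (B `&` D)) \is a fin_num));
  last first.
  rewrite ge0_fin_numE//; apply: start_law_finite.
  by apply: (markov_measurable hX Su); exact: measurableI.
rewrite -(rexp_indic hX _ Su); last exact: measurableI.
rewrite /rexp /Rintegral fineK.
  apply: eq_integral => w /set_mem wu /=.
  by rewrite !indicE in_setI [X in _ && X]mem_set ?andbT//; exact: (alive_state hX Su).
have mau := measurable_alive hX Su.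
apply: integrable_fin_num => //.
apply: bounded_mfun_integrable => //; first exact: start_law_finite.
apply: (bounded_position_comp mD hX Su); apply: bounded_fun_mfun.
  by apply: measurable_indic; exact: measurableI.
exists 1; split; first exact: num_real.
by move=> K K1 y _; rewrite /= ger0_norm// (le_trans _ (ltW K1))// indicE; case: (_ \in _).
Qed.

(** [excessive_le] is the case of indicators. Measurability of the image is carried along with the
    inequality because monotone convergence under [mu] requires it. *)
Lemma measurable_eexp_le u k : S u -> 0 < u -> measurable_fun D k ->
  (forall y, 0 <= k y)%E -> measurable_fun D (eexp u k) /\
  (\int[mu]_(x in D) eexp u k x <= \int[mu]_(x in D) k x)%E.
Proof.
move=> Su u0 mk k0.
have mau := measurable_alive hX Su.
suff : measurable_fun D (eexp u (k \_ D)) /\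
    (\int[mu]_(x in D) eexp u (k \_ D) x <= \int[mu]_(x in D) (k \_ D) x)%E.
  rewrite (_ : eexp u (k \_ D) = eexp u k); last first.
    by apply/funext => x; rewrite eexp_restrict.
  rewrite [in X in (_ <= X)%E](_ : \int[mu]_(x in D) (k \_ D) x = \int[mu]_(x in D) k x)%E//.
  by apply: eq_integral => y Dy; rewrite patchT.
have mkD : measurable_fun setT (k \_ D) by exact/(measurable_restrictT _ mD).
have kD0 y : (0 <= (k \_ D) y)%E by apply: erestrict_ge0.
have mp (f : R -> \bar R) : measurable_fun setT f ->
    measurable_fun (alive X u) (fun w => f (position X u w)).
  by move=> mf; apply: (measurable_position_comp mD hX Su); exact: measurable_funTS.
move: (k \_ D) mkD kD0; apply: ge0_measurable_ind.
- move=> B mB; split.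
    rewrite (funext (fun x => eexp_indic x Su mB)).
    by apply: (markov_kernel hX Su); exact: measurableI.
  rewrite (funext (fun x => eexp_indic x Su mB)).
  rewrite [leRHS](_ : _ = mu (B `&` D)); last by rewrite integral_indic.
  by apply: (excessive_le hmu Su u0); [exact: measurableI|exact: subIsetr].
- move=> a f g mf mg f0 g0 a0 [mEf lef] [mEg leg].
  have mf' := mp _ mf; have mg' := mp _ mg.
  have e x : eexp u (fun y => a%:E * f y + g y)%E x = (a%:E * eexp u f x + eexp u g x)%E.
    rewrite /eexp ge0_integralD//; last 2 first.
    - by move=> w _; rewrite mule_ge0.
    - exact: measurable_funeM.
    by rewrite ge0_integralZl_EFin.
  have af0 y : (0 <= a%:E * f y)%E by rewrite mule_ge0.
  have aE0 x : (0 <= a%:E * eexp u f x)%E by rewrite mule_ge0// eexp_ge0.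
  rewrite (funext e); split.
    by apply: emeasurable_funD => //; exact: measurable_funeM.
  have mfD : measurable_fun D f by exact: measurable_funTS.
  have mgD : measurable_fun D g by exact: measurable_funTS.
  rewrite ge0_integralD//; [|exact: measurable_funeM|by move=> x _; exact: eexp_ge0].
  rewrite [leRHS]ge0_integralD//; last exact: measurable_funeM.
  have -> : (\int[mu]_(x in D) (a%:E * eexp u f x) = a%:E * \int[mu]_(x in D) eexp u f x)%E.
    by rewrite ge0_integralZl_EFin// => x _; exact: eexp_ge0.
  have -> : (\int[mu]_(x in D) (a%:E * f x) = a%:E * \int[mu]_(x in D) f x)%E.
    by rewrite ge0_integralZl_EFin.
  by apply: leeD => //; rewrite lee_wpmul2l.
- move=> f_ f mf f0 nd cf IH.
  have c x : eexp u (f_ n) x @[n --> \oo] --> eexp u f x.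
    rewrite /eexp (eq_integral (fun w => limn (f_ ^~ (position X u w)))); last first.
      by move=> w _; apply/esym/cvg_lim => //; exact: cf.
    apply: cvg_monotone_convergence => //.
    by move=> n; exact: mp.
  split; first by apply: (emeasurable_fun_cvg _ _ (fun n => (IH n).1)) => x _; exact: c.
  have -> : (\int[mu]_(x in D) eexp u f x = limn (fun n => \int[mu]_(x in D) eexp u (f_ n) x))%E.
    rewrite -monotone_convergence//.
    + by apply: eq_integral => x _; apply/esym/cvg_lim => //; exact: c.
    + by move=> n; exact: (IH n).1.
    + by move=> n x _; exact: eexp_ge0.
    + move=> x _ i j ij; apply: ge0_le_integral => //.
      * exact: mp.
      * exact: mp.
      * by move=> w _; exact: nd.
  have -> : (\int[mu]_(x in D) f x = limn (fun n => \int[mu]_(x in D) f_ n x))%E.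
    rewrite -monotone_convergence//.
    + by apply: eq_integral => x _; apply/esym/cvg_lim => //; exact: cf.
    + by move=> n; exact: measurable_funTS.
  apply: lee_lim.
  + apply: ereal_nondecreasing_is_cvgn => i j ij; apply: ge0_le_integral => //.
    * by move=> x _; exact: eexp_ge0.
    * exact: (IH i).1.
    * exact: (IH j).1.
    * move=> x _; apply: ge0_le_integral => //; [exact: mp|exact: mp|].
      by move=> w _; exact: nd.
  + apply: ereal_nondecreasing_is_cvgn => i j ij; apply: ge0_le_integral => //.
    * exact: measurable_funTS.
    * exact: measurable_funTS.
    * by move=> x _; exact: nd.
  + by apply: nearW => n; exact: (IH n).2.
Qed.

(** The function P_u(|f|^2), possibly infinite at some points: the pointwise majorant of the squared
    expectations below. *)
Definition sqexp (u : R) (f : R -> R[i]) : R -> \bar R :=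
  eexp u (fun y => (nsq (f y))%:E).

Lemma sqexp_ge0 u f x : (0 <= sqexp u f x)%E.
Proof. by apply: eexp_ge0 => y; rewrite lee_fin nsq_ge0. Qed.

Lemma start_law_alive0 x : D x -> start_law X x (alive X 0) = 1%E.
Proof.
move=> Dx; have S0 := time_interval0 hS.
have mA := measurable_alive hX S0.
apply/eqP; rewrite eq_le probability_le1//= -(markov_start hX Dx).
apply: le_measure; rewrite ?inE//.
  by apply: (markov_measurable hX S0); exact: measurable_set1.
by move=> w [w0 _]; split.
Qed.

Lemma sqexp0 f x : D x -> measurable_funC D f -> sqexp 0 f x = (nsq (f x))%:E.
Proof.
move=> Dx mf; have S0 := time_interval0 hS.
have mA := measurable_alive hX S0.
have mx := markov_measurable hX S0 (measurable_set1 x).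
have iP : start_law X x (~` alive_in X 0 [set x]) = 0%E.
  by rewrite probability_setC// (markov_start hX Dx) subee.
rewrite /sqexp /eexp (@ge0_ae_eq_integral _ _ _ _ _ _ (fun=> (nsq (f x))%:E))//.
- rewrite integral_cst//.
  by rewrite [X in (_ * X)%E](_ : _ = 1%E) ?mule1//; exact: start_law_alive0.
- by apply: (measurable_position_comp mD hX S0 (k := fun y => (nsq (f y))%:E));
  exact: measurable_nsqE.
- by move=> w _; rewrite lee_fin nsq_ge0.
- by move=> w _; rewrite lee_fin nsq_ge0.
- exists (~` alive_in X 0 [set x]); split => //; first exact: measurableC.
  by move=> w /= H [w0 wx]; apply: H => _; rewrite wx.
Qed.

(** Excessiveness speaks of positive times; at time 0 the majorant is [nsq f] itself. *)
Lemma sqexp_le u f : S u -> measurable_funC D f ->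
  measurable_fun D (sqexp u f) /\
  (\int[mu]_(x in D) sqexp u f x <= Nsq mu D f)%E.
Proof.
move=> Su mf; have := time_interval_ge0 hS Su; rewrite le_eqVlt => /predU1P[u0|u0].
  rewrite -u0; split.
    by apply: eq_measurable_fun (measurable_nsqE mf) => x /set_mem Dx; rewrite sqexp0.
  by rewrite (eq_integral (fun x => (nsq (f x))%:E))// => x /set_mem Dx; rewrite sqexp0.
apply: measurable_eexp_le => //; first exact: measurable_nsqE.
by move=> y; rewrite lee_fin nsq_ge0.
Qed.

End excessive_bound.

Section distance.
Context {R : realType} {d : measure_display} {T : measurableType d}.
Context (mu : {measure set T -> \bar R}) (D : set T).
Hypothesis mD : measurable D.

Lemma Nsq_triangle_lt (f g h : T -> R[i]) (a b : R) : inL2 mu D f -> inL2 mu D g ->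
  inL2 mu D h ->
  (Nsq mu D (fun x => f x - g x)%R < a%:E)%E ->
  (Nsq mu D (fun x => g x - h x)%R < b%:E)%E ->
  (Nsq mu D (fun x => f x - h x)%R < (2 * a + 2 * b)%:E)%E.
Proof.
move=> /inL2P[mf _] /inL2P[mg _] /inL2P[mh _] fg gh.
apply: (le_lt_trans (NsqB_le mu mD mf mg mh)).
have -> : (2 * a + 2 * b)%:E = (2%:E * a%:E + 2%:E * b%:E)%E by [].
by rewrite lteD// lte_pmul2l.
Qed.

Lemma ae_eq_Nsq_sub (f f' g g' : T -> R[i]) : inL2 mu D f -> inL2 mu D f' ->
  inL2 mu D g -> inL2 mu D g' ->
  f = f' %[ae mu in D] -> g = g' %[ae mu in D] ->
  Nsq mu D (fun x => f x - g x) = Nsq mu D (fun x => f' x - g' x).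
Proof.
move=> /inL2P[mf _] /inL2P[mf' _] /inL2P[mg _] /inL2P[mg' _] ff' gg'.
apply: (ae_eq_Nsq mD); [exact: measurable_funCB|exact: measurable_funCB|].
by apply: filterS2 ff' gg' => x h1 h2 Dx; rewrite h1// h2.
Qed.

Lemma extension_Nsq A B f (eta : R) : continuous_extensionL2 mu D A B ->
  inL2 mu D f -> 0 < eta ->
  exists2 rho : R, 0 < rho & forall h, inL2 mu D h ->
    (Nsq mu D (fun x => h x - f x)%R < rho%:E)%E ->
    (Nsq mu D (fun x => B h x - B f x)%R < eta%:E)%E.
Proof.
move=> AB Lf eta0.
have se0 : 0 < Num.sqrt eta by rewrite sqrtr_gt0.
have [r r0 H] := extension_continuous AB Lf se0.
exists (r ^+ 2); first exact: exprn_gt0.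
move=> h Lh hf; have := H h Lh; rewrite !L2norm_lt// sqr_sqrtr ?ltW//; exact.
Qed.

End distance.

(** * Path functionals approximated by step sums *)

Section functional.
Context {R : realType} {d : measure_display} {O : measurableType d}.
Context (X : process R O) (S D : set R).
Hypotheses (hS : time_interval S) (mD : measurable D).
Hypothesis hX : markov_process X S D.
Context (mu : {measure set R -> \bar R}).
Hypothesis hmu : excessive X S D mu.
Context (q : R -> R[i]) (qP : Cplus_fun D q).
Context (e : R) (Se : S e).
Context (J : O -> R[i]) (l_ : nat -> seq (R * R)).
Hypotheses (l0 : forall n, nneg_steps (l_ n)) (lt : forall n, steps_time (l_ n) = e).

(** [J] enters only as the limit, on paths alive at [e], of step sums along staircases of total time
    [e]. Both processes are instances: X with the jump steps, Y with the shifted ones. *)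
Let sums n w := steps_sum (fun v => q (position X v w)) 0 (l_ n).

Hypothesis J_re : forall w, alive X e w ->
  complex.Re (sums n w) @[n --> \oo] --> complex.Re (J w).
Hypothesis J_im : forall w, alive X e w ->
  complex.Im (sums n w) @[n --> \oo] --> complex.Im (J w).

Let xi w := expC (- J w).
Let EX (f : R -> R[i]) : R -> R[i] :=
  expectation_alive X e (fun w => xi w * f (position X e w)).

Lemma steps_sum_Re_ge0 l u w : 0 <= u -> nneg_steps l -> u + steps_time l = e ->
  alive X e w -> 0 <= complex.Re (steps_sum (fun v => q (position X v w)) u l).
Proof.
move=> + + + we; elim: l u => [|[a b] l IH] u u0 ll0 ule /=; first by [].
have [/= a0 b0 ll1] := nneg_steps_cons ll0.
have t0 := steps_time_ge0 ll1.
rewrite steps_time_cons in ule.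
have ue : u <= e by rewrite -ule lerDl addr_ge0.
rewrite cReD cReM /= mul0r subr0 addr_ge0//; last first.
  by apply: IH; rewrite ?addr_ge0// -addrA.
rewrite mulr_ge0// qP.2//; apply: (alive_state hX).
  exact: (time_interval_le hS Se).
exact: alive_mono we.
Qed.

Lemma measurable_steps_sum l u : 0 <= u -> nneg_steps l -> u + steps_time l = e ->
  measurable_funC (alive X e) (fun w => steps_sum (fun v => q (position X v w)) u l).
Proof.
elim: l u => [|[a b] l IH] u u0 ll0 ule /=; first exact: measurable_funC_cst.
have [/= a0 b0 ll1] := nneg_steps_cons ll0.
have t0 := steps_time_ge0 ll1.
rewrite steps_time_cons in ule.
have ue : u <= e by rewrite -ule lerDl addr_ge0.
have Su : S u by exact: (time_interval_le hS Se).
apply: measurable_funCD; last by apply: IH; rewrite ?addr_ge0// -addrA.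
apply: measurable_funCM; first exact: measurable_funC_cst.
have mau := measurable_alive hX Su.
by split; [have m := qP.1.1|have m := qP.1.2];
  apply: (measurable_funS mau (alive_mono ue));
  exact: (measurable_position_comp mD hX Su m).
Qed.

Let xi_ n w := expC (- sums n w).

Lemma nsq_xi_n n w : alive X e w -> nsq (xi_ n w) <= 1.
Proof.
move=> we; apply: nsq_expC_le1; rewrite cReN oppr_le0.
by apply: steps_sum_Re_ge0; rewrite ?add0r.
Qed.

Lemma measurable_xi_n n : measurable_funC (alive X e) (xi_ n).
Proof.
apply: measurable_funCX; apply: measurable_funCN.
by apply: measurable_steps_sum; rewrite ?add0r.
Qed.

Lemma cvg_xi w : alive X e w ->
  complex.Re (xi_ n w) @[n --> \oo] --> complex.Re (xi w) /\
  complex.Im (xi_ n w) @[n --> \oo] --> complex.Im (xi w).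
Proof.
move=> we; apply: cvg_expC.
- under eq_fun do rewrite cReN; rewrite cReN; apply: cvgN; exact: J_re.
- under eq_fun do rewrite cImN; rewrite cImN; apply: cvgN; exact: J_im.
Qed.

Lemma nsq_xi w : alive X e w -> nsq (xi w) <= 1.
Proof.
move=> we; apply: nsq_expC_le1; rewrite cReN oppr_le0.
rewrite -(cvg_lim _ (J_re we))//; apply: limr_ge; first exact: cvgP (J_re we).
by apply: nearW => n; apply: steps_sum_Re_ge0; rewrite ?add0r.
Qed.

(** [J] stands for an integral over time along the path; its measurability is read off the step
    sums, each of which involves finitely many positions. *)
Lemma measurable_xi : measurable_funC (alive X e) xi.
Proof.
split.
- apply: (measurable_fun_cvgR (fun n => (measurable_xi_n n).1)) => w we.
  exact: (cvg_xi we).1.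
- apply: (measurable_fun_cvgR (fun n => (measurable_xi_n n).2)) => w we.
  exact: (cvg_xi we).2.
Qed.

Lemma measurable_funC_position (f : R -> R[i]) : measurable_funC D f ->
  measurable_funC (alive X e) (fun w => f (position X e w)).
Proof.
by move=> [mr mi]; split; [move: mr|move: mi] => m;
  exact: (measurable_position_comp mD hX Se m).
Qed.

Lemma integral_nsq_xi_le f x : measurable_funC D f ->
  (\int[start_law X x]_(w in alive X e) (nsq (xi w * f (position X e w)))%:E
   <= sqexp X e f x)%E.
Proof.
move=> mf; apply: ge0_le_integral.
- exact: (measurable_alive hX Se).
- by move=> w _; rewrite lee_fin nsq_ge0.
- by apply/measurable_nsqE/measurable_funCM; [exact: measurable_xi|exact: measurable_funC_position].
- by apply: measurable_nsqE; exact: measurable_funC_position.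
- by move=> w we; rewrite lee_fin nsqM ler_piMl ?nsq_ge0 ?nsq_xi.
Qed.

(** Jensen's inequality followed by [nsq (xi w) <= 1]. This estimate yields both the domination for
    bounded functions and the continuity of the extension. *)
Lemma nsq_EX_le f x : measurable_funC D f -> ((nsq (EX f x))%:E <= sqexp X e f x)%E.
Proof.
move=> mf; apply: le_trans (integral_nsq_xi_le x mf).
have mA := measurable_alive hX Se.
apply: nsq_integralC_le => //; first exact: probability_le1.
by apply: measurable_funCM; [exact: measurable_xi|exact: measurable_funC_position].
Qed.

(** Finiteness of the two majorants makes both integrals genuine; otherwise the default value of
    [fine] could break additivity. *)
Lemma EXB f g x : measurable_funC D f -> measurable_funC D g ->
  (sqexp X e f x < +oo)%E -> (sqexp X e g x < +oo)%E ->
  EX (fun y => f y - g y) x = EX f x - EX g x.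
Proof.
move=> mf mg ff fg.
have mA := measurable_alive hX Se.
rewrite /EX /expectation_alive -integralCB//.
- by apply: eq_integralC => w _; rewrite mulrBr.
- exact: probability_le1.
- by apply: measurable_funCM; [exact: measurable_xi|exact: measurable_funC_position].
- by apply: measurable_funCM; [exact: measurable_xi|exact: measurable_funC_position].
- exact: le_lt_trans (integral_nsq_xi_le x mf) ff.
- exact: le_lt_trans (integral_nsq_xi_le x mg) fg.
Qed.

Lemma sqexp_bounded h : bounded_mfunC D h ->
  exists M : R, forall x, (sqexp X e h x <= M%:E)%E.
Proof.
move=> /bounded_mfunCP[mh [M hM]]; exists (M ^+ 2) => x.
have mA := measurable_alive hX Se.
apply: (@le_trans _ _ (\int[start_law X x]_(w in alive X e) (M ^+ 2)%:E)%E).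
  apply: ge0_le_integral => //.
  - by move=> w _; rewrite lee_fin nsq_ge0.
  - by apply: measurable_nsqE; exact: measurable_funC_position.
  - move=> w we; rewrite lee_fin -normc_sqr.
    have Dw := alive_state hX Se we.
    have n0 : 0 <= Normc.normc (h (position X e w)).
      by case: (h _) => ? ?; exact: sqrtr_ge0.
    by rewrite lerXn2r ?nnegrE ?hM// (le_trans n0)// hM.
rewrite integral_cst// -[leRHS]mule1 lee_wpmul2l ?lee_fin ?sqr_ge0//.
exact: probability_le1.
Qed.

Lemma cvg_steps_op_EX h x : D x -> bounded_mfunC D h ->
  complex.Re (steps_op X q (l_ n) h x) @[n --> \oo] --> complex.Re (EX h x) /\
  complex.Im (steps_op X q (l_ n) h x) @[n --> \oo] --> complex.Im (EX h x).
Proof.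
move=> Dx bh.
have mA := measurable_alive hX Se; have fA := start_law_finite X x mA.
have hE n : steps_op X q (l_ n) h x =
    integralC (start_law X x) (alive X e) (fun w => xi_ n w * h (position X e w)).
  rewrite -(steps_expectation hS mD hX qP Dx (@l0 n))// ?lt//.
have bp := bounded_mfunC_position mD hX Se bh.
have [[mr [M rM]] [mi [N iN]]] := bp.
have x1 n w : alive X e w -> `|complex.Re (xi_ n w)| <= 1 /\ `|complex.Im (xi_ n w)| <= 1.
  by move=> we; apply: nsq_le1P; exact: nsq_xi_n.
have mx n := measurable_funCM (measurable_xi_n n) (conj mr mi).
(* Both parts of [xi_ n] have absolute value at most 1, so each part of the product is bounded by
   the sum of the bounds [M] and [N] of the two parts of [h]. *)
split; (under eq_fun do rewrite hE); rewrite /EX /expectation_alive /integralC /=;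
  apply: (bounded_cvg_Rintegral mA fA (M := M + N)).
- by move=> n; exact: (mx n).1.
- move=> n w we; have [xr xm] := x1 n w we.
  rewrite cReM (le_trans (ler_normB _ _))// lerD//.
    by rewrite normrM -[leRHS]mul1r ler_pM// rM.
  by rewrite normrM -[leRHS]mul1r ler_pM// iN.
- move=> w we; have [cr ci] := cvg_xi we.
  under eq_fun do rewrite cReM; rewrite cReM.
  by apply: cvgB; apply: cvgM => //; exact: cvg_cst.
- by move=> n; exact: (mx n).2.
- move=> n w we; have [xr xm] := x1 n w we.
  rewrite cImM (le_trans (ler_normD _ _))// [leRHS]addrC lerD//.
    by rewrite normrM -[leRHS]mul1r ler_pM// iN.
  by rewrite normrM -[leRHS]mul1r ler_pM// rM.
- move=> w we; have [cr ci] := cvg_xi we.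
  under eq_fun do rewrite cImM; rewrite cImM.
  by apply: cvgD; apply: cvgM => //; exact: cvg_cst.
Qed.

Lemma bounded_mfunC_steps_op_n n h : bounded_mfunC D h -> bounded_mfunC D (steps_op X q (l_ n) h).
Proof. by move=> bh; apply: (bounded_mfunC_steps_op hS mD hX qP) => //; rewrite lt. Qed.

Lemma measurable_EX_bounded h : bounded_mfunC D h -> measurable_funC D (EX h).
Proof.
move=> bh; have mo n := (bounded_mfunCP _ _).1 (bounded_mfunC_steps_op_n n bh).
split.
- apply: (measurable_fun_cvgR (fun n => (mo n).1.1)) => x Dx.
  exact: (cvg_steps_op_EX Dx bh).1.
- apply: (measurable_fun_cvgR (fun n => (mo n).1.2)) => x Dx.
  exact: (cvg_steps_op_EX Dx bh).2.
Qed.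

Lemma nsq_steps_op_le n h x : D x -> bounded_mfunC D h ->
  ((nsq (steps_op X q (l_ n) h x))%:E <= sqexp X e h x)%E.
Proof.
move=> Dx bh; rewrite -(steps_expectation hS mD hX qP Dx (@l0 n))// ?lt//.
have mA := measurable_alive hX Se.
have [mh _] := (bounded_mfunCP _ _).1 bh.
have mx : measurable_funC (alive X e) (fun w => xi_ n w * h (position X e w)).
  by apply: measurable_funCM; [exact: measurable_xi_n|exact: measurable_funC_position].
apply: (le_trans (nsq_integralC_le mA (probability_le1 _ mA) mx)).
apply: ge0_le_integral => //.
- by move=> w _; rewrite lee_fin nsq_ge0.
- exact: measurable_nsqE.
- by apply: measurable_nsqE; exact: measurable_funC_position.
- by move=> w we; rewrite lee_fin nsqM ler_piMl ?nsq_ge0 ?nsq_xi_n.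
Qed.

Lemma cvg_Nsq_steps_op h : bounded_inL2 mu D h ->
  Nsq mu D (fun x => steps_op X q (l_ n) h x - EX h x) @[n --> \oo] --> 0%E.
Proof.
move=> [Lh Bh]; have /inL2P[mh fh] := Lh.
have bh : bounded_mfunC D h by apply/bounded_mfunCP.
have [ms sle] := sqexp_le hS mD hX hmu Se mh.
have [M sM] := sqexp_bounded bh.
have mo n := ((bounded_mfunCP _ _).1 (bounded_mfunC_steps_op_n n bh)).1.
have mE := measurable_EX_bounded bh.
have sfin x : sqexp X e h x \is a fin_num.
  by rewrite ge0_fin_numE ?sqexp_ge0// (le_lt_trans (sM x))// ltry.
rewrite (_ : 0%E = \int[mu]_(x in D) cst 0%E x)%E; last by rewrite integral0.
(* The factor 4 is 2 + 2: [nsqD_le] splits the difference, and both terms have squared modulus at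
   most P(|h|^2). *)
apply: (@dominated_cvg _ _ _ mu D mD
  (fun n x => (nsq (steps_op X q (l_ n) h x - EX h x))%:E) _
  (fun x => 4%:E * sqexp X e h x)%E).
- by move=> n; apply: measurable_nsqE; exact: measurable_funCB.
- move=> x Dx; have [cr ci] := cvg_steps_op_EX Dx bh.
  rewrite /= (_ : 0%E = (nsq (EX h x - EX h x))%:E); last by rewrite subrr nsq0.
  apply: cvg_EFin; first exact: nearW.
  apply: cvg_nsq; [under eq_fun do rewrite cReD cReN; rewrite cReD cReN|
    under eq_fun do rewrite cImD cImN; rewrite cImD cImN]; by apply: cvgB => //; exact: cvg_cst.
- by move=> x Dx; rewrite fin_numM.
- apply: integrableZl => //; apply/integrableP; split => //.
  under eq_integral do rewrite gee0_abs ?sqexp_ge0//.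
  exact: le_lt_trans sle fh.
- move=> n x Dx; rewrite gee0_abs ?lee_fin ?nsq_ge0//.
  have h1 := nsq_steps_op_le n Dx bh; have h2 := nsq_EX_le x mh.
  rewrite -(fineK (sfin x)) in h1 h2 *; rewrite -EFinM lee_fin; rewrite lee_fin in h1;
    rewrite lee_fin in h2.
  by have := nsqD_le (steps_op X q (l_ n) h x) (- EX h x); rewrite nsqN; lra.
Qed.

(* Elsewhere the integral defining EX f x may be a junk value. *)
Let BX f x : R[i] := if x \in [set x | (sqexp X e f x < +oo)%E] `&` D then EX f x else 0.

Lemma BX_set_measurable f : measurable_funC D f ->
  measurable ([set x | (sqexp X e f x < +oo)%E] `&` D).
Proof.
move=> mf; have [ms _] := sqexp_le hS mD hX hmu Se mf.
rewrite setIC; have := emeasurable_fun_infty_o mD ms +oo%E.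
exact.
Qed.

(** The limit of step operators is established for bounded functions only, so [f] is truncated:
    where P(|f|^2) is finite, |EX(f_n) - EX(f)|^2 is at most P(|f_n - f|^2), which tends to 0 by
    dominated convergence under the start law. *)
Lemma measurable_BX f : measurable_funC D f -> measurable_funC D (BX f).
Proof.
move=> mf; have mA := BX_set_measurable mf.
have [f_ [bf_ lef_ ef_]] := truncation mD mf.
have mf_ n := ((bounded_mfunCP _ _).1 (bf_ n)).1.
have mE n := measurable_EX_bounded (bf_ n).
pose g n x : R[i] := if x \in [set x | (sqexp X e f x < +oo)%E] `&` D then EX (f_ n) x else 0.
have mg n : measurable_funC D (g n).
  by apply: measurable_funC_if => //; exact: measurable_funC_cst.
have mAe := measurable_alive hX Se.
have cg x : D x -> complex.Re (g n x) @[n --> \oo] --> complex.Re (BX f x) /\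
    complex.Im (g n x) @[n --> \oo] --> complex.Im (BX f x).
  move=> Dx; rewrite /g /BX; case: ifPn => [|_]; last by split; exact: cvg_cst.
  rewrite inE => -[/= sf _]; apply: (@cvg_nsq0 R (fun n => EX (f_ n) x) (EX f x)).
  have le0 n : (sqexp X e (fun y => f_ n y - f y)%R x <= sqexp X e f x)%E.
    apply: ge0_le_integral => //.
    - by move=> w _; rewrite lee_fin nsq_ge0.
    - apply: measurable_nsqE; apply: (measurable_funC_position (f := fun y => f_ n y - f y)).
      exact: measurable_funCB.
    - by apply: measurable_nsqE; exact: measurable_funC_position.
    - by move=> w we; rewrite lee_fin -nsqN opprB.
  have sf_ n : (sqexp X e (f_ n) x < +oo)%E.
    have [M sM] := sqexp_bounded (bf_ n).
    by rewrite (le_lt_trans (sM x))// ltry.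
  apply: (@squeeze_cvge _ _ _ _ (cst 0%E) _ (fun n => sqexp X e (fun y => f_ n y - f y) x)).
  - apply: nearW => n /=; rewrite lee_fin nsq_ge0/= -EXB//.
    by apply: nsq_EX_le; exact: measurable_funCB.
  - exact: cvg_cst.
  - rewrite (_ : 0%E = \int[start_law X x]_(w in alive X e) cst 0%E w)%E; last by rewrite integral0.
    have mfp := measurable_funC_position mf.
    have H := @dominated_convergence _ _ _ (start_law X x) (alive X e) mAe
      (fun n w => (nsq (f_ n (position X e w) - f (position X e w)))%:E) (cst 0%E)
      (fun w => (nsq (f (position X e w)))%:E).
    have [] := H _ _ _ _ _ => {H}//.
    + move=> n; apply: measurable_nsqE.
      by apply: (measurable_funC_position (f := fun y => f_ n y - f y)); exact: measurable_funCB.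
    + apply: aeW => w we; apply: cvg_near_cst.
      have := ef_ _ (alive_state hX Se we); apply: filterS => n ->.
      by rewrite subrr nsq0.
    + apply/integrableP; split; first exact: measurable_nsqE.
      by under eq_integral do rewrite gee0_abs ?lee_fin ?nsq_ge0//.
    + by apply: aeW => w n we; rewrite gee0_abs ?lee_fin ?nsq_ge0// -nsqN opprB.
split.
- by apply: (measurable_fun_cvgR (fun n => (mg n).1)) => x Dx; exact: (cg x Dx).1.
- by apply: (measurable_fun_cvgR (fun n => (mg n).2)) => x Dx; exact: (cg x Dx).2.
Qed.

(** By excessiveness the majorant has a finite integral, so the points of [D] where [BX] takes its
    default value 0 are negligible. *)
Lemma sqexp_ae_fin f : inL2 mu D f -> {ae mu, forall x, D x -> (sqexp X e f x < +oo)%E}.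
Proof.
move=> /inL2P[mf fi]; have [ms sle] := sqexp_le hS mD hX hmu Se mf.
have : mu.-integrable D (sqexp X e f).
  apply/integrableP; split => //.
  under eq_integral do rewrite gee0_abs ?sqexp_ge0//.
  exact: le_lt_trans sle fi.
move/(integrable_ae mD); apply: filterS => x H Dx.
by rewrite -ge0_fin_numE ?sqexp_ge0// H.
Qed.

Lemma EX_continuous_extension : continuous_extensionL2 mu D EX BX.
Proof.
split.
- move=> f Lf; have /inL2P[mf fi] := Lf; apply/inL2P; split; first exact: measurable_BX.
  have [ms sle] := sqexp_le hS mD hX hmu Se mf.
  apply: le_lt_trans (le_lt_trans sle fi); apply: ge0_le_integral => //.
  + by move=> x _; rewrite lee_fin nsq_ge0.
  + by apply: measurable_nsqE; exact: measurable_BX.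
  + move=> x Dx; rewrite /BX; case: ifPn => _; last by rewrite nsq0 sqexp_ge0.
    exact: nsq_EX_le.
(* The extension is a contraction: outside a null set [BX h - BX f] is [EX (h - f)], whose squared
   norm is at most that of [h - f]. Hence the radius equals the tolerance. *)
- move=> f Lf r r0; exists r => // h Lh.
  rewrite !L2norm_lt//; apply: le_lt_trans.
  have /inL2P[mf fi] := Lf; have /inL2P[mh hi] := Lh.
  have mhf := measurable_funCB mh mf.
  have [ms sle] := sqexp_le hS mD hX hmu Se mhf.
  apply: le_trans sle; apply: ae_ge0_le_integral => //.
  + by move=> x _; rewrite lee_fin nsq_ge0.
  + by apply/measurable_nsqE/measurable_funCB; exact: measurable_BX.
  + by move=> x _; exact: sqexp_ge0.
  + apply: filterS2 (sqexp_ae_fin Lf) (sqexp_ae_fin Lh) => x ff fh Dx.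
    rewrite /BX !ifT ?inE; [|by split => //=; exact: ff|by split => //=; exact: fh].
    rewrite -EXB ?ff ?fh//; exact: nsq_EX_le.
- move=> h [Lh Bh]; have /inL2P[mh fh] := Lh.
  have bh : bounded_mfunC D h by apply/bounded_mfunCP.
  have [M sM] := sqexp_bounded bh.
  by apply: aeW => x Dx; rewrite /BX ifT// inE; split => //=; rewrite (le_lt_trans (sM x))// ltry.
Qed.

Lemma EX_has_extension : exists B, continuous_extensionL2 mu D EX B.
Proof. by exists BX; exact: EX_continuous_extension. Qed.

(** [B] is an arbitrary extension, tied to [EX] on bounded functions only. A bounded [h] close to
    [f] links the two: [B h] is reached by step operators, and [B f] is near [B h] by continuity. *)
Lemma extension_approx B f (eta : R) : continuous_extensionL2 mu D EX B ->
  inL2 mu D f -> 0 < eta ->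
  exists h, [/\ bounded_inL2 mu D h, (Nsq mu D (fun x => f x - h x)%R < eta%:E)%E,
    (Nsq mu D (fun x => B h x - B f x)%R < eta%:E)%E &
    \forall n \near \oo,
      (Nsq mu D (fun x => steps_op X q (l_ n) h x - B h x)%R < eta%:E)%E].
Proof.
move=> EB Lf eta0; have [rho rho0 H] := extension_Nsq EB Lf eta0.
(* [rho] is the radius given by continuity of [B] at [f]; the minimum secures closeness of [B h] to
   [B f] and of [h] to [f] at once. *)
have m0 : 0 < Num.min rho eta by rewrite lt_min rho0.
have [h Bh fh] := bounded_inL2_dense mD Lf m0.
exists h; split => //.
- by apply: (lt_le_trans fh); rewrite lee_fin ge_min lexx orbT.
- apply: H; first exact: Bh.1.
  by rewrite Nsq_subC (lt_le_trans fh)// lee_fin ge_min lexx.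
have := cvge0_near_lt (cvg_Nsq_steps_op Bh) eta0; apply: filterS => n.
have bh : bounded_mfunC D h by apply/bounded_mfunCP; split; [case/inL2P: Bh.1|exact: Bh.2].
have mo := ((bounded_mfunCP _ _).1 (bounded_mfunC_steps_op_n n bh)).1.
have mE := measurable_EX_bounded bh.
have /inL2P[mB _] := extension_dom EB Bh.1.
congr (_ < _)%E; apply: (ae_eq_Nsq mD); try exact: measurable_funCB.
by have := extensionE EB Bh; apply: filterS => x e1 Dx; rewrite e1.
Qed.

End functional.

(** * Left jumps and Stieltjes measures *)

Lemma subsingleton_countable {T : Type} (A : set T) :
  (forall x y, A x -> A y -> x = y) -> countable A.
Proof.
move=> AA; have [->//|[x Ax]] : A = set0 \/ A !=set0.
  by have [->|/set0P] := eqVneq A set0; [left|right].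
rewrite (_ : A = [set x])//; apply/seteqP; split => y /=; first by move=> /AA; exact.
by move=> ->.
Qed.

(** For [0 < c] this is the usual left limit; the guard [0 <= v] fits paths, which are observed at
    nonnegative times. *)
Definition left_limit_is {R : realType} (k : R -> R) (c l : R) :=
  forall eps, 0 < eps -> exists2 del, 0 < del &
    forall v, c - del < v -> v < c -> 0 <= v -> `|k v - l| < eps.

Definition left_jumps {R : realType} (k : R -> R) : set R :=
  [set c | 0 < c /\ exists2 l, left_limit_is k c l & l != k c].

(* A jump c is determined by a rational level a separating k c from the left
   limit, the side, and a rational b < c with k on the side of the limit on
   ]b, c[. *)
Lemma countable_left_jumps {R : realType} (k : R -> R) : countable (left_jumps k).
Proof.
pose sg (s : bool) (x : R) := if s then x else - x.
pose F (i : rat * rat * bool) : set R := [set c | 0 <= ratr i.1.2 :> R /\ ratr i.1.2 < c /\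
   sg i.2 (ratr i.1.1) < sg i.2 (k c) /\
   forall v, ratr i.1.2 < v -> v < c -> sg i.2 (k v) < sg i.2 (ratr i.1.1)].
have cF i : countable (F i).
  apply: subsingleton_countable.
  suff H c c' : F i c -> F i c' -> ~ c < c'.
    move=> c c' Fc Fc'; apply/eqP; rewrite eq_le !leNgt; apply/andP.
    by split; apply/negP; exact: H.
  move=> [_ [bc [ac _]]] [_ [_ [_ Hc']]] cc'.
  by have := lt_trans ac (Hc' c bc cc'); rewrite ltxx.
apply: (@sub_countable _ _ _ (\bigcup_i F i)); last first.
  by apply: bigcup_countable => //.
apply: subset_card_le => c [c0 [l kl lk]].
have [s slt] : exists s, sg s l < sg s (k c).
  have [h|h|h] := ltgtP l (k c).
  - by exists true.
  - by exists false; rewrite /sg ltrN2.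
  - by rewrite h eqxx in lk.
have [a1 a2] : exists a : rat, sg s l < sg s (ratr a) < sg s (k c).
  case: s slt => /= slt.
    by have [a] := rat_in_itvoo slt; rewrite in_itv/= => H; exists a.
  rewrite ltrN2 in slt; have [a] := rat_in_itvoo slt.
  by rewrite in_itv/= => /andP[h1 h2]; exists a; rewrite !ltrN2 h1 h2.
case/andP: a2 => a2 a3.
have e0 : 0 < sg s (ratr a1) - sg s l by rewrite subr_gt0.
have [del d0 Hd] := kl _ e0.
have mx : Num.max 0 (c - del) < c by rewrite gt_max c0 ltrBlDr ltrDl.
have [b] := rat_in_itvoo mx; rewrite in_itv/= gt_max => /andP[/andP[b0 cb] bc].
exists (a1, b, s) => //; split => /=; first exact: ltW.
split=> //; split=> // v bv vc.
have := Hd v (lt_trans cb bv) vc (ltW (lt_trans b0 bv)).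
case: (s) => /=; rewrite ltr_norml; lra.
Qed.

(** * Left limits and Stieltjes masses of intervals and points *)

Section stieltjes_facts.
Context {R : realType} (c : cumulative R R).
Let mu : {measure set (measurableTypeR R) -> \bar R} := lebesgue_stieltjes_measure c.

Lemma cumulative_le (x y : R) : x <= y -> c x <= c y.
Proof. exact: cumulative_is_nondecreasing. Qed.

Lemma left_limit_cvg (b : R) : c v @[v --> b^'-] --> left_limit c b.
Proof.
have : cvg (c v @[v --> b^'-]); last by [].
apply: nondecreasing_at_left_is_cvgr.
- by near=> x; move=> y z _ _; exact: cumulative_le.
- near=> x; exists (c b) => _ /= [v + <-]; rewrite in_itv/= => /andP[_ vb].
  exact/cumulative_le/ltW.
Unshelve. all: by end_near. Qed.

Lemma left_limit_ge (a b : R) : a < b -> c a <= left_limit c b.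
Proof.
move=> ab; apply: limr_ge; first exact: cvgP (@left_limit_cvg b).
near=> v; apply: cumulative_le; near: v; exact: nbhs_left_ge.
Unshelve. all: by end_near. Qed.

Lemma left_limit_le (b : R) : left_limit c b <= c b.
Proof.
apply: limr_le; first exact: cvgP (@left_limit_cvg b).
near=> v; apply: cumulative_le; near: v; exact: nbhs_left_le.
Unshelve. all: by end_near. Qed.

Lemma left_limit_near (b eps : R) : 0 < eps ->
  exists2 del, 0 < del & forall v, b - del < v -> left_limit c b - eps < c v.
Proof.
move=> e0; have /cvgrPdist_lt/(_ eps e0) := @left_limit_cvg b.
move=> [del /= d0 Hd]; exists del => // v bv.
have [vb|bv'] := ltP v b.
  have : `|left_limit c b - c v| < eps.
    by apply: Hd => //=; rewrite gtr0_norm ?subr_gt0//; lra.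
  by rewrite ltr_norml => /andP[_]; lra.
by have := left_limit_le b; have := cumulative_le bv'; lra.
Qed.

Lemma right_limit_near (b eps : R) : 0 < eps ->
  exists2 del, 0 < del & forall v, v < b + del -> c v < c b + eps.
Proof.
move=> e0; have e2 : 0 < eps / 2 by rewrite divr_gt0.
have [del Hd] := @nondecreasing_right_continuousP R b _ c e2.
exists del%:num => // v vb.
have := cumulative_le (ltW vb); have : eps / 2 < eps by rewrite ltr_pdivrMr// ltr_pMr// ltr1n.
by move: Hd; lra.
Qed.

Lemma stieltjes_oc (a b : R) : a <= b -> mu `]a, b]%classic = (c b - c a)%:E.
Proof.
move=> ab; rewrite /mu /= /lebesgue_stieltjes_measure /measure_extension /=.
rewrite measurable_mu_extE.
  by apply: wlength_itv_bnd.
exact: is_ocitv.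
Qed.

Lemma stieltjes_oo (a b : R) : a < b -> mu `]a, b[%classic = (left_limit c b - c a)%:E.
Proof.
move=> ab.
(* These points start at [a] and increase to [b] without reaching it, so the intervals []a, b_ n]]
   exhaust []a, b[]; continuity from below then produces the left limit of [c]. *)
pose b_ n := b - (b - a) / n.+1%:R.
have ba0 : 0 < b - a by rewrite subr_gt0.
have abn n : a <= b_ n.
  by rewrite /b_ lerBrDr -lerBrDl ler_pdivrMr// ler_peMr ?ler1n ?ltW//.
have bnb n : b_ n < b by rewrite /b_ ltrBlDr ltrDl divr_gt0.
have nd : nondecreasing_seq (fun n => `]a, b_ n]%classic).
  move=> n m nm; apply/subsetPset => x /=; rewrite !in_itv/= => /andP[-> xb] /=.
  apply: (le_trans xb); rewrite /b_ lerB// ler_pM2l// lef_pV2 ?posrE//.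
  by rewrite ler_nat.
have U : \bigcup_n `]a, b_ n]%classic = `]a, b[%classic.
  apply/seteqP; split => x /=.
    by move=> [n _ /=]; rewrite !in_itv/= => /andP[-> /= /le_lt_trans]; exact.
  rewrite in_itv/= => /andP[ax xb].
  have xb0 : 0 < (b - x) / (b - a) by rewrite divr_gt0// subr_gt0.
  exists (Num.truncn ((b - x) / (b - a))^-1) => //=; rewrite in_itv/= ax /=.
  rewrite /b_ lerBrDr -lerBrDl ler_pdivrMr//.
  have := truncnS_gt ((b - x) / (b - a))^-1; set m := _.+1%:R => Hm.
  have m0 : 0 < m by rewrite ltr0n.
  rewrite invf_div ltr_pdivrMr ?subr_gt0// in Hm.
  by rewrite mulrC ltW.
have c1 : mu `]a, b_ n]%classic @[n --> \oo] --> mu `]a, b[%classic.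
  rewrite -U; apply: nondecreasing_cvg_mu => //.
  by rewrite U; exact: (measurable_itv `]a, b[).
have c2 : mu `]a, b_ n]%classic @[n --> \oo] --> (left_limit c b - c a)%:E.
  rewrite (_ : (fun n => mu _) = fun n => (c (b_ n) - c a)%:E); last first.
    by apply/funext => n; rewrite stieltjes_oc.
  apply: cvg_EFin; first exact: nearW.
  apply: cvgB; last exact: cvg_cst.
  apply/cvgrPdist_lt => eps e0.
  have [del d0 Hd] := left_limit_near b e0.
  near=> n; rewrite ltr_norml.
  have lo : left_limit c b - eps < c (b_ n).
    apply: Hd; rewrite /b_ ltrD2l ltrN2; near: n.
    exists (Num.truncn ((b - a) / del)) => // n /= nn.
    rewrite ltr_pdivrMr// mulrC -ltr_pdivrMr// (lt_le_trans (truncnS_gt _))// ler_nat ltnS//.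
  have := left_limit_ge (bnb n); lra.
exact: (cvg_unique _ c1 c2).
Unshelve. all: by end_near. Qed.

Lemma stieltjes_set1 (b : R) : mu [set b] = (c b - left_limit c b)%:E.
Proof.
have b1 : b - 1 < b by rewrite ltrBlDr ltrDl.
have m1 : @measurable _ (measurableTypeR R) `](b - 1),
  b[%classic by exact: (measurable_itv `](b - 1), b[).
have m2 : @measurable _ (measurableTypeR R) [set b] by exact: measurable_set1.
have e : (mu `](b - 1)%R, b[%classic + mu [set b])%E = (c b - c (b - 1))%:E.
  rewrite -(stieltjes_oc (ltW b1)).
  rewrite (_ : `]b - 1, b]%classic = `](b - 1), b[%classic `|` [set b]); last first.
    apply/seteqP; split => x /=; rewrite !in_itv/=.
      by move=> /andP[-> /=]; rewrite le_eqVlt => /predU1P[->|->]; [right|left].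
    by case=> [/andP[-> /ltW ->]|->]//; rewrite b1 lexx.
  apply/esym; apply: measureU => //.
  by apply/seteqP; split => x //= -[/=]; rewrite in_itv/= => + xb; rewrite xb ltxx andbF.
move: e; rewrite (stieltjes_oo b1).
have : (0 <= mu [set b])%E by exact: measure_ge0.
case: (mu [set b]) => [x| |]//= x0;
  rewrite -EFinD => -[] /(congr1 (fun z => z - (left_limit c b - c (b - 1)))).
by rewrite addrC addKr => ->; congr EFin; ring.
Qed.

End stieltjes_facts.

(** * Step functions along a partition *)

Section step_functions.
Context {R : realType}.
Implicit Types (F : R -> R -> R) (H k : R -> R) (a r : R) (rs : seq R).

(** [F] receives both end points of an interval, so that one definition serves X, read at the left
    end, and Y, read at the right end. Partition points get a value [H] of their own because the
    measure may have atoms there. The default 0 is only taken beyond the last point. *)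
Fixpoint stepf F H a rs r : R :=
  if rs is b :: rs' then
    if r < b then F a b else if r == b then H b else stepf F H b rs' r
  else 0.

Fixpoint stepsum (c : R -> R) F H a rs : R :=
  if rs is b :: rs' then
    (left_limit c b - c a) * F a b + (c b - left_limit c b) * H b +
    stepsum c F H b rs'
  else 0.

Lemma measurable_stepf F H a rs : measurable_fun setT (stepf F H a rs).
Proof.
elim: rs a => [a|b rs IH a] /=; first exact: measurable_cst.
apply: measurable_fun_ifT; [|exact: measurable_cst|].
  by apply: measurable_fun_ltr => //; exact: measurable_cst.
apply: measurable_fun_ifT; [|exact: measurable_cst|exact: IH].
by apply: measurable_fun_eqr => //; exact: measurable_cst.
Qed.

Lemma stepf_bounded F H M a rs r : (forall x y, `|F x y| <= M) ->
  (forall x, `|H x| <= M) -> `|stepf F H a rs r| <= M.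
Proof.
move=> FM HM; elim: rs a => [a|b rs IH a] /=.
  by rewrite normr0 (le_trans _ (HM 0)).
by case: ifP => // _; case: ifP.
Qed.

Lemma path_le_last a rs x : path <%R a rs -> x \in a :: rs -> x <= last a rs.
Proof.
elim: rs a x => [a x _|b rs IH a x /= /andP[ab p]].
  by rewrite inE => /eqP ->.
rewrite inE => /orP[/eqP ->|xb]; last exact: IH.
by rewrite (le_trans (ltW ab))// IH// mem_head.
Qed.

Lemma path_ge_head a rs x : path <%R a rs -> x \in a :: rs -> a <= x.
Proof.
elim: rs a => [a _|b rs IH a /= /andP[ab p]]; first by rewrite inE => /eqP ->.
rewrite inE => /orP[/eqP -> //|xb].
by rewrite (le_trans (ltW ab))// IH.
Qed.

Lemma Rintegral_stepf (c : cumulative R R) F H M a rs :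
  (forall x y, `|F x y| <= M) -> (forall x, `|H x| <= M) -> path <%R a rs ->
  \int[lebesgue_stieltjes_measure c]_(r in `]a, last a rs]) stepf F H a rs r =
  stepsum c F H a rs.
Proof.
move=> FM HM; elim: rs a => [a _|b rs IH a /= /andP[ab p]].
  by rewrite /= set_itvoc0 Rintegral_set0.
pose mu : {measure set (measurableTypeR R) -> \bar R} := lebesgue_stieltjes_measure c.
rewrite -/mu.
have bl : b <= last b rs by apply: path_le_last; rewrite ?mem_head.
have m1 : @measurable _ (measurableTypeR R) `]a, b[%classic by exact: (measurable_itv `]a, b[).
have m2 : @measurable _ (measurableTypeR R) [set b] by exact: measurable_set1.
have m3 : @measurable _ (measurableTypeR R) `]b, last b rs]%classic by exact:
  (measurable_itv `]b, last b rs]).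
have m23 := measurableU _ _ m2 m3.
have mA : @measurable _ (measurableTypeR R) `]a, last b rs]%classic by exact:
  (measurable_itv `]a, last b rs]).
have fA : (mu `]a, last b rs]%classic < +oo)%E.
  by rewrite (stieltjes_oc c (le_trans (ltW ab) bl)) ltry.
pose f r : R := if r < b then F a b else if r == b then H b else stepf F H b rs r.
rewrite -[LHS]/(\int[mu]_(r in `]a, last b rs]) f r).
have bf : @bounded_mfun _ (measurableTypeR R) R `]a, last b rs]%classic f.
  split; last by exists M => r _; exact: (stepf_bounded a (b :: rs) r FM HM).
  by apply: measurable_funTS; exact: (measurable_stepf F H a (b :: rs)).
have intf := bounded_mfun_integrable mA fA bf.
have U : `]a, last b rs]%classic = `]a, b[%classic `|` ([set b] `|` `]b, last b rs]%classic).
  apply/seteqP; split => x /=; rewrite !in_itv/=.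
    move=> /andP[ax xl]; have [xb|bx|->] := ltgtP x b; rewrite ?ax ?xl; [left|right;
      right|right; left] => //.
  case=> [/andP[-> xb]/=|[->|/andP[bx ->]]]; first exact: (le_trans (ltW xb)).
    by rewrite ab.
  by rewrite (lt_trans ab).
have d1 : [disjoint `]a, b[%classic & [set b] `|` `]b, last b rs]%classic].
  apply/disj_setPS => x [/=]; rewrite !in_itv/= => /andP[_ xb] [xe|/andP[bx _]].
    by rewrite xe ltxx in xb.
  by have := lt_trans xb bx; rewrite ltxx.
have d2 : [disjoint [set b] & `]b, last b rs]%classic].
  by apply/disj_setPS => x [/= ->]; rewrite in_itv/= ltxx.
rewrite U in intf *.
rewrite Rintegral_setU// Rintegral_setU//; last first.
  apply: (integrableS _ m23 _ intf); first exact: (measurableU _ _ m1 m23).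
  exact: subsetUr.
rewrite -addrA; congr (_ + _).
  rewrite (@eq_Rintegral _ _ _ _ _ (fun=> F a b)); last first.
    by move=> x /set_mem /=; rewrite in_itv/= /f => /andP[_ ->].
  by rewrite Rintegral_cst// (stieltjes_oo c ab)/= mulrC.
congr (_ + _).
  rewrite (@eq_Rintegral _ _ _ _ _ (fun=> H b)); last first.
    by move=> x /set_mem /= ->; rewrite /f ltxx eqxx.
  by rewrite Rintegral_cst// (stieltjes_set1 c b)/= mulrC.
rewrite -(IH b p); apply: eq_Rintegral => x /set_mem /=; rewrite in_itv/= /f => /andP[bx _].
by rewrite ltNge (ltW bx)/= gt_eqF.
Qed.

(** What matters for convergence is that no partition point lies strictly between [p] and [b]: a
    point of the dense set close to [r] pushes [p] or [b] towards [r] once it has entered the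
    partition. *)
Lemma stepf_char F H a rs r : path <%R a rs -> a < r -> r <= last a rs ->
  (r \in rs /\ stepf F H a rs r = H r) \/
  (exists p b, [/\ p \in a :: rs, p < r, r < b, b \in rs &
     (forall z, z \in rs -> z <= p \/ b <= z) /\ stepf F H a rs r = F p b]).
Proof.
elim: rs a => [a _ /= ar ra|b rs IH a /= /andP[ab pa] ar rl].
  by have := lt_le_trans ar ra; rewrite ltxx.
have [rb|br|->] := ltgtP r b.
- right; exists a, b; split; rewrite ?mem_head//.
  by split => // z zb; right; exact: (path_ge_head pa zb).
- have [[rrs ->]|[p [b' [pb pr rb' b'rs [Hz ->]]]]] := IH b pa br rl.
    by left; rewrite inE rrs orbT.
  right; exists p, b'; split => //.
  + by rewrite inE pb orbT.
  + by rewrite inE b'rs orbT.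
  + split => // z; rewrite inE => /orP[/eqP ->|/Hz//].
    by left; exact: (path_ge_head pa pb).
- by left; rewrite mem_head.
Qed.

Fixpoint rsum k (u : R) (l : seq (R * R)) : R :=
  if l is (a, b) :: l' then a * k u + rsum k (u + b) l' else 0.

Lemma eq_rsum k k' u l : nneg_steps l ->
  (forall v, u <= v -> v <= u + steps_time l -> k v = k' v) ->
  rsum k u l = rsum k' u l.
Proof.
elim: l u => [//|[a b] l IH] u l0 kk' /=.
have [/= a0 b0 l1] := nneg_steps_cons l0; have t0 := steps_time_ge0 l1.
move: kk'; rewrite steps_time_cons => kk'.
rewrite kk' ?lerDl ?addr_ge0//; congr (_ + _); apply: IH => // v uv vu.
by apply: kk'; [rewrite (le_trans _ uv)// lerDl|rewrite addrA].
Qed.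

Lemma Re_steps_sum (p : R -> R[i]) u l :
  complex.Re (steps_sum p u l) = rsum (fun v => complex.Re (p v)) u l.
Proof.
by elim: l u => [//|[a b] l IH] u /=; rewrite cReD cReM /= mul0r subr0 IH.
Qed.

Lemma Im_steps_sum (p : R -> R[i]) u l :
  complex.Im (steps_sum p u l) = rsum (fun v => complex.Im (p v)) u l.
Proof.
by elim: l u => [//|[a b] l IH] u /=; rewrite cImD cImM /= mul0r addr0 IH.
Qed.

(* Each partition point contributes the part of the curve up to its left limits
   and then its jump. *)
Fixpoint jump_steps (t s : R -> R) a rs : seq (R * R) :=
  if rs is b :: rs' then
    (left_limit t b - t a, left_limit s b - s a) ::
    (t b - left_limit t b, s b - left_limit s b) :: jump_steps t s b rs'
  else [::].

Lemma nneg_jump_steps (t s : cumulative R R) a rs : path <%R a rs ->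
  nneg_steps (jump_steps t s a rs).
Proof.
elim: rs a => [a _ p|b rs IH a /= /andP[ab pa] p]; first by rewrite in_nil.
rewrite !inE => /or3P[/eqP -> |/eqP ->|]/=; last exact: IH.
  by rewrite !subr_ge0 !left_limit_ge.
by rewrite !subr_ge0 !left_limit_le.
Qed.

Lemma steps_time_jump (t s : R -> R) a rs :
  steps_time (jump_steps t s a rs) = s (last a rs) - s a.
Proof.
elim: rs a => [a|b rs IH a] /=; first by rewrite /steps_time big_nil subrr.
by rewrite !steps_time_cons IH; ring.
Qed.

Lemma steps_time_shift (t s : R -> R) x a rs :
  steps_time (shift_steps x (jump_steps t s a rs)) = t (last a rs) - t a.
Proof.
elim: rs a x => [a x|b rs IH a x] /=.
  by rewrite /steps_time big_cons big_nil addr0 subrr.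
by rewrite !steps_time_cons IH; ring.
Qed.

(** Each [b] gives two readings: at the left end [s a] for the mass of [t] strictly before [b], and
    at [left_limit s b] for the atom at [b]. The latter is the source of the left limit in the
    functional of X. *)
Lemma rsum_jump (t s : R -> R) k a rs :
  rsum k (s a) (jump_steps t s a rs) =
  stepsum t (fun x _ => k (s x)) (fun y => k (left_limit s y)) a rs.
Proof.
elim: rs a => [//|b rs IH a] /=.
have -> : s a + (left_limit s b - s a) = left_limit s b by ring.
have -> : left_limit s b + (s b - left_limit s b) = s b by ring.
by rewrite IH; ring.
Qed.

(** After the shift, [t] has already moved when the path is read: up to [left_limit t b] for the
    mass of [s] before [b], and through its jump, to [t b], for the atom at [b]. Hence the
    functional of Y has no left limit. *)
Lemma rsum_shift (t s : R -> R) k x a rs :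
  rsum k (t a) (shift_steps x (jump_steps t s a rs)) = x * k (t a) +
  stepsum s (fun _ y => k (left_limit t y)) (fun y => k (t y)) a rs.
Proof.
elim: rs a x => [a x //|b rs IH a x] /=.
rewrite [t a + _]addrC subrK [left_limit t b + _]addrC subrK IH.
by rewrite -!addrA.
Qed.

End step_functions.

Lemma countable_enumeration {T : pointedType} (A : set T) : countable A ->
  exists e : nat -> T, A `<=` range e.
Proof.
move=> /countable_injP[f finj].
exists (fun n => get [set x | A x /\ f x = n]) => x Ax; exists (f x) => //.
have [Ay fy] : [set y | A y /\ f y = f x] (get [set y | A y /\ f y = f x]).
  by apply: getPex; exists x.
by apply: finj; rewrite ?inE.
Qed.

Section partitions.
Context {R : realType} (e : nat -> R).

(** The enumeration may repeat itself and leave the unit interval, hence [undup], which makes the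
    order strict, and the filter. The point 1 is always included, so that the steps end at the final
    times; 0 is supplied as the head of the path. *)
Definition partition_pts n : seq R :=
  sort <=%R (undup (1 :: [seq x <- [seq e i | i <- iota 0 n] | 0 < x < 1])).

Lemma partition_ptsP n x : x \in partition_pts n ->
  x = 1 \/ 0 < x < 1 /\ exists i, x = e i.
Proof.
rewrite mem_sort mem_undup inE => /orP[/eqP|]; first by left.
rewrite mem_filter => /andP[x01 /mapP[i _ xi]].
by right; split=> //; exists i.
Qed.

Lemma mem_partition_pts n i : (i < n)%N -> 0 < e i < 1 -> e i \in partition_pts n.
Proof.
move=> inn ei; rewrite mem_sort mem_undup inE mem_filter ei /=.
by rewrite map_f ?orbT// mem_iota.
Qed.

Lemma one_partition_pts n : 1 \in partition_pts n.
Proof. by rewrite mem_sort mem_undup mem_head. Qed.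

Lemma partition_pts01 n x : x \in partition_pts n -> 0 < x <= 1.
Proof. by move=> /partition_ptsP[->|[/andP[-> /ltW ->]]]; rewrite ?ltr01 ?lexx. Qed.

Lemma path_partition_pts n : path <%R 0 (partition_pts n).
Proof.
rewrite (path_sortedE lt_trans); apply/andP; split.
  by apply/allP => x /partition_pts01/andP[].
rewrite lt_sorted_uniq_le sort_uniq undup_uniq/=.
by apply: sort_sorted; exact: le_total.
Qed.

Lemma last_partition_pts n : last 0 (partition_pts n) = 1.
Proof.
have p := path_partition_pts n.
apply/eqP; rewrite eq_le; apply/andP; split; last first.
  by apply: path_le_last => //; rewrite inE one_partition_pts orbT.
have := mem_last 0 (partition_pts n); rewrite inE => /orP[/eqP ->//|].
by move=> /partition_pts01/andP[].
Qed.

End partitions.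

(** * Convergence along refining partitions *)

Definition cadlag_on {R : realType} (T : R) (k : R -> R) :=
  forall u, 0 <= u -> u <= T ->
    (forall eps, 0 < eps -> exists2 del, 0 < del &
      forall v, u <= v -> v < u + del -> v <= T -> `|k v - k u| < eps) /\
    (0 < u -> exists l, left_limit_is k u l).

Section partition_limits.
Context {R : realType} (e : nat -> R).
Hypothesis e_dense : forall x y : R, 0 <= x -> x < y -> y <= 1 ->
  exists2 i, x < e i & e i < y.
Context (s t : cumulative R R) (k : R -> R) (T M : R).
Hypotheses (s0 : s 0 = 0) (kM : forall x, `|k x| <= M).
Let P n := partition_pts e n.

Lemma stepf_eventually F H r : 0 < r -> r <= 1 -> (r = 1 \/ exists i, r = e i) ->
  \forall n \near \oo, stepf F H 0 (P n) r = H r.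
Proof.
move=> r0 r1 re.
have [N HN] : exists N, forall n, (N <= n)%N -> r \in P n.
  have [->|r1'] := eqVneq r 1; first by exists 0 => n _; exact: one_partition_pts.
  case: re => [re|[i ri]]; first by rewrite re eqxx in r1'.
  exists i.+1 => n ni; rewrite ri; apply: mem_partition_pts => //.
  by rewrite -ri r0 lt_neqAle r1' r1.
exists N => // n /= Nn.
have := stepf_char F H (path_partition_pts e n) r0; rewrite last_partition_pts => /(_ r1).
case=> [[_]//|[p [b [_ pr rb _ [Hz _]]]]].
have [rp|br] := Hz r (HN n Nn).
  by have := lt_le_trans pr rp; rewrite ltxx.
by have := lt_le_trans rb br; rewrite ltxx.
Qed.

(** Off the enumerated points and 1 the step function is [k (s p)] for the last partition point [p]
    before [r]. Either [s] is constant just before [r], and [s p] eventually equals its left limit;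
    or [s p] approaches it strictly from below, and [k (s p)] tends to the left limit of [k] there,
    which is its value unless [k] jumps. *)
Lemma cvg_stepf_X r : s 1 = T -> cadlag_on T k -> 0 < r -> r <= 1 ->
  (r = 1 \/ (exists i, r = e i)) \/
  ~ (left_jumps k (left_limit s r) /\ forall q, 0 <= q -> q < r -> s q < left_limit s r) ->
  stepf (fun x _ => k (s x)) (fun y => k (left_limit s y)) 0 (P n) r
    @[n --> \oo] --> k (left_limit s r).
Proof.
move=> s1 kc r0 r1 hr.
have [re|re] := EM (r = 1 \/ exists i, r = e i).
  by apply: cvg_near_cst; exact: stepf_eventually.
have {}hr : ~ (left_jumps k (left_limit s r) /\
    forall q, 0 <= q -> q < r -> s q < left_limit s r) by case: hr.
have rlt : r < 1 by rewrite lt_neqAle r1 andbT; apply/eqP => re1; apply: re; left.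
have char n : exists2 p, [/\ 0 <= p, p < r & forall i, (i < n)%N -> 0 < e i -> e i < r ->
  e i <= p] &
    stepf (fun x _ => k (s x)) (fun y => k (left_limit s y)) 0 (P n) r = k (s p).
  have pp := path_partition_pts e n.
  have := stepf_char (fun x _ => k (s x)) (fun y => k (left_limit s y)) pp r0.
  rewrite last_partition_pts => /(_ r1).
  case=> [[/partition_ptsP[rr|[_ rr]] _]|]; [by exfalso; apply: re; left|by exfalso;
    apply: re; right|].
  move=> [p [b [p0 pr rb _ [Hz ->]]]]; exists p => //; split => //.
    exact: (path_ge_head pp p0).
  move=> i ni ei0 eir.
  have /Hz[//|be] : e i \in P n.
    by apply: mem_partition_pts => //; rewrite ei0 (lt_trans eir).
  by have := lt_le_trans (lt_trans eir rb) be; rewrite ltxx.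
apply/cvgrPdist_lt => eps eps0.
have [[q [q0 qr sq]]|strict] := EM (exists q, [/\ 0 <= q, q < r & s q = left_limit s r]).
  have [i qi ir] := e_dense q0 qr r1.
  exists i.+1 => // n /= ni; have [p [p0 pr Hp] ->] := char n.
  have qp : q <= p by rewrite (le_trans (ltW qi))// Hp// (le_lt_trans q0).
  have -> : s p = left_limit s r.
    by apply/eqP; rewrite eq_le left_limit_ge//= -sq cumulative_le.
  by rewrite subrr normr0.
have {}strict q : 0 <= q -> q < r -> s q < left_limit s r.
  move=> q0 qr; rewrite lt_neqAle left_limit_ge// andbT; apply/eqP => sq.
  by apply: strict; exists q.
have c0 : 0 < left_limit s r by rewrite -s0; exact: strict.
have cT : left_limit s r <= T.
  by rewrite -s1 (le_trans (left_limit_le s r))// cumulative_le.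
have [_ /(_ c0)[l kl]] := kc _ (ltW c0) cT.
have lk : l = k (left_limit s r).
  apply/eqP/negPn/negP => lk; apply: hr; split => //; split => //.
  by exists l.
have [del d0 Hd] := kl _ eps0.
have [del' d0' Hd'] := left_limit_near s r d0.
have mx : Num.max 0 (r - del') < r by rewrite gt_max r0 ltrBlDr ltrDl.
have mx0 : 0 <= Num.max 0 (r - del') by rewrite le_max lexx.
have [i mi ir] := e_dense mx0 mx r1.
move: mi; rewrite gt_max => /andP[ei0 eid].
exists i.+1 => // n /= ni; have [p [p0 pr Hp] ->] := char n.
have eip := Hp i ni ei0 ir.
rewrite distrC -lk; apply: Hd.
- by apply: Hd'; exact: lt_le_trans eip.
- exact: strict.
- by rewrite -s0 cumulative_le.
Qed.

(** Here the relevant end point [b] comes down to [r], and [left_limit t b] lies between [t r] and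
    [t b]. Right continuity of [t] and [k] settles every such [r], including those where [k] jumps
    at [t r]. *)
Lemma cvg_stepf_Y r : t 1 = T -> t 0 = 0 -> cadlag_on T k -> 0 < r -> r <= 1 ->
  stepf (fun _ y => k (left_limit t y)) (fun y => k (t y)) 0 (P n) r
    @[n --> \oo] --> k (t r).
Proof.
move=> t1 t0 kc r0 r1.
have [re|re] := EM (r = 1 \/ exists i, r = e i).
  by apply: cvg_near_cst; exact: stepf_eventually.
have rlt : r < 1 by rewrite lt_neqAle r1 andbT; apply/eqP => re1; apply: re; left.
have tr0 : 0 <= t r by rewrite -t0 cumulative_le// ltW.
have trT : t r <= T by rewrite -t1 cumulative_le.
have [kr _] := kc _ tr0 trT.
apply/cvgrPdist_lt => eps eps0.
have [del d0 Hd] := kr _ eps0.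
have [del' d0' Hd'] := right_limit_near t r d0.
have mn : r < Num.min 1 (r + del') by rewrite lt_min rlt ltrDl.
have mn1 : Num.min 1 (r + del') <= 1 by rewrite ge_min lexx.
have [i ri im] := e_dense (ltW r0) mn mn1.
move: im; rewrite lt_min => /andP[ei1 eid].
exists i.+1 => // n /= ni.
have pp := path_partition_pts e n.
have := stepf_char (fun _ y => k (left_limit t y)) (fun y => k (t y)) pp r0.
rewrite last_partition_pts => /(_ r1).
case=> [[/partition_ptsP[rr|[_ rr]] _]|]; [by exfalso; apply: re; left|by exfalso;
  apply: re; right|].
move=> [p [b [_ pr rb bP [Hz ->]]]].
have be : b <= e i.
  have /Hz[|//] : e i \in P n.
    by apply: mem_partition_pts => //; rewrite ei1 (lt_trans r0 ri).
  by move=> eip; have := lt_le_trans (lt_trans pr ri) eip; rewrite ltxx.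
rewrite distrC; apply: Hd; first exact: left_limit_ge.
- apply: le_lt_trans (left_limit_le t b) _; apply: le_lt_trans (Hd' _ eid).
  exact: cumulative_le.
- rewrite -t1 (le_trans (left_limit_le t b))// cumulative_le//.
  by rewrite (le_trans be)// ltW.
Qed.

Let itv01 : set (measurableTypeR R) := `]0, 1]%classic.
Let m01 : @measurable _ (measurableTypeR R) itv01.
Proof. exact: (measurable_itv `]0, 1]). Qed.

Let f01 (c : cumulative R R) : (lebesgue_stieltjes_measure c itv01 < +oo)%E.
Proof. by rewrite (stieltjes_oc c ler01) ltry. Qed.

Lemma cvg_rsum_Y : t 1 = T -> t 0 = 0 -> cadlag_on T k ->
  rsum k 0 (shift_steps 0 (jump_steps t s 0 (P n))) @[n --> \oo] -->
  \int[lebesgue_stieltjes_measure s]_(r in `]0, 1]) k (t r).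
Proof.
move=> t1 t0 kc.
rewrite (_ : (fun n => _) = (fun n =>
    \int[lebesgue_stieltjes_measure s]_(r in itv01)
      stepf (fun _ y => k (left_limit t y)) (fun y => k (t y)) 0 (P n) r)); last first.
  apply/funext => n; rewrite -{1}t0 rsum_shift mul0r add0r.
  have := @Rintegral_stepf _ s (fun _ y => k (left_limit t y)) (fun y => k (t y)) M 0 (P n).
  by rewrite last_partition_pts => <-//; exact: path_partition_pts.
apply: (@bounded_cvg_Rintegral _ (measurableTypeR R) R
  (lebesgue_stieltjes_measure s) _ m01 (f01 s) _ _ M).
- by move=> n; apply: measurable_funTS; exact: measurable_stepf.
- by move=> n r _; exact: stepf_bounded.
- by move=> r; rewrite /itv01 /= in_itv/= => /andP[r0 r1]; exact: cvg_stepf_Y.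
Qed.

Lemma countable_stieltjes0 (c : cumulative R R) (A : set R) : countable A ->
  (forall r, A r -> left_limit c r = c r) -> lebesgue_stieltjes_measure c A = 0%E.
Proof.
move=> cA Ac; have [e' Ae'] := countable_enumeration cA.
pose mu : {measure set (measurableTypeR R) -> \bar R} := lebesgue_stieltjes_measure c.
have m1 (r : R) : @measurable _ (measurableTypeR R) [set r] by exact: measurable_set1.
pose G n : set (measurableTypeR R) := [set e' n] `&` A.
have G0 n : measurable (G n) /\ mu (G n) = 0%E.
  have [Aen|nA] := EM (A (e' n)).
    have -> : G n = [set e' n] by apply: setIidl => x /= ->.
    by split => //; rewrite (stieltjes_set1 c (e' n)) Ac// subrr.
  have -> : G n = set0.
    by apply/seteqP; split => x //= -[/= ->]; exact: nA.
  by split => //; rewrite measure0.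
have AU : A = \bigcup_n G n.
  apply/seteqP; split => x /=; last by move=> [n _ []].
  by move=> Ax; have [n _ en] := Ae' _ Ax; exists n.
have : mu.-negligible (\bigcup_n G n).
  by apply: negligible_bigcup => n; have [? ?] := G0 n; exists (G n); split.
rewrite -AU => /negligibleP -> //.
by rewrite AU; apply: bigcupT_measurable => n; case: (G0 n).
Qed.

Lemma countable_measurableR (A : set R) : countable A -> @measurable _ (measurableTypeR R) A.
Proof. by move=> cA; apply: countable_measurable => // r; exact: measurable_set1. Qed.

Lemma cvg_rsum_X : s 1 = T -> cadlag_on T k ->
  (forall r, 0 < r -> r < 1 -> left_limit t r <> t r -> exists i, r = e i) ->
  rsum k 0 (jump_steps t s 0 (P n)) @[n --> \oo] -->
  \int[lebesgue_stieltjes_measure t]_(r in `]0, 1]) k (left_limit s r).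
Proof.
move=> s1 kc tdisc.
pose mu : {measure set (measurableTypeR R) -> \bar R} := lebesgue_stieltjes_measure t.
pose f n := stepf (fun x _ => k (s x)) (fun y => k (left_limit s y)) 0 (P n).
rewrite (_ : (fun n => _) = (fun n => \int[mu]_(r in itv01) f n r)); last first.
  apply/funext => n; rewrite -{1}s0 rsum_jump.
  have := @Rintegral_stepf _ t (fun x _ => k (s x)) (fun y => k (left_limit s y)) M 0 (P n).
  by rewrite last_partition_pts => <-//; exact: path_partition_pts.
pose N : set R := [set r | [/\ 0 < r, r <= 1, ~ (r = 1 \/ exists i, r = e i) &
   left_jumps k (left_limit s r) /\ forall q, 0 <= q -> q < r -> s q < left_limit s r]].
(* Each jump location [c] is the left limit of [s] at no more than one point of [N]: for [r < r']
   sharing it, strictness at [r'] gives [s r < c], although [s r] is at least its own left limit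
   [c]. *)
have cN : countable N.
  pose G c := [set r | N r /\ left_limit s r = c].
  apply: (@sub_countable _ _ _ (\bigcup_(c in left_jumps k) G c)).
    by apply: subset_card_le => r Nr; exists (left_limit s r) => //; case: Nr => _ _ _ [].
  apply: bigcup_countable; first exact: countable_left_jumps.
  move=> c _; apply: subsingleton_countable.
  suff H r r' : G c r -> G c r' -> ~ r < r'.
    move=> r r' Gr Gr'; apply/eqP; rewrite eq_le !leNgt; apply/andP.
    by split; apply/negP; exact: H.
  move=> [[r0 _ _ _] rc] [[_ _ _ [_ Hr']] r'c] rr'.
  have := Hr' r (ltW r0) rr'; rewrite r'c -rc ltNge; move/negP; apply.
  exact: left_limit_le.
have mN := countable_measurableR cN.
(* The discontinuities of [t] inside the unit interval are enumerated, and [N] avoids the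
   enumeration and 1; so no point of [N] is an atom. *)
have N0 : mu N = 0%E.
  apply: countable_stieltjes0 => // r [r0 r1 re _].
  apply: contrapT => lr; apply: re.
  have [->|rn1] := eqVneq r 1; first by left.
  by right; apply: tdisc => //; rewrite lt_neqAle rn1 r1.
have cf r : itv01 r -> ~ N r -> f n r @[n --> \oo] --> k (left_limit s r).
  rewrite /itv01 /= in_itv/= => /andP[r0 r1] Nr; apply: cvg_stepf_X => //.
  have [re|re] := EM (r = 1 \/ exists i, r = e i); first by left.
  by right => H; apply: Nr; split.
have mf n : @measurable_fun _ _ (measurableTypeR R) R itv01 (f n).
  by apply: measurable_funTS; exact: measurable_stepf.
(* Off [N] the integrand is a limit of step functions; within the countable set [N] every subset is
   measurable. *)
have mk : @measurable_fun _ _ (measurableTypeR R) R itv01 (fun r => k (left_limit s r)).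
  rewrite (_ : itv01 = (itv01 `\` N) `|` (itv01 `&` N)); last first.
    by apply/seteqP; split => x /=; [move=> ix; have [|] := EM (N x); [right|left]|case=> -[]].
  apply/measurable_funU; [exact: measurableD|exact: measurableI|split].
    apply: (@measurable_fun_cvgR _ (measurableTypeR R) R _ f).
      by move=> n; apply: measurable_funS (mf n) => //; exact: subDsetl.
    by move=> r [ir Nr]; exact: cf.
  move=> _ B mB; apply: countable_measurableR.
  apply: sub_countable cN; apply: subset_card_le.
  by move=> x [[_ Nx] _].
have := @dominated_convergence _ (measurableTypeR R) R mu itv01 m01 (fun n r => (f n r)%:E)
  (fun r => (k (left_limit s r))%:E) (cst M%:E).
case.
- by move=> n; apply/measurable_EFinP; exact: mf.
- exact/measurable_EFinP.
- exists N; split => //.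
  move=> r /= H; apply: contrapT => Nr; apply: H => ir.
  by apply: cvg_EFin; [exact: nearW|exact: cf].
- by apply: (bounded_mfun_integrable m01 (f01 t)); exact: bounded_mfun_cst.
- by apply: aeW => r n _; rewrite /= lee_fin; exact: stepf_bounded.
move=> ik _ c; apply: fine_cvg; rewrite fineK//.
exact: integrable_fin_num.
Qed.

End partition_limits.

(** * Path functionals of a cadlag process *)

Definition continuous_in {R : realType} (D : set R) (p : R -> R) :=
  forall x, D x -> forall eps, 0 < eps -> exists2 del, 0 < del &
    forall y, D y -> `|x - y| < del -> `|p y - p x| < eps.

Lemma continuous_in_measurable {R : realType} (D : set R) (p : R -> R) :
  measurable D -> continuous_in D p -> measurable_fun D p.
Proof.
move=> mD cp; apply: subspace_continuous_measurable_fun => //.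
apply/subspace_continuousP => x Dx; apply/cvgrPdist_lt => eps e0.
have [del d0 H] := cp x Dx eps e0.
rewrite near_withinE; exists del => // y /= xy Dy.
by rewrite distrC; exact: H.
Qed.

Section continuous_Cplus_facts.
Context {R : realType} (D : set R) (q : R -> R[i]).
Hypothesis hq : continuous_Cplus D q.

Lemma Cplus_continuous_in :
  continuous_in D (fun x => complex.Re (q x)) /\
  continuous_in D (fun x => complex.Im (q x)).
Proof.
have H x eps : D x -> 0 < eps -> exists2 del, 0 < del &
    forall y, D y -> `|x - y| < del -> Normc.normc (q y - q x) < eps.
  move=> Dx e0.
  have /subspace_continuousP/(_ x Dx)/cvgrPdist_lt := Cplus_continuous hq.
  have e0' : 0 < eps%:C by rewrite ltcR.
  move=> /(_ _ e0'); rewrite near_withinE => -[del /= d0 Hd].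
  exists del => // y Dy xy; have := Hd y xy Dy.
  by rewrite distrC ltcR.
split=> x Dx eps e0; have [del d0 Hd] := H x eps Dx e0; exists del => // y Dy xy;
  apply: le_lt_trans (Hd y Dy xy).
- by rewrite -cReN -cReD; exact: abs_Re_le.
- by rewrite -cImN -cImD; exact: abs_Im_le.
Qed.

Lemma Cplus_funP : measurable D -> Cplus_fun D q.
Proof.
move=> mD; have [cr ci] := Cplus_continuous_in.
split; last exact: (Cplus_ge0 hq).
by split; exact: continuous_in_measurable.
Qed.

End continuous_Cplus_facts.

(** Near a time [u] with left limit [l] the function is bounded by [|k u| + |l| + 1]; compactness of
    [[0, T]] turns these local bounds into a global one. *)
Lemma cadlag_on_bounded {R : realType} (T : R) (k : R -> R) : cadlag_on T k ->
  exists M, forall v, 0 <= v -> v <= T -> `|k v| <= M.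
Proof.
move=> kc.
have cK : compact `[0, T]%classic by exact: segment_compact.
have /compact_near_coveringP := cK.
move=> /(_ nat \oo (fun n v => 0 <= v -> v <= T -> `|k v| <= n%:R)) H.
have [|N _ HN] := H; last first.
  by exists N%:R => v v0 vT; apply: (HN N (leqnn N)) => //=; rewrite in_itv/= v0 vT.
move=> u /=; rewrite in_itv/= => /andP[u0 uT].
have [kr kl] := kc u u0 uT.
have [d1 d10 H1] := kr 1 ltr01.
have [l [d2 d20 H2]] : exists l, exists2 d2, 0 < d2 &
    forall v, u - d2 < v -> v < u -> 0 <= v -> `|k v - l| < 1.
  have [u0'|u0'] := ltP 0 u.
    by have [l /(_ 1 ltr01)[d2 d20 H2]] := kl u0'; exists l, d2.
  (* At [u = 0] no nonnegative time precedes [u], so any value serves as [l]. *)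
  exists 0, 1 => // v _ vu v0.
  by have := lt_le_trans (le_lt_trans v0 vu) u0'; rewrite ltxx.
exists ([set v | `|u - v| < Num.min d1 d2], [set n : nat | `|k u| + `|l| + 1 <= n%:R]).
  split => /=.
    by exists (Num.min d1 d2) => //=; rewrite lt_min d10.
  exists (Num.truncn (`|k u| + `|l| + 1)).+1 => // n /= nn.
  by rewrite ltW// (lt_le_trans (truncnS_gt _))// ler_nat.
move=> [v n] /= [+ nn] v0 vT; rewrite lt_min !ltr_norml => /andP[/andP[a1 a2] /andP[a3 a4]].
apply: le_trans nn; have := normr_ge0 l; have := normr_ge0 (k u).
have [uv|vu] := leP u v.
  have hv := H1 v uv _ vT; have {}hv : `|k v - k u| < 1 by apply: hv; lra.
  by have := ler_normD (k v - k u) (k u); rewrite subrK; lra.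
have hv : `|k v - l| < 1 by apply: H2 => //; lra.
by have := ler_normD (k v - l) l; rewrite subrK; lra.
Qed.

Section path_functional.
Context {R : realType} {d : measure_display} {O : measurableType d}.
Context (X : process R O) (S D : set R).
Hypotheses (hS : time_interval S).
Hypothesis hX : markov_process X S D.
Context (T : R) (ST : S T) (w : O) (wT : alive X T w).

(** Setting the path to zero outside [[0, T]] gives a function bounded on the whole line, as the
    limit theorems along partitions assume, and discards positions after [T], where the process may
    have been killed. *)
Definition observed_path (p : R -> R) (v : R) : R :=
  if (0 <= v) && (v <= T) then p (position X v w) else 0.

Lemma observed_pathE p v : 0 <= v -> v <= T -> observed_path p v = p (position X v w).
Proof. by rewrite /observed_path => -> ->. Qed.

(** [cadlag_path] places left limits in [D], where [p] is continuous; this is why [p] along the path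
    has left limits too. *)
Lemma cadlag_observed_path p : continuous_in D p -> cadlag_on T (observed_path p).
Proof.
move=> cp u u0 uT.
have Su : S u by exact: (time_interval_le hS ST).
have [wu _] := alive_mono uT wT.
have [Du cr cl] := markov_cadlag hX Su wu.
have Dv v : 0 <= v -> v <= T -> D (position X v w).
  move=> v0 vT; apply: (alive_state hX); first exact: (time_interval_le hS ST).
  exact: alive_mono wT.
split=> [eps e0|u0'].
  have [del d0 Hd] := cp _ Du eps e0.
  have /cvgrPdist_lt/(_ del d0) := cr.
  rewrite near_withinE => -[del' /= d0' Hd'].
  exists del' => // v uv vd vT.
  have v0 := le_trans u0 uv.
  rewrite !observed_pathE//; move: uv; rewrite le_eqVlt => /predU1P[<-|uv].
    by rewrite subrr normr0.
  apply: Hd; first exact: Dv.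
  apply: Hd' => //=; last exact: (time_interval_le hS ST).
  by rewrite ltr0_norm ?subr_lt0//; lra.
have [l Dl cl'] := cl u0'.
exists (p l) => eps e0.
have [del d0 Hd] := cp _ Dl eps e0.
have /cvgrPdist_lt/(_ del d0) := cl'.
move=> [del' /= d0' Hd']; exists del' => // v dv vu v0.
have vT : v <= T by rewrite (le_trans (ltW vu)).
rewrite observed_pathE//; apply: Hd; first exact: Dv.
by apply: Hd' => //=; rewrite gtr0_norm ?subr_gt0//; lra.
Qed.

Lemma observed_path_bounded p : continuous_in D p ->
  exists M, forall v, `|observed_path p v| <= M.
Proof.
move=> cp; have [M HM] := cadlag_on_bounded (cadlag_observed_path cp).
exists `|M| => v; rewrite /observed_path; case: ifPn => [/andP[v0 vT]|_]; last by rewrite normr0.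
by rewrite -(observed_pathE p v0 vT) (le_trans (HM v v0 vT))// ler_norm.
Qed.

Context (e : nat -> R).
Hypothesis e_dense : forall x y : R, 0 <= x -> x < y -> y <= 1 ->
  exists2 i, x < e i & e i < y.
Context (s t : cumulative R R) (s0 : s 0 = 0) (t0 : t 0 = 0).

Lemma cvg_path_X p : continuous_in D p -> s 1 = T ->
  (forall r, 0 < r -> r < 1 -> left_limit t r <> t r -> exists i, r = e i) ->
  rsum (fun v => p (position X v w)) 0 (jump_steps t s 0 (partition_pts e n)) @[n --> \oo] -->
  \int[lebesgue_stieltjes_measure t]_(r in `]0, 1]) p (position X (left_limit s r) w).
Proof.
move=> cp s1 tdisc; have [M HM] := observed_path_bounded cp.
have := cvg_rsum_X e_dense s0 HM s1 (cadlag_observed_path cp) tdisc.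
rewrite (_ : (fun n => _) = fun n => rsum (fun v =>
  p (position X v w)) 0 (jump_steps t s 0 (partition_pts e n))).
  move=> c; rewrite -[X in _ --> X](_ :
    \int[lebesgue_stieltjes_measure t]_(r in `]0, 1]) observed_path p (left_limit s r) = _)//.
  apply: eq_Rintegral => r /set_mem /=; rewrite in_itv/= => /andP[r0 r1].
  rewrite observed_pathE//; first by rewrite -s0 left_limit_ge.
  by rewrite -s1 (le_trans (left_limit_le s r))// cumulative_le.
apply/funext => n; apply: eq_rsum; first exact/nneg_jump_steps/path_partition_pts.
move=> v v0; rewrite add0r steps_time_jump last_partition_pts s1 s0 subr0 => vT.
by rewrite observed_pathE.
Qed.

Lemma cvg_path_Y p : continuous_in D p -> t 1 = T ->
  rsum (fun v => p (position X v w)) 0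
    (shift_steps 0 (jump_steps t s 0 (partition_pts e n))) @[n --> \oo] -->
  \int[lebesgue_stieltjes_measure s]_(r in `]0, 1]) p (position X (t r) w).
Proof.
move=> cp t1; have [M HM] := observed_path_bounded cp.
have := cvg_rsum_Y (s := s) e_dense HM t1 t0 (cadlag_observed_path cp).
rewrite (_ : (fun n => _) = fun n => rsum (fun v =>
  p (position X v w)) 0 (shift_steps 0 (jump_steps t s 0 (partition_pts e n)))).
  move=> c; rewrite -[X in _ --> X](_ :
    \int[lebesgue_stieltjes_measure s]_(r in `]0, 1]) observed_path p (t r) = _)//.
  apply: eq_Rintegral => r /set_mem /=; rewrite in_itv/= => /andP[r0 r1].
  rewrite observed_pathE//; first by rewrite -t0 cumulative_le// ltW.
  by rewrite -t1 cumulative_le.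
apply/funext => n; apply: eq_rsum.
  by apply: nneg_shift_steps => //; exact/nneg_jump_steps/path_partition_pts.
move=> v v0; rewrite add0r steps_time_shift last_partition_pts t1 t0 subr0 => vT.
by rewrite observed_pathE.
Qed.

End path_functional.

(** The rationals give density. A monotone [t] has left limits everywhere, so its discontinuities
    [left_limit t r <> t r] are left jumps, of which there are countably many. *)
Lemma dense_enumeration {R : realType} (t : cumulative R R) :
  exists e : nat -> R,
    (forall x y : R, 0 <= x -> x < y -> y <= 1 -> exists2 i, x < e i & e i < y) /\
    (forall r, 0 < r -> r < 1 -> left_limit t r <> t r -> exists i, r = e i).
Proof.
have cA : countable (range (@ratr R) `|` left_jumps t).
  rewrite setUC -[left_jumps t `|` _]bigcup2E.
  apply: bigcup_countable => // -[|[|n]] _ /=.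
  - exact: countable_left_jumps.
  - by apply: (sub_countable (card_image_le _ _)); exact: countableP.
  - exact: countable0.
have [e He] := countable_enumeration cA.
exists e; split.
  move=> x y _ xy _; have [a] := rat_in_itvoo xy; rewrite in_itv/= => /andP[xa ay].
  have [|i _ ei] := He (ratr a); first by left; exists a.
  by exists i; rewrite ei.
move=> r r0 _ lr.
have [|i _ ei] := He r; last by exists i.
right; split => //; exists (left_limit t r); last exact/eqP.
move=> eps e0; have [del d0 Hd] := left_limit_near t r e0.
exists del => // v dv vr _; have := Hd v dv; have := left_limit_ge t vr.
by rewrite ltr_norml; lra.
Qed.

(** * Passage to the limit *)

Section steps_op_duality.
Context {R : realType} {d : measure_display} {O : measurableType d}.
Context (X : process R O) (S D D' : set R).
Hypotheses (hS : time_interval S) (mD : measurable D) (mD' : measurable D').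
Hypothesis hX : markov_process X S D.
Context (mu nu : {measure set R -> \bar R}).
Context (U V : (R -> R[i]) -> (R -> R[i])) (q q' : R -> R[i]).
Hypothesis UV : unitaryL2 mu D nu D' U V.
Hypotheses (qP : Cplus_fun D q) (qP' : Cplus_fun D' q').
Hypothesis XUV : forall b, S b -> 0 < b -> forall f, bounded_inL2 mu D f ->
  semigroup X b f = V (expmul q' b (U f)) %[ae mu in D].

Lemma bounded_inL2P h : bounded_inL2 mu D h <-> bounded_mfunC D h /\ (Nsq mu D h < +oo)%E.
Proof.
split=> [[/inL2P[mh fh] bh]|[/bounded_mfunCP[mh bh] fh]].
  by split => //; apply/bounded_mfunCP.
by split => //; apply/inL2P.
Qed.

(** (A1) applies to bounded elements of L^2, so this membership is carried through the induction:
    boundedness comes from the expectations, finiteness of the norm from the unitary expression.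
    Steps of time 0 use [semigroup0] in place of (A1). *)
Lemma steps_op_dual_ops l h : nneg_steps l -> S (steps_time l) ->
  bounded_inL2 mu D h ->
  bounded_inL2 mu D (steps_op X q l h) /\
  steps_op X q l h = dual_ops U V q q' l h %[ae mu in D].
Proof.
move=> + + Bh; have Lh := Bh.1; elim: l => [|[a b] l IH] l0.
  by move=> _; split => //; apply: aeW.
rewrite steps_time_cons => Sl.
have [/= a0 b0 l1] := nneg_steps_cons l0; have t0 := steps_time_ge0 l1.
have Sb : S b by apply: (time_interval_le hS Sl) => //; rewrite lerDl.
have Stl : S (steps_time l) by apply: (time_interval_le hS Sl) => //; rewrite lerDr.
have [Bo oE] := IH l1 Stl.
have Lo := Bo.1; have Ld := inL2_dual_ops mD mD' UV qP qP' l1 Lh.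
have LUd := unitary_dom UV Ld; have LUo := unitary_dom UV Lo.
have LEd := inL2_expmul mD' qP' b0 LUd; have LEo := inL2_expmul mD' qP' b0 LUo.
have VU := unitary_sym mD mD' UV.
have sE : semigroup X b (steps_op X q l h) =
    V (expmul q' b (U (dual_ops U V q q' l h))) %[ae mu in D].
  have e1 : semigroup X b (steps_op X q l h) =
      V (expmul q' b (U (steps_op X q l h))) %[ae mu in D].
    move: b0; rewrite le_eqVlt => /predU1P[b0|b0]; last exact: XUV.
    rewrite -b0 expmul0; have := unitaryK UV Lo; apply: filterS => x e Dx.
    have [bo _] := (bounded_inL2P _).1 Bo.
    by rewrite e// (semigroup0 hS mD hX).
  have e2 : V (expmul q' b (U (steps_op X q l h))) =
      V (expmul q' b (U (dual_ops U V q q' l h))) %[ae mu in D].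
    apply: (unitary_ae_eq mD' mD VU) => //.
    by apply: expmul_ae_eq; exact: (unitary_ae_eq mD mD' UV).
  by apply: filterS2 e1 e2 => x h1 h2 Dx; rewrite h1// h2.
have oE' := expmul_ae_eq q a sE; split => //.
apply/bounded_inL2P.
have [bo _] := (bounded_inL2P _).1 Bo.
have bsl : bounded_mfunC D (steps_op X q ((a, b) :: l) h).
  have [bh _] := (bounded_inL2P _).1 Bh.
  by apply: (bounded_mfunC_steps_op hS mD hX qP) => //; rewrite steps_time_cons.
split => //.
have Lf := inL2_expmul mD qP a0 (unitary_cod UV LEd).
have /inL2P[mf ff] := Lf.
by rewrite (ae_eq_Nsq mD _ mf oE')//; have [] := (bounded_mfunCP _ _).1 bsl.
Qed.

End steps_op_duality.


Section approximation_chain.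
Context {R : realType}.
Context (S T D D' : set R).
Context {dX dY : measure_display} {OX : measurableType dX} {OY : measurableType dY}.
Context (X : process R OX) (Y : process R OY).
Hypotheses (mD : measurable D) (mD' : measurable D').
Context (mu nu : {measure set R -> \bar R}).
Context (U V : (R -> R[i]) -> (R -> R[i])) (q q' : R -> R[i]).
Hypothesis UV : unitaryL2 mu D nu D' U V.
Hypotheses (qP : Cplus_fun D q) (qP' : Cplus_fun D' q').

(** With [Z] and [W] the staircase operators of the two sides, the chain is [bg], [bk], [W k], [W g]
    = [U (Z f)], [U (Z h)], [U bh], [U bf]. Exact duality stands in the middle; each of the six
    remaining links has squared length below [eta], by contractivity for [W k] to [W g] and for
    [U (Z f)] to [U (Z h)]. *)
Lemma duality_distance l f g h k bh bk bf bg (eta : R) : nneg_steps l ->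
  inL2 mu D f -> inL2 nu D' g -> g = U f %[ae nu in D'] ->
  inL2 mu D h -> inL2 nu D' k ->
  inL2 mu D bh -> inL2 nu D' bk -> inL2 mu D bf -> inL2 nu D' bg ->
  bounded_inL2 mu D (steps_op X q l h) ->
  steps_op X q l h = dual_ops U V q q' l h %[ae mu in D] ->
  bounded_inL2 nu D' (steps_op Y q' (shift_steps 0 l) k) ->
  steps_op Y q' (shift_steps 0 l) k =
    dual_ops V U q' q (shift_steps 0 l) k %[ae nu in D'] ->
  (Nsq mu D (fun x => f x - h x)%R < eta%:E)%E ->
  (Nsq nu D' (fun x => g x - k x)%R < eta%:E)%E ->
  (Nsq mu D (fun x => bh x - bf x)%R < eta%:E)%E ->
  (Nsq nu D' (fun x => bk x - bg x)%R < eta%:E)%E ->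
  (Nsq mu D (fun x => steps_op X q l h x - bh x)%R < eta%:E)%E ->
  (Nsq nu D' (fun x => steps_op Y q' (shift_steps 0 l) k x - bk x)%R < eta%:E)%E ->
  (Nsq nu D' (fun x => bg x - U bf x)%R < (40 * eta)%:E)%E.
Proof.
move=> l0 Lf Lg gUf Lh Lk Lbh Lbk Lbf Lbg [Lo _] oE [Lo' _] oE' fh gk bhf bkg ob ob'.
have VU := unitary_sym mD mD' UV.
have l0' := nneg_shift_steps (lexx 0) l0.
have LUf := unitary_dom UV Lf.
have Ldh := inL2_dual_ops mD mD' UV qP qP' l0 Lh.
have Ldf := inL2_dual_ops mD mD' UV qP qP' l0 Lf.
have Ldk := inL2_dual_ops mD' mD VU qP' qP l0' Lk.
have Ldg := inL2_dual_ops mD' mD VU qP' qP l0' Lg.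
have LdUf := inL2_dual_ops mD' mD VU qP' qP l0' LUf.
set W := dual_ops V U q' q (shift_steps 0 l) in Ldk Ldg LdUf oE' *.
set Z := dual_ops U V q q' l in Ldh Ldf oE *.
(* [g] equals [U f] only almost everywhere; since [W] does not increase distances, it does not see
   the difference. *)
have dual : W g = U (Z f) %[ae nu in D'].
  have e1 : W g = W (U f) %[ae nu in D'].
    have /inL2P[m1 _] := Ldg; have /inL2P[m2 _] := LdUf.
    apply: (Nsq0_ae_eq mD' m1 m2); apply/eqP; rewrite eq_le Nsq_ge0 andbT.
    apply: le_trans (Nsq_dual_ops mD' mD VU qP' qP l0' Lg LUf) _.
    have /inL2P[m3 _] := Lg; have /inL2P[m4 _] := LUf.
    by rewrite (ae_eq_Nsq0 mD' m3 m4).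
  have e2 := dual_ops_duality mD mD' UV qP qP' l0 (lexx 0) Lf.
  rewrite expmul0 -/W -/Z in e2.
  by apply: filterS2 e1 e2 => x h1 h2 Dx; rewrite h1// h2.
have L1 := unitary_dom UV Ldf; have L2 := unitary_dom UV Ldh.
have L3 := unitary_dom UV Lbh; have L4 := unitary_dom UV Lbf.
have d12 : (Nsq nu D' (fun x => bg x - W k x)%R < (2 * eta + 2 * eta)%:E)%E.
  apply: (Nsq_triangle_lt mD' Lbg Lbk Ldk); first by rewrite Nsq_subC.
  rewrite Nsq_subC (ae_eq_Nsq_sub mD' Ldk Lo' Lbk Lbk)//.
    by apply: filterS oE' => x h1 Dx; rewrite h1.
  exact: aeW.
have d34 : (Nsq nu D' (fun x => W k x - U (Z h) x)%R < (2 * eta + 2 * eta)%:E)%E.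
  apply: (Nsq_triangle_lt mD' Ldk L1 L2).
    rewrite -(ae_eq_Nsq_sub mD' Ldk Ldk Ldg L1)//; last exact: aeW.
    apply: le_lt_trans (Nsq_dual_ops mD' mD VU qP' qP l0' Lk Lg) _.
    by rewrite Nsq_subC.
  rewrite (unitary_dist mD mD' UV Ldf Ldh).
  exact: le_lt_trans (Nsq_dual_ops mD mD' UV qP qP' l0 Lf Lh) fh.
have d56 : (Nsq nu D' (fun x => U (Z h) x - U bf x)%R < (2 * eta + 2 * eta)%:E)%E.
  apply: (Nsq_triangle_lt mD' L2 L3 L4).
    rewrite (unitary_dist mD mD' UV Ldh Lbh) (ae_eq_Nsq_sub mD Ldh Lo Lbh Lbh)//.
      by apply: filterS oE => x h1 Dx; rewrite h1.
    exact: aeW.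
  by rewrite (unitary_dist mD mD' UV Lbh Lbf).
(* Each pair of links costs [4 * eta]. Joining two pairs gives 2 (4 + 4) = 16, and adding the third
   gives 2 (16 + 4) = 40. *)
have := Nsq_triangle_lt mD' Lbg L2 L4 (Nsq_triangle_lt mD' Lbg Ldk L2 d12 d34) d56.
by congr (_ < _%:E)%E; ring.
Qed.

End approximation_chain.

Theorem theorem2p2 (R : realType)
    (S T : set R) (hS : time_interval S) (hT : time_interval T)
    (XX YY : set R) (hXX : state_space XX) (hYY : state_space YY)
    (dX dY : measure_display) (OX : measurableType dX) (OY : measurableType dY)
    (X : process R OX) (hX : markov_process X S XX)
    (Y : process R OY) (hY : markov_process Y T YY)
    (mu nu : {measure set R -> \bar R})
    (F Finv : (R -> R[i]) -> (R -> R[i])) (phi psi : R -> R[i])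
    (A1 : dual_semigroups X S XX Y T YY mu nu F Finv phi psi)
    (hmu : excessive X S XX mu) (hnu : excessive Y T YY nu)
    (sE tE : R) (hsE : S sE) (htE : T tE)
    (s t : cumulative R R)
    (s0 : s 0 = 0) (s1 : s 1 = sE) (t0 : t 0 = 0) (t1 : t 1 = tE)
    (f g : R -> R[i]) (hf : inL2 mu XX f) (hg : inL2 nu YY g)
    (hgf : g = F f %[ae nu in YY]) :
  let EX (h : R -> R[i]) := expectation_alive X sE (fun w =>
    expC (- stieltjes01 t (fun r => psi (position X (left_limit s r) w))) *
    h (position X sE w)) in
  let EY (h : R -> R[i]) := expectation_alive Y tE (fun w =>
    expC (- stieltjes01 s (fun r => phi (position Y (t r) w))) *
    h (position Y tE w)) in
  [/\ exists BX, continuous_extensionL2 mu XX EX BX,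
      exists BY, continuous_extensionL2 nu YY EY BY
    & forall BX BY,
        continuous_extensionL2 mu XX EX BX ->
        continuous_extensionL2 nu YY EY BY ->
        inL2 mu XX (BX f) /\ BY g = F (BX f) %[ae nu in YY]].
Proof.
move=> EX EY.
have mXX := state_space_measurable hXX; have mYY := state_space_measurable hYY.
have UV := dual_unitary A1.
have qP := Cplus_funP (dual_psi A1) mXX; have qP' := Cplus_funP (dual_phi A1) mYY.
have [psir psii] := Cplus_continuous_in (dual_psi A1).
have [phir phii] := Cplus_continuous_in (dual_phi A1).
have [e [e_dense e_disc]] := dense_enumeration t.
pose l n := jump_steps t s 0 (partition_pts e n).
have l0 n : nneg_steps (l n) by exact/nneg_jump_steps/path_partition_pts.
have lX n : steps_time (l n) = sE.
  by rewrite steps_time_jump last_partition_pts s1 s0 subr0.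
(* Both processes use the same partition; the shift turns the multipliers, which are increments of
   [t], into running times of Y, and conversely for [s]. *)
have l0' n : nneg_steps (shift_steps 0 (l n)) by exact: nneg_shift_steps.
have lY n : steps_time (shift_steps 0 (l n)) = tE.
  by rewrite steps_time_shift last_partition_pts t1 t0 subr0.
have JXr w : alive X sE w ->
    complex.Re (steps_sum (fun v => psi (position X v w)) 0 (l n)) @[n --> \oo] -->
    complex.Re (stieltjes01 t (fun r => psi (position X (left_limit s r) w))).
  move=> wX; under eq_fun do rewrite Re_steps_sum.
  exact: (cvg_path_X hS hX hsE wX e_dense s0 psir s1 e_disc).
have JXi w : alive X sE w ->
    complex.Im (steps_sum (fun v => psi (position X v w)) 0 (l n)) @[n --> \oo] -->
    complex.Im (stieltjes01 t (fun r => psi (position X (left_limit s r) w))).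
  move=> wX; under eq_fun do rewrite Im_steps_sum.
  exact: (cvg_path_X hS hX hsE wX e_dense s0 psii s1 e_disc).
have JYr w : alive Y tE w ->
    complex.Re (steps_sum (fun v => phi (position Y v w)) 0 (shift_steps 0 (l n))) @[n --> \oo] -->
    complex.Re (stieltjes01 s (fun r => phi (position Y (t r) w))).
  move=> wY; under eq_fun do rewrite Re_steps_sum.
  exact: (cvg_path_Y (s := s) hT hY htE wY e_dense t0 phir t1).
have JYi w : alive Y tE w ->
    complex.Im (steps_sum (fun v => phi (position Y v w)) 0 (shift_steps 0 (l n))) @[n --> \oo] -->
    complex.Im (stieltjes01 s (fun r => phi (position Y (t r) w))).
  move=> wY; under eq_fun do rewrite Im_steps_sum.
  exact: (cvg_path_Y (s := s) hT hY htE wY e_dense t0 phii t1).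
have XUV b : S b -> 0 < b -> forall h, bounded_inL2 mu XX h ->
    semigroup X b h = Finv (expmul phi b (F h)) %[ae mu in XX].
  move=> Sb b0 h Bh; have := dual_semigroup1 A1 (time_interval0 hS) Sb b0 Bh.
  by rewrite subr0 sub0r.
have YVU b : T b -> 0 < b -> forall h, bounded_inL2 nu YY h ->
    semigroup Y b h = F (expmul psi b (Finv h)) %[ae nu in YY].
  move=> Tb b0 h Bh; have := dual_semigroup2 A1 (time_interval0 hT) Tb b0 Bh.
  by rewrite subr0 sub0r.
split.
- exact: (EX_has_extension hS mXX hX hmu qP hsE l0 lX JXr JXi).
- exact: (EX_has_extension hT mYY hY hnu qP' htE l0' lY JYr JYi).
move=> BX BY hBX hBY; split; first exact: (extension_dom hBX).
have LBX := extension_dom hBX hf; have LBY := extension_dom hBY hg.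
have LUB := unitary_dom UV LBX.
have /inL2P[m1 _] := LBY; have /inL2P[m2 _] := LUB.
apply: (Nsq_small_ae_eq mYY m1 m2) => eps eps0.
have eta0 : 0 < eps / 40 by rewrite divr_gt0.
(* [h] and [k] are unrelated: [F h] might be unbounded, and then it could not serve as [k]. *)
have [h [Bh fh bhf nh]] := extension_approx hS mXX hX hmu qP hsE l0 lX JXr JXi hBX hf eta0.
have [k [Bk gk bkg nk]] := extension_approx hT mYY hY hnu qP' htE l0' lY JYr JYi hBY hg eta0.
(* Duality relates the two sides only along the same staircase, so both approximations must be good
   at a common index. *)
have [n nhk] : exists n,
    (Nsq mu XX (fun x => steps_op X psi (l n) h x - BX h x)%R < (eps / 40)%:E)%E /\
    (Nsq nu YY (fun x => steps_op Y phi (shift_steps 0 (l n)) k x - BY k x)%R < (eps / 40)%:E)%E.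
  have [N1 _ H1] := nh; have [N2 _ H2] := nk.
  by exists (maxn N1 N2); split; [apply: H1|apply: H2]; rewrite /= ?leq_maxl ?leq_maxr.
case: nhk => nX nY.
have [Bo oE] := steps_op_dual_ops hS mXX mYY hX UV qP qP' XUV (@l0 n)
  (eq_ind_r S hsE (lX n)) Bh.
have [Bo' oE'] := steps_op_dual_ops hT mYY mXX hY (unitary_sym mXX mYY UV) qP' qP YVU (@l0' n)
  (eq_ind_r T htE (lY n)) Bk.
have -> : eps = 40 * (eps / 40) by rewrite mulrC divfK// pnatr_eq0.
apply: (duality_distance mXX mYY UV qP qP' (@l0 n) hf hg hgf Bh.1 Bk.1
  (extension_dom hBX Bh.1) (extension_dom hBY Bk.1) LBX LBY Bo oE Bo' oE' fh gk bhf bkg nX nY).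
Qed.
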